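(* Let $\frac12<\alpha\le1$, $s>\frac12$, $a\le 2\alpha-1$, $\sigma\in\{+1,-1\}$, $u_0\in H^s(\mathbb{T})$, and let $u$ be the solution of $$iu_t+(-\Delta)^{\alpha}u=\sigma|u|^2u,\quad x\in\mathbb{T},\qquad u(x,0)=u_0(x).$$ Put $P=\frac1\pi\|u_0\|_{L^2(\mathbb{T})}^2$. Then $u(t)-e^{it(-\Delta)^\alpha-i\sigma Pt}u_0\in C^0_tH^{s+a}_x$, and for every $s_0$ with $\frac12<s_0\le s$, $$\big\|u(t)-e^{it(-\Delta)^\alpha-i\sigma Pt}u_0\big\|_{H^{s+a}}\lesssim \|u_0\|_{H^s}\big(1+\|u_0\|_{H^{s_0}}^2\big)+\|u(t)\|_{H^s}\|u(t)\|_{H^{s_0}}^2+\Big|\int_0^t\|u(t')\|_{H^s}\big(\|u(t')\|_{H^{s_0}}^2+\|u(t')\|_{H^{s_0}}^4\big)\,dt'\Big|$$ for all $t$ in the maximal interval of existence, with implicit constant depending only on $\alpha,s,a,s_0$. In particular, for $s\ge\alpha$ and $a\le2\alpha-1$, $$\big\|u(t)-e^{it(-\Delta)^\alpha-i\sigma Pt}u_0\big\|_{H^{s+a}}\lesssim\|u_0\|_{H^s}+\|u(t)\|_{H^s}+\Big|\int_0^t\|u(t')\|_{H^s}\,dt'\Big|$$ for all $t$, with implicit constant depending only on $\alpha,s,a$ and $\|u_0\|_{H^\alpha}$.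
   Context: $\mathbb{T}=\mathbb{R}/2\pi\mathbb{Z}$, $\widehat f(k)=\frac1{2\pi}\int_0^{2\pi}f(x)e^{-ikx}dx$, $\langle k\rangle=(1+k^2)^{1/2}$, $\|f\|_{H^s(\mathbb{T})}=\big(\sum_{k\in\mathbb{Z}}\langle k\rangle^{2s}|\widehat f(k)|^2\big)^{1/2}$, and $\|f\|_{L^2(\mathbb{T})}^2=\int_0^{2\pi}|f|^2dx$. The operator $(-\Delta)^\alpha$ has Fourier multiplier $|k|^{2\alpha}$, and $e^{it(-\Delta)^\alpha-i\sigma Pt}=e^{-i\sigma Pt}e^{it(-\Delta)^\alpha}$ where $e^{it(-\Delta)^\alpha}$ has multiplier $e^{it|k|^{2\alpha}}$. For $s>\frac12$ the equation is locally well posed in $H^s(\mathbb{T})$, and ''the solution'' means the unique solution in $C_tH^s_x$ on its maximal interval of existence. For $s\ge\alpha$ solutions are global in time, by conservation of mass and energy. *)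

(* Defs.v *)
From mathcomp Require Import all_boot all_order all_algebra.
From mathcomp Require Import all_classical all_reals all_analysis.
From mathcomp Require Export complex.
Import Order.TTheory GRing.Theory Num.Theory.
Import numFieldNormedType.Exports.

Set Implicit Arguments.
Unset Strict Implicit.
Unset Printing Implicit Defensive.

Local Open Scope classical_set_scope.
Local Open Scope complex_scope.
Local Open Scope ring_scope.

Section Torus.
Context {R : realType}.
Local Notation mu := (@lebesgue_measure R).
Local Notation re := (@complex.Re R).
Local Notation im := (@complex.Im R).
Local Notation normc := (@ComplexField.Normc.normc R).
Implicit Types (f g : R -> R[i]) (r : R) (k : int).

Definition cis (theta : R) : R[i] := cos theta +i* sin theta.

(* A function on T = R/2piZ is a 2pi-periodic function on R, and integrals
   over T are Lebesgue integrals over [0, 2pi].  Functions that agree almost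
   everywhere represent the same element of L^2(T). *)
Definition torus_cint f : R[i] :=
  (\int[mu]_(x in `[0%R, 2 * pi]) re (f x))%R +i*
  (\int[mu]_(x in `[0%R, 2 * pi]) im (f x))%R.

Definition L2T f : Prop :=
  [/\ forall x, f (x + 2 * pi) = f x,
      measurable_fun setT (re \o f),
      measurable_fun setT (im \o f) &
      (\int[mu]_(x in `[0%R, (2 * pi)%R]) (normc (f x) ^+ 2)%:E < +oo)%E].

Definition L2norm f : R :=
  Num.sqrt (\int[mu]_(x in `[0, 2 * pi]) (normc (f x) ^+ 2)).

Definition fcoef f k : R[i] :=
  ((2 * pi)^-1)%:C * torus_cint (fun x => f x * cis (- (k%:~R * x))).

Definition japanese k : R := Num.sqrt (1 + k%:~R ^+ 2).

Definition Hnorm2 r f : \bar R :=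
  \esum_(k in [set: int])
    (japanese k `^ (2 * r) * normc (fcoef f k) ^+ 2)%:E.

(* For r < 0 this is the set of those elements of H^r(T) that are L^2
   functions. *)
Definition inH r f : Prop := L2T f /\ (Hnorm2 r f < +oo)%E.

(* Meaningful only when Hnorm2 r f is finite. *)
Definition Hnorm r f : R := Num.sqrt (fine (Hnorm2 r f)).

Definition CtH r (I : set R) (w : R -> R -> R[i]) : Prop :=
  (forall t, I t -> inH r (w t)) /\
  (forall t0, I t0 ->
    Hnorm r (fun x => w t x - w t0 x) @[t --> within I (nbhs t0)] --> (0 : R)).

(* An L^2 function with Fourier coefficients m k * fcoef f k; it is unique up
   to a.e. equality, and exists whenever m is bounded and f is in L^2(T). *)
Definition fourier_multiplier (m : int -> R[i]) f : R -> R[i] :=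
  xget (fun=> 0) [set g | L2T g /\ forall k, fcoef g k = m k * fcoef f k].

Definition frac_symbol (alpha : R) k : R := `|k%:~R : R| `^ (2 * alpha).

Definition free_evol (alpha t : R) f : R -> R[i] :=
  fourier_multiplier (fun k => cis (t * frac_symbol alpha k)) f.

Definition phased_evol (alpha sigma P t : R) f : R -> R[i] :=
  fun x => cis (- (sigma * P * t)) * free_evol alpha t f x.

Definition cderive_at (z : R -> R[i]) (t : R) (d : R[i]) : Prop :=
  is_derive t (1 : R) (re \o z) (re d) /\
  is_derive t (1 : R) (im \o z) (im d).

Definition cubic f : R -> R[i] := fun x => (normc (f x) ^+ 2)%:C * f x.

(* i u_t + (-Delta)^alpha u = sigma |u|^2 u in the sense of distributions.
   Since (-Delta)^alpha u need not be a function, the equation is tested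
   against e^{-ikx} in space; all the terms except the time derivative are then
   continuous in t when s > 1/2, so the time derivative is a classical one. *)
Definition fNLS_solution (alpha s sigma : R) (u0 : R -> R[i]) (I : set R)
    (u : R -> R -> R[i]) : Prop :=
  [/\ [/\ open I, is_interval I & I 0],
      CtH s I u,
      u 0 = u0 %[ae mu] &
      forall t, I t -> forall k, exists2 d,
        cderive_at (fun t' => fcoef (u t') k) t d &
        (0 +i* 1)%C * d + (frac_symbol alpha k)%:C * fcoef (u t) k
          = sigma%:C * fcoef (cubic (u t)) k].

Definition fNLS_maximal_solution (alpha s sigma : R) (u0 : R -> R[i])
    (I : set R) (u : R -> R -> R[i]) : Prop :=
  fNLS_solution alpha s sigma u0 I u /\
  forall (J : set R) (v : R -> R -> R[i]),
    fNLS_solution alpha s sigma u0 J v -> I `<=` J ->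
    (forall t, I t -> v t = u t %[ae mu]) -> J `<=` I.

Definition oriented_integral (a b : R) (h : R -> R) : R :=
  if a <= b then (\int[mu]_(t in `[a, b]) h t)%R
  else - (\int[mu]_(t in `[b, a]) h t)%R.

Definition smoothing_diff (alpha sigma : R) (u0 : R -> R[i])
    (u : R -> R -> R[i]) (t : R) : R -> R[i] :=
  let P := pi^-1 * L2norm u0 ^+ 2 in
  fun x => u t x - phased_evol alpha sigma P t u0 x.

End Torus.

(* Main.v *)
(** In Fourier coefficients the equation reads c_k' = i |k|^(2 alpha) c_k
    - i sigma (cubic convolution)_k.  In the convolution the terms a = k and
    b = k (indices a + b - l = k) are resonant: by conservation of mass they
    contribute sigma P c_k, which is removed by the phase e^(-i sigma P t), and
    - sigma |c_k|^2 c_k, which gains 2 s0 > 1 derivatives.  For the other terms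
    the phase Psi = |a|^(2 alpha) - |l|^(2 alpha) + |b|^(2 alpha) - |k|^(2 alpha)
    is at least a multiple of
    |a - k| |b - k| (|k| + |a - k| + |b - k|)^(2 alpha - 2), so a normal form
    (integration by parts in time) replaces the cubic sum by a boundary term and
    a quintic sum that carry the factor 1/Psi; the bound on Psi yields
    2 alpha - 1 derivatives.  The transformation is carried out for the
    frequencies |k| <= K and the error vanishes, uniformly on compact time
    intervals, as K tends to infinity.  When s >= alpha, conservation of mass and
    energy bounds the H^alpha norm by a function of its initial value. *)
Require Import Defs.
From mathcomp Require Import all_boot all_order all_algebra.
From mathcomp Require Import all_classical all_reals all_analysis.
From mathcomp Require Import measurable_realfun.
From mathcomp Require Import ring lra zify.
Import Order.TTheory GRing.Theory Num.Theory.
Import numFieldNormedType.Exports.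

Set Implicit Arguments.
Unset Strict Implicit.
Unset Printing Implicit Defensive.

Local Open Scope classical_set_scope.
Local Open Scope ring_scope.

(** * Weighted sequences and trilinear sums *)

Section FiniteSums.
Context {R : realType}.

(** The exact coefficients are inserted into sums over |k| <= K, so conservation of mass, the normal
    form and conservation of energy hold only up to the difference between the true cubic
    coefficient and the truncated convolution. For mass and normal form this difference is
    controlled uniformly in k but not in a weighted l2 norm. The obstacle is met by fixing a finite
    set S of frequencies, choosing K after S, and obtaining a bound independent of S; hence norms
    are expressed throughout as bounds on all finite partial sums. The energy carries the factor
    |k|^(2 alpha), for which a uniform bound in k is too weak; there the difference is shown to be
    small in H^alpha, by means of the trilinear estimates in that space. The number P equals 2 sum
    |c_k|^2 at time 0, since the squared L2 norm is 2 pi times that sum; the factor 2 matches the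
    two resonances a = k and b = k. The phase is a mixed second difference of |x|^(2 alpha) at k
    with steps a - k and b - k. Its second derivative is singular at 0 when alpha < 1, so the lower
    bound comes from monotonicity of the first derivative. *)

Lemma ler_sum_uniq_sub (T : eqType) (s s' : seq T) (F : T -> R) :
  uniq s -> {subset s <= s'} -> (forall x, 0 <= F x) ->
  \sum_(x <- s) F x <= \sum_(x <- s') F x.
Proof.
move=> + + F0; elim: s s' => [|x s ih] s' /=.
  by rewrite big_nil => _ _; apply: sumr_ge0.
move=> /andP[xs us] ss'; rewrite big_cons [leRHS](big_rem x) /=; last first.
  by apply: ss'; rewrite mem_head.
rewrite lerD2l; apply: ih => // y ys.
have : y \in s' by apply: ss'; rewrite inE ys orbT.
rewrite (perm_mem (perm_to_rem (ss' x (mem_head _ _)))) inE => /orP[/eqP yx|//].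
by rewrite yx (negPf xs) in ys.
Qed.

(** Lagrange's identity: the nonnegative double sum of w_i w_j (x_i y_j - x_j y_i)^2 equals twice
    the difference of the two sides. *)
Lemma weighted_cauchy_schwarz (I : Type) (s : seq I) (w x y : I -> R) :
  (forall i, 0 <= w i) ->
  (\sum_(i <- s) w i * x i * y i) ^+ 2 <=
  (\sum_(i <- s) w i * x i ^+ 2) * (\sum_(i <- s) w i * y i ^+ 2).
Proof.
move=> w0.
have : 0 <= \sum_(i <- s) \sum_(j <- s) w i * w j * (x i * y j - x j * y i) ^+ 2.
  by do 2!(apply: sumr_ge0 => ? _); rewrite mulr_ge0 ?sqr_ge0 ?mulr_ge0.
set A := \sum_(i <- s) w i * x i ^+ 2; set B := \sum_(i <- s) w i * y i ^+ 2.
set C := \sum_(i <- s) w i * x i * y i.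
suff -> : \sum_(i <- s) \sum_(j <- s) w i * w j * (x i * y j - x j * y i) ^+ 2
    = 2 * (A * B - C ^+ 2) by lra.
transitivity (\sum_(i <- s) ((w i * x i ^+ 2) * B + (w i * y i ^+ 2) * A
                             - 2 * (w i * x i * y i) * C)).
  apply: eq_bigr => i _; rewrite !mulr_sumr -big_split /= -sumrB.
  by apply: eq_bigr => j _; ring.
rewrite sumrB big_split /= -!mulr_suml -mulr_sumr -/A -/B -/C; ring.
Qed.

Lemma cauchy_schwarz (I : Type) (s : seq I) (x y : I -> R) :
  (\sum_(i <- s) x i * y i) ^+ 2 <=
  (\sum_(i <- s) x i ^+ 2) * (\sum_(i <- s) y i ^+ 2).
Proof.
have := @weighted_cauchy_schwarz I s (fun=> 1) x y (fun=> ler01).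
by under eq_bigr do rewrite mul1r; under [X in X * _]eq_bigr do rewrite mul1r;
  under [X in _ * X]eq_bigr do rewrite mul1r.
Qed.

Lemma weighted_cauchy_schwarz2 (I J : Type) (s : seq I) (r : seq J)
    (w x y : I -> J -> R) :
  (forall i j, 0 <= w i j) ->
  (\sum_(i <- s) \sum_(j <- r) w i j * x i j * y i j) ^+ 2 <=
  (\sum_(i <- s) \sum_(j <- r) w i j * x i j ^+ 2) *
  (\sum_(i <- s) \sum_(j <- r) w i j * y i j ^+ 2).
Proof.
move=> w0.
have := @weighted_cauchy_schwarz _ [seq (i, j) | i <- s, j <- r]
  (fun p => w p.1 p.2) (fun p => x p.1 p.2) (fun p => y p.1 p.2)
  (fun p => w0 p.1 p.2).
by rewrite !big_allpairs.
Qed.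

Lemma minkowski_le (I : Type) (s : seq I) (x y : I -> R) (a b : R) :
  0 <= a -> 0 <= b ->
  \sum_(i <- s) x i ^+ 2 <= a ^+ 2 -> \sum_(i <- s) y i ^+ 2 <= b ^+ 2 ->
  \sum_(i <- s) (x i + y i) ^+ 2 <= (a + b) ^+ 2.
Proof.
move=> a0 b0 xa yb.
have sy0 : 0 <= \sum_(i <- s) y i ^+ 2 by apply: sumr_ge0 => i _; apply: sqr_ge0.
have xy : \sum_(i <- s) x i * y i <= a * b.
  rewrite (le_trans (ler_norm _))// -(@ler_pXn2r _ 2) ?nnegrE ?mulr_ge0//.
  rewrite real_normK ?num_real// exprMn; apply: le_trans (cauchy_schwarz _ _ _) _.
  by apply: ler_pM => //; apply: sumr_ge0 => i _; apply: sqr_ge0.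
under eq_bigr do rewrite sqrrD -mulr_natl.
by rewrite !big_split /= -mulr_sumr; lra.
Qed.

(** For nonnegative [F] this says that the l1 norm is at most [A], without naming an infinite sum:
    an estimate uniform over finite sets already is the estimate of the series. *)
Definition l1le (T : eqType) (F : T -> R) (A : R) :=
  forall S : seq T, uniq S -> \sum_(x <- S) F x <= A.

Lemma l1le_ge0 (T : eqType) (F : T -> R) A : l1le F A -> 0 <= A.
Proof. by move/(_ [::] isT); rewrite big_nil. Qed.

Lemma l1le_inj (T U : eqType) (F : T -> R) A (phi : U -> T) (S : seq U) :
  injective phi -> l1le F A -> uniq S -> \sum_(x <- S) F (phi x) <= A.
Proof.
move=> phiI FA uS; have := FA (map phi S); rewrite big_map => -> //.
by rewrite map_inj_uniq.
Qed.

Implicit Types (f g h : int -> R) (S B : seq int).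

(** Young's inequality l2 * l1 * l1 -> l2. For fixed k the weights g(a + c - k) h(c) have total mass
    at most G H, so Cauchy-Schwarz with these weights leaves f(a)^2 times weights, and summing over
    k first, then c, gives another factor G H. *)
Lemma young_fst f g h S B A G H :
  (forall k, 0 <= f k) -> (forall k, 0 <= g k) -> (forall k, 0 <= h k) ->
  uniq S -> uniq B ->
  l1le (fun k => f k ^+ 2) (A ^+ 2) -> l1le g G -> l1le h H ->
  \sum_(k <- S) (\sum_(a <- B) \sum_(c <- B) f a * g (a + c - k) * h c) ^+ 2
  <= (A * G * H) ^+ 2.
Proof.
move=> f0 g0 h0 uS uB fA gG hH; have G0 := l1le_ge0 gG; have H0 := l1le_ge0 hH.
have ghk k : \sum_(a <- B) \sum_(c <- B) g (a + c - k) * h c <= G * H.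
  rewrite exchange_big /=.
  apply: (@le_trans _ _ (\sum_(c <- B) G * h c)).
    apply: ler_sum => c _; rewrite -mulr_suml ler_wpM2r //.
    by apply: (l1le_inj (phi := fun a => a + c - k)) => // x y /addIr /addIr.
  by rewrite -mulr_sumr ler_wpM2l // hH.
apply: (@le_trans _ _ (\sum_(k <- S)
    (\sum_(a <- B) \sum_(c <- B) g (a + c - k) * h c * f a ^+ 2) * (G * H))).
  apply: ler_sum => k _.
  have := weighted_cauchy_schwarz2 B B (w := fun a c => g (a + c - k) * h c)
    (fun a _ => f a) (fun _ _ => 1) (fun a c => mulr_ge0 (g0 _) (h0 _)).
  under eq_bigr do under eq_bigr do rewrite mulr1 mulrC mulrA.
  move/le_trans; apply; rewrite ler_wpM2l //.
    by apply: sumr_ge0 => a _; apply: sumr_ge0 => c _; rewrite !mulr_ge0 ?sqr_ge0.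
  by under eq_bigr do under eq_bigr do rewrite expr1n mulr1.
rewrite -mulr_suml.
suff : \sum_(k <- S) \sum_(a <- B) \sum_(c <- B) g (a + c - k) * h c * f a ^+ 2
   <= A ^+ 2 * (G * H).
  by move=> /(ler_wpM2r (mulr_ge0 G0 H0)) /le_trans; apply; lra.
rewrite exchange_big /=.
apply: (@le_trans _ _ (\sum_(a <- B) f a ^+ 2 * (G * H))); last first.
  by rewrite -mulr_suml ler_wpM2r ?mulr_ge0 // fA.
apply: ler_sum => a _; rewrite exchange_big /=.
apply: (@le_trans _ _ (\sum_(c <- B) f a ^+ 2 * G * h c)); last first.
  by rewrite -mulr_sumr -mulrA ler_wpM2l ?sqr_ge0 // ler_wpM2l // hH.
apply: ler_sum => c _; rewrite -!mulr_suml -mulrA [leRHS]mulrAC [leRHS]mulrC.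
rewrite [f a ^+ 2 * _]mulrC ler_wpM2r ?mulr_ge0 ?sqr_ge0 //.
by apply: (l1le_inj (phi := fun k => a + c - k)) => // x y /addrI /oppr_inj.
Qed.

(** Here the Cauchy-Schwarz weights are f(a) h(c), whose total mass does not depend on k; the l2
    factor g is then summed along k. *)
Lemma young_mid f g h S B A G H :
  (forall k, 0 <= f k) -> (forall k, 0 <= g k) -> (forall k, 0 <= h k) ->
  uniq S -> uniq B ->
  l1le f A -> l1le (fun k => g k ^+ 2) (G ^+ 2) -> l1le h H ->
  \sum_(k <- S) (\sum_(a <- B) \sum_(c <- B) f a * g (a + c - k) * h c) ^+ 2
  <= (A * G * H) ^+ 2.
Proof.
move=> f0 g0 h0 uS uB fA gG hH; have A0 := l1le_ge0 fA; have H0 := l1le_ge0 hH.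
have fh : \sum_(a <- B) \sum_(c <- B) f a * h c <= A * H.
  rewrite -big_distrlr /= ler_pM ?sumr_ge0 //; [exact: fA|exact: hH].
apply: (@le_trans _ _ (\sum_(k <- S)
    (\sum_(a <- B) \sum_(c <- B) f a * h c * g (a + c - k) ^+ 2) * (A * H))).
  apply: ler_sum => k _.
  have := weighted_cauchy_schwarz2 B B (w := fun a c => f a * h c)
    (fun a c => g (a + c - k)) (fun _ _ => 1) (fun a c => mulr_ge0 (f0 _) (h0 _)).
  under eq_bigr do under eq_bigr do rewrite mulr1 mulrAC.
  move/le_trans; apply; rewrite ler_wpM2l //.
    by apply: sumr_ge0 => a _; apply: sumr_ge0 => c _; rewrite !mulr_ge0 ?sqr_ge0.
  by under eq_bigr do under eq_bigr do rewrite expr1n mulr1.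
rewrite -mulr_suml.
suff : \sum_(k <- S) \sum_(a <- B) \sum_(c <- B) f a * h c * g (a + c - k) ^+ 2
   <= G ^+ 2 * (A * H).
  by move=> /(ler_wpM2r (mulr_ge0 A0 H0)) /le_trans; apply; lra.
rewrite exchange_big /= mulrC.
apply: (@le_trans _ _ ((\sum_(a <- B) \sum_(c <- B) f a * h c) * G ^+ 2)); last first.
  by rewrite ler_wpM2r ?sqr_ge0.
rewrite mulr_suml; apply: ler_sum => a _; rewrite exchange_big mulr_suml.
apply: ler_sum => c _; rewrite -mulr_sumr ler_wpM2l ?mulr_ge0 //.
by apply: (l1le_inj (phi := fun k => a + c - k) (F := fun k => g k ^+ 2)) =>
  // x y /addrI /oppr_inj.
Qed.

Lemma young_lst f g h S B A G H :
  (forall k, 0 <= f k) -> (forall k, 0 <= g k) -> (forall k, 0 <= h k) ->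
  uniq S -> uniq B ->
  l1le f A -> l1le g G -> l1le (fun k => h k ^+ 2) (H ^+ 2) ->
  \sum_(k <- S) (\sum_(a <- B) \sum_(c <- B) f a * g (a + c - k) * h c) ^+ 2
  <= (A * G * H) ^+ 2.
Proof.
move=> f0 g0 h0 uS uB fA gG hH; rewrite [A * G * H]mulrC mulrA mulrAC.
apply: le_trans (young_fst h0 g0 f0 uS uB hH gG fA).
rewrite le_eqVlt; apply/orP; left; apply/eqP; apply: eq_bigr => k _; congr (_ ^+ 2).
rewrite exchange_big /=; do 2!(apply: eq_bigr => ? _).
by rewrite [X in g (X - k)]addrC; ring.
Qed.

(** All three factors are only in l2. The square summability of w(a - k) w(c - k) in (a, c), uniform
    in k, pays for Cauchy-Schwarz, and the remaining sum of squares over (k, a, c) factorizes. *)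
Lemma l2_trilinear (w : int -> R) f g h S B W A G H :
  uniq S -> uniq B ->
  l1le (fun k => w k ^+ 2) W ->
  l1le (fun k => f k ^+ 2) (A ^+ 2) -> l1le (fun k => g k ^+ 2) (G ^+ 2) ->
  l1le (fun k => h k ^+ 2) (H ^+ 2) ->
  \sum_(k <- S) (\sum_(a <- B) \sum_(c <- B)
     w (a - k) * w (c - k) * (f a * g (a + c - k) * h c)) ^+ 2
  <= (W * (A * G * H)) ^+ 2.
Proof.
move=> uS uB wW fA gG hH; have W0 := l1le_ge0 wW.
have ww k : \sum_(a <- B) \sum_(c <- B) (w (a - k) * w (c - k)) ^+ 2 <= W ^+ 2.
  under eq_bigr do under eq_bigr do rewrite exprMn.
  rewrite -big_distrlr /= expr2.
  have wk : \sum_(a <- B) w (a - k) ^+ 2 <= W.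
    by apply: (l1le_inj (phi := fun a => a - k) (F := fun k => w k ^+ 2)) =>
      // x y /addIr.
  by rewrite ler_pM // sumr_ge0 // => *; rewrite sqr_ge0.
apply: (@le_trans _ _ (\sum_(k <- S) W ^+ 2 *
    (\sum_(a <- B) \sum_(c <- B) (f a * g (a + c - k) * h c) ^+ 2))).
  apply: ler_sum => k _.
  have := weighted_cauchy_schwarz2 B B (w := fun _ _ => 1)
    (fun a c => w (a - k) * w (c - k)) (fun a c => f a * g (a + c - k) * h c)
    (fun _ _ => ler01).
  under eq_bigr do under eq_bigr do rewrite mul1r.
  move/le_trans; apply.
  under eq_bigr do under eq_bigr do rewrite mul1r.
  under [X in _ * X]eq_bigr do under eq_bigr do rewrite mul1r.
  apply: ler_wpM2r; last exact: ww.
  by apply: sumr_ge0 => a _; apply: sumr_ge0 => c _; rewrite sqr_ge0.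
rewrite -mulr_sumr exprMn; apply: ler_wpM2l; first exact: sqr_ge0.
rewrite exchange_big /=.
apply: (@le_trans _ _ (\sum_(a <- B) \sum_(c <- B) f a ^+ 2 * h c ^+ 2 * G ^+ 2)).
  apply: ler_sum => a _; rewrite exchange_big; apply: ler_sum => c _ /=.
  under eq_bigr do rewrite !exprMn mulrAC.
  rewrite -mulr_sumr; apply: ler_wpM2l; first by rewrite mulr_ge0 ?sqr_ge0.
  by apply: (l1le_inj (phi := fun k => a + c - k) (F := fun k => g k ^+ 2)) =>
    // x y /addrI /oppr_inj.
under eq_bigr do rewrite -mulr_suml -mulr_sumr.
rewrite -!mulr_suml !exprMn [leRHS]mulrAC; apply: ler_wpM2r; first exact: sqr_ge0.
by rewrite ler_pM ?fA ?hH //; apply: sumr_ge0 => *; rewrite sqr_ge0.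
Qed.

End FiniteSums.

(** * Powers of the Japanese bracket *)

Section Weights.
Context {R : realType}.
Implicit Types (k a b c : int) (r s x : R) (f g h : int -> R).
Local Notation jap := (@japanese R).

Definition jpow r k : R := jap k `^ r.

Lemma japanese_ge1 k : 1 <= jap k.
Proof. by rewrite -sqrtr1 ler_wsqrtr // lerDl sqr_ge0. Qed.

Lemma japanese_sqr k : jap k ^+ 2 = 1 + k%:~R ^+ 2.
Proof. by rewrite sqr_sqrtr // addr_ge0 ?sqr_ge0. Qed.

Lemma japanese_ge0 k : 0 <= jap k.
Proof. exact: le_trans ler01 (japanese_ge1 k). Qed.

Lemma normr_le_japanese k : `|k%:~R| <= jap k.
Proof.
rewrite -(@ler_pXn2r _ 2) ?nnegrE ?japanese_ge0 // japanese_sqr.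
by rewrite real_normK ?num_real // lerDr.
Qed.

Lemma japanese_le k : jap k <= 1 + `|k%:~R|.
Proof.
rewrite -(@ler_pXn2r _ 2) ?nnegrE ?japanese_ge0 ?addr_ge0 // japanese_sqr.
rewrite sqrrD real_normK ?num_real // expr1n lerD2r lerDl.
by rewrite mulrn_wge0 // mulr_ge0.
Qed.

Lemma jpow_gt0 r k : 0 < jpow r k.
Proof. by rewrite powR_gt0 // (lt_le_trans ltr01) ?japanese_ge1. Qed.
Hint Resolve jpow_gt0 : core.

Lemma jpow_ge0 r k : 0 <= jpow r k.
Proof. exact/ltW. Qed.
Hint Resolve jpow_ge0 : core.

Lemma ler_jpow r s k : r <= s -> jpow r k <= jpow s k.
Proof. by move=> rs; apply: ler_powR => //; apply: japanese_ge1. Qed.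

Lemma jpow0 k : jpow 0 k = 1.
Proof. by rewrite /jpow powRr0. Qed.

Lemma jpow_ge1 r k : 0 <= r -> 1 <= jpow r k.
Proof. by move=> r0; rewrite -(jpow0 k); exact: ler_jpow. Qed.

Lemma jpowD r s k : jpow (r + s) k = jpow r k * jpow s k.
Proof.
rewrite /jpow powRD //; apply/implyP => _.
by rewrite gt_eqF // (lt_le_trans ltr01) ?japanese_ge1.
Qed.

Lemma jpow_sqr r k : jpow r k ^+ 2 = jpow (2 * r) k.
Proof. by rewrite mulr_natl mulr2n jpowD expr2. Qed.

Lemma jpowNr r k : jpow (- r) k * jpow r k = 1.
Proof. by rewrite -jpowD addNr jpow0. Qed.

Lemma ler_jpow_dil r k a (d : R) : 0 <= r -> 0 <= d -> jap k <= d * jap a ->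
  jpow r k <= d `^ r * jpow r a.
Proof.
move=> r0 d0 kda; rewrite -powRM ?japanese_ge0 //.
by rewrite ge0_ler_powR ?nnegrE ?mulr_ge0 ?japanese_ge0.
Qed.

Lemma japanese_add_le a b c : jap (a + c - b) <= jap a + jap b + jap c.
Proof.
rewrite -(@ler_pXn2r _ 2) ?nnegrE ?addr_ge0 ?japanese_ge0 // japanese_sqr.
have n3 : `|(a + c - b)%:~R : R| <= `|a%:~R| + `|b%:~R| + `|c%:~R|.
  rewrite rmorphB rmorphD /=; apply: le_trans (ler_normB _ _) _.
  by rewrite addrAC lerD2r ler_normD.
rewrite -(real_normK (num_real (a + c - b)%:~R)).
have sq k : jap k ^+ 2 = 1 + `|k%:~R : R| ^+ 2.
  by rewrite japanese_sqr real_normK ?num_real.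
move: (sq a) (sq b) (sq c) (normr_le_japanese a) (normr_le_japanese b) n3.
move: (normr_le_japanese c) (normr_ge0 (a%:~R : R)) (normr_ge0 (b%:~R : R)).
move: (normr_ge0 (c%:~R : R)) (normr_ge0 ((a + c - b)%:~R : R)).
move: (jap a) (jap b) (jap c) `|a%:~R : R| `|b%:~R : R| `|c%:~R : R|.
move: `|_ : R| => /= {sq} n A B C x y z z0 n0 zC x0 y0 + + + xA yB nle.
move=> A2 B2 C2; rewrite (@le_trans _ _ (1 + (x + y + z) ^+ 2)) //.
  by rewrite lerD2l ler_pXn2r ?nnegrE ?addr_ge0.
have AB : x * y <= A * B by rewrite ler_pM.
have AC : x * z <= A * C by rewrite ler_pM.
have BC : y * z <= B * C by rewrite ler_pM.
have z2 : 0 <= z ^+ 2 by rewrite sqr_ge0.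
have -> : (A + B + C) ^+ 2 =
  A ^+ 2 + B ^+ 2 + C ^+ 2 + 2 * (A * B) + 2 * (A * C) + 2 * (B * C) by ring.
by rewrite A2 B2 C2; lra.
Qed.

(** By subadditivity one of the three brackets is at least a third of the bracket of a + c - b; the
    other two terms on the right are discarded. *)
Lemma jpow_add_le r a b c : 0 <= r ->
  jpow r (a + c - b) <= 3 `^ r * (jpow r a + jpow r b + jpow r c).
Proof.
move=> r0; have J := japanese_add_le a b c; set k := a + c - b in J *.
have K d : jap k <= 3 * jap d -> jpow r k <= 3 `^ r * jpow r d.
  by apply: ler_jpow_dil.
have P d : 0 <= 3 `^ r * jpow r d by rewrite mulr_ge0 ?powR_ge0.
have H : [\/ jap k <= 3 * jap a, jap k <= 3 * jap b | jap k <= 3 * jap c].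
  move: J; move: (jap k) (jap a) (jap b) (jap c) => x A B C J.
  have [|xA] := leP x (3 * A); first by constructor 1.
  have [|xB] := leP x (3 * B); first by constructor 2.
  by constructor 3; lra.
rewrite !mulrDr; case: H => [/K|/K|/K] /le_trans; apply.
- by rewrite -addrA lerDl addr_ge0.
- by rewrite addrAC lerDr addr_ge0.
- by rewrite lerDr addr_ge0.
Qed.

(** A telescoping form of the integral test. After division by (n+1)^(-q) it reads q/(n+1) <=
    ((n+1)/n)^q - 1, which follows from e^x >= 1 + x and ln(1 - 1/(n+1)) <= -1/(n+1). *)
Lemma powR_inv_telescope (q : R) (n : nat) : 0 < q -> (0 < n)%N ->
  n.+1%:R `^ (- (1 + q)) <= (n%:R `^ (- q) - n.+1%:R `^ (- q)) / q.
Proof.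
move=> q0 n0; have n0' : 0 < n%:R :> R by rewrite ltr0n.
have n1 : 0 < n.+1%:R :> R by rewrite ltr0n.
rewrite ler_pdivlMr // opprD powRD; last by apply/implyP => _; rewrite gt_eqF.
rewrite powR_inv1 ?(ltW n1) // lerBrDr -{2}[_ `^ (- q)]mul1r mulrAC -mulrDl.
rewrite /powR !gt_eqF // -ler_pdivlMr ?expR_gt0 // -expRN -expRD.
apply: le_trans (expR_ge1Dx _); rewrite addrC lerD2l.
have -> : - q * ln n%:R - - q * ln n.+1%:R = q * (ln n.+1%:R - ln n%:R) :> R.
  by rewrite !mulNr opprK mulrBr addrC.
rewrite mulrC ler_wpM2l ?(ltW q0) // -ln_div ?posrE //.
rewrite -[leLHS]opprK lerNl -lnV ?posrE ?divr_gt0 // invf_div.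
have := @le_ln1Dx R (- n.+1%:R^-1); rewrite ltrN2.
have -> : 1 - n.+1%:R^-1 = n%:R / n.+1%:R :> R.
  apply: (mulIf (lt0r_neq0 n1)).
  by rewrite mulrBl mul1r mulVf ?divfK ?gt_eqF // -natr1 addrK.
by apply; rewrite invf_lt1 // ltr1n ltnS.
Qed.

Definition box (K : nat) : seq int := [seq i%:Z - K%:Z | i <- iota 0 (2 * K).+1].

Lemma mem_box K k : (k \in box K) = (`|k| <= K)%N.
Proof.
apply/mapP/idP => [[i ] | kK]; first by rewrite mem_iota; lia.
by exists (absz (k + K%:Z)); rewrite ?mem_iota; lia.
Qed.

Lemma box_uniq K : uniq (box K).
Proof. by rewrite map_inj_uniq ?iota_uniq // => i j; lia. Qed.

Lemma sub_box (S : seq int) : exists K, {subset S <= box K}.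
Proof.
exists (\max_(k <- S) `|k|)%N => k kS; rewrite mem_box.
by apply: (@leq_bigmax_seq _ S xpredT absz k).
Qed.

Lemma l1le_box (F : int -> R) A : (forall k, 0 <= F k) ->
  (forall K, \sum_(k <- box K) F k <= A) -> l1le F A.
Proof.
move=> F0 FA S uS; have [K SK] := sub_box S.
by apply: le_trans (FA K); apply: ler_sum_uniq_sub.
Qed.

Lemma sum_box_even (F : int -> R) K : (forall k, F (- k) = F k) ->
  \sum_(k <- box K) F k = F 0 + 2 * \sum_(0 <= n < K) F n.+1%:Z.
Proof.
move=> Fev.
have P : perm_eq (box K) (0 :: [seq n.+1%:Z | n <- iota 0 K] ++
                               [seq - n.+1%:Z | n <- iota 0 K]).
  apply: uniq_perm; first exact: box_uniq.
    rewrite /= mem_cat cat_uniq !map_inj_uniq ?iota_uniq; try by move=> i j; lia.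
    rewrite andbT /=; apply/andP; split.
      by apply/negP => /orP[] /mapP[n _]; lia.
    by apply/hasPn => _ /mapP[n _ ->]; apply/negP => /mapP[m _]; lia.
  move=> k; rewrite mem_box inE mem_cat; apply/idP/idP => [kK|].
    case: k kK => [[//|n]|n] nK; first by rewrite map_f // mem_iota; lia.
    apply/orP; right; apply/orP; right; apply/mapP; exists n; rewrite ?mem_iota; lia.
  by case/orP => [/eqP ->//|/orP[] /mapP[n]]; rewrite mem_iota; lia.
rewrite (perm_big _ P) big_cons big_cat /= !big_map.
under [X in _ + (_ + X)]eq_bigr do rewrite Fev.
by rewrite /index_iota subn0; ring.
Qed.

Lemma l1le_jpow s0 : 2^-1 < s0 -> exists Z, l1le (fun k => jpow (- s0) k ^+ 2) Z.
Proof.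
move=> hs0; set q := 2 * s0 - 1; have q0 : 0 < q by rewrite /q; lra.
have H K : \sum_(0 <= n < K.+1) (n.+1%:R `^ (- (1 + q)) : R) <=
    1 + (1 - K.+1%:R `^ (- q)) / q.
  elim: K => [|K IH].
    by rewrite big_nat1 !powR1 subrr mul0r addr0.
  rewrite big_nat_recr //=; have := powR_inv_telescope q0 (ltn0Sn K).
  by move: IH; rewrite !mulrBl; lra.
(* The frequency 0 contributes 1; each half line contributes 1 for n = 1 and at most 1/q for the
   telescoped rest. *)
exists (1 + 2 * (1 + q^-1)); apply: l1le_box => [k|K]; first exact: sqr_ge0.
have jev k : jpow (- s0) (- k) ^+ 2 = jpow (- s0) k ^+ 2 :> R.
  by rewrite /jpow /japanese rmorphN sqrrN.
rewrite sum_box_even // jpow_sqr {1}/jpow /japanese expr0n addr0 sqrtr1 powR1.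
rewrite lerD2l ler_wpM2l //.
have [->|K0] := posnP K; first by rewrite big_nil addr_ge0 ?invr_ge0 ?ltW.
rewrite -(prednK K0); apply: (@le_trans _ _ (1 + (1 - K.-1.+1%:R `^ (- q)) / q)).
  apply: le_trans (H _); apply: ler_sum => n _; rewrite jpow_sqr /jpow mulrN.
  have -> : 2 * s0 = 1 + q by rewrite /q; ring.
  have nj : n.+1%:R <= jap n.+1%:Z.
    by apply: le_trans (normr_le_japanese _); rewrite ger0_norm.
  have q1 : 0 <= 1 + q by lra.
  have n1 : 0 < n.+1%:R :> R by rewrite ltr0n.
  rewrite !powRN lef_pV2 ?posrE ?powR_gt0 ?(lt_le_trans n1) //.
  by rewrite ge0_ler_powR // nnegrE ?(ltW n1) ?japanese_ge0.
by rewrite lerD2l -[leRHS]mul1r ler_wpM2r ?invr_ge0 ?(ltW q0) // gerBl powR_ge0.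
Qed.

End Weights.

(** * Lower bound for the phase and the gain from dividing by it *)

Section Phase.
Context {R : realType}.
Local Notation jap := (@japanese R).
Implicit Types (x u v M p q beta : R).

(** The tangent line at 1 lies above the concave power. With L = ln x and x = e^(beta L) e^((1-beta)
    L), the inequality e^y >= 1 + y is used at (1-beta) L and at -beta L; weighted by beta and 1 -
    beta, the terms in L cancel. *)
Lemma powR_bernoulli beta x : 0 < beta <= 1 -> 0 <= x ->
  x `^ beta <= 1 + beta * (x - 1).
Proof.
move=> /andP[b0 b1]; rewrite le_eqVlt => /predU1P[<-|x0].
  by rewrite powR0 ?gt_eqF //; lra.
rewrite /powR gt_eqF //; set L := ln x.
have xE : x = expR (beta * L) * expR ((1 - beta) * L).
  by rewrite -expRD -mulrDl addrC subrK mul1r lnK.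
have h1 := expR_ge1Dx ((1 - beta) * L).
have h2 := expR_ge1Dx (- (beta * L)).
have e0 := expR_gt0 (beta * L).
have := expRN (beta * L) => eN.
have h3 : expR (beta * L) * (1 - beta * L) <= 1.
  by rewrite -ler_pdivlMl // mulr1 -eN.
rewrite [in leRHS]xE; move: h1 h3 e0; clearbody L; clear -b0 b1.
move: (expR (beta * L)) (expR ((1 - beta) * L)) => E F h1 h3 e0.
have : E * (1 + (1 - beta) * L) <= E * F by rewrite ler_pM2l.
move=> h4; have : beta * (E * (1 + (1 - beta) * L)) <= beta * (E * F).
  by rewrite ler_pM2l.
have : (1 - beta) * (E * (1 - beta * L)) <= (1 - beta) * 1.
  by apply: ler_wpM2l => //; lra.
lra.
Qed.

(** [powR_bernoulli] at u/v gives the bound with v^(beta-1), the slope at the right end, and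
    M^(beta-1) is smaller because beta <= 1. The case u = 0 is covered. *)
Lemma powR_sub_ge beta u v M : 0 < beta <= 1 -> 0 <= u -> u <= v -> v <= M ->
  beta * M `^ (beta - 1) * (v - u) <= v `^ beta - u `^ beta.
Proof.
move=> /andP[b0 b1] u0; rewrite le_eqVlt => /predU1P[->|uv] vM.
  by rewrite !subrr mulr0.
have v0 : 0 < v by apply: le_lt_trans uv.
have M0 : 0 < M by apply: lt_le_trans vM.
have uE : u `^ beta = (u / v) `^ beta * v `^ beta.
  by rewrite -powRM ?divfK ?gt_eqF ?divr_ge0 // ltW.
have B : (u / v) `^ beta <= 1 + beta * (u / v - 1).
  by apply: powR_bernoulli; rewrite ?b0 // divr_ge0 // ltW.
have vE : v `^ beta = v * v `^ (beta - 1).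
  by rewrite mulr_powRB1 // ltW.
apply: (@le_trans _ _ (beta * v `^ (beta - 1) * (v - u))).
  apply: ler_wpM2r; first by rewrite subr_ge0 ltW.
  apply: ler_wpM2l; first exact: ltW.
  have -> : beta - 1 = - (1 - beta) by lra.
  rewrite !powRN lef_pV2 ?posrE ?powR_gt0 //.
  by rewrite ge0_ler_powR ?nnegrE ?subr_ge0 // ltW.
have -> : v `^ beta - u `^ beta = (1 - (u / v) `^ beta) * v * v `^ (beta - 1).
  by rewrite -mulrA -vE mulrBl mul1r -uE.
have -> : beta * v `^ (beta - 1) * (v - u) =
          (beta * (1 - u / v)) * v * v `^ (beta - 1).
  have -> : beta * (1 - u / v) * v = beta * (v - u).
    by rewrite -mulrA mulrBl mul1r divfK ?gt_eqF.
  by rewrite mulrAC.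
apply: ler_wpM2r; first exact: powR_ge0.
by apply: ler_wpM2r; [exact: ltW | lra].
Qed.

(** The odd extension of the power to the line; up to the factor 1 + beta it is the derivative of
    |x|^(1+beta). *)
Definition sgpow beta x : R := Num.sg x * `|x| `^ beta.

Lemma sgpow_sub_ge beta u v M : 0 < beta <= 1 -> - M <= u -> u <= v -> v <= M ->
  beta * M `^ (beta - 1) * (v - u) <= sgpow beta v - sgpow beta u.
Proof.
move=> /[dup] hb /andP[b0 b1] Mu uv vM.
have b'0 : beta != 0 by rewrite gt_eqF.
have P x : 0 <= x -> sgpow beta x = x `^ beta.
  rewrite /sgpow le_eqVlt => /predU1P[<-|x0].
    by rewrite normr0 powR0 // mulr0.
  by rewrite gtr0_sg // mul1r ger0_norm // ltW.
have N x : x <= 0 -> sgpow beta x = - (- x) `^ beta.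
  move=> x0; rewrite -P ?oppr_ge0 // /sgpow sgrN normrN mulNr opprK //.
have [u0|u0] := leP 0 u.
  by rewrite !P ?(le_trans u0) //; apply: powR_sub_ge.
have [v0|v0] := leP v 0.
  rewrite !N ?(ltW u0) // opprK [leRHS]addrC.
  have -> : v - u = - u - - v by lra.
  by apply: powR_sub_ge => //; [rewrite oppr_ge0|rewrite lerN2|rewrite lerNl].
(* Now u < 0 < v: the increment is v^beta + (-u)^beta, and each summand is an increment from 0. *)
rewrite P ?(ltW v0) // N ?(ltW u0) // opprK.
have := powR_sub_ge hb (lexx 0) (ltW v0) vM.
have := @powR_sub_ge beta 0 (- u) M hb (lexx 0).
rewrite oppr_ge0 lerNl powR0 // !subr0 => /(_ (ltW u0) Mu).
by rewrite mulrN mulrBr; lra.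
Qed.

Lemma is_derive_normr_powR beta x : 0 < beta ->
  is_derive x 1 (fun y : R => `|y| `^ (1 + beta)) ((1 + beta) * sgpow beta x).
Proof.
move=> b0; have b1 : 0 < 1 + beta by rewrite addr_gt0.
have [->|x0] := eqVneq x 0.
  (* The difference quotient of |y|^(1+beta) at 0 is [sgpow beta] itself, and it tends to 0 because
     beta > 0. *)
  rewrite /sgpow sgr0 mul0r mulr0; apply/is_derive1_caratheodory.
  exists (sgpow beta); split; last by rewrite /sgpow sgr0 mul0r.
    move=> z; rewrite normr0 powR0 ?gt_eqF // !subr0 /sgpow mulrAC -normrEsg.
    rewrite powRD ?powRr1 //; apply/implyP; rewrite (gt_eqF b1) // => /eqP.
  have g0 : sgpow beta 0 = 0 by rewrite /sgpow sgr0 mul0r.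
  rewrite /prop_for /continuous_at g0.
  apply/cvgrPdist_lt => e e0; near=> z; rewrite sub0r normrN /sgpow normrM.
  rewrite [`|_ `^ _|]ger0_norm ?powR_ge0 //.
  apply: (@le_lt_trans _ _ (`|z| `^ beta)).
    by rewrite ler_piMl ?powR_ge0 // normr_sg; case: (z == 0); rewrite ?lexx ?ler01.
  have -> : e = (e `^ beta^-1) `^ beta.
    by rewrite -powRrM mulVf ?gt_eqF // powRr1 // ltW.
  rewrite gt0_ltr_powR ?nnegrE ?powR_ge0 //; near: z.
  have /cvgrPdist_lt := @cvg_id R (nbhs 0).
  move=> /(_ (e `^ beta^-1)); rewrite powR_gt0 // => /(_ isT); apply: filterS => z.
  by rewrite sub0r normrN.
have [x1|x1] := ltP 0 x.
  rewrite /sgpow gtr0_sg // mul1r gtr0_norm //.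
  have := is_derive1_powR (1 + beta) x1; rewrite [1 + beta]addrC addrK addrC.
  apply: near_eq_is_derive; near=> y; rewrite gtr0_norm //; near: y.
  exact: lt_nbhsr.
have {x0}x1 : x < 0 by rewrite lt_neqAle x0.
have x1' : 0 < - x by rewrite oppr_gt0.
rewrite /sgpow ltr0_sg // mulN1r mulrN ltr0_norm // -[X in is_derive _ _ _ X]mulrN1.
have d1 := is_derive1_powR (1 + beta) x1'.
have d2 : is_derive x 1 (fun y : R => - y) (-1) by apply: is_deriveN.
have := is_derive1_comp d1 d2; rewrite [1 + beta - 1]addrAC subrr add0r.
apply: near_eq_is_derive; near=> y; rewrite /= ltr0_norm //; near: y.
exact: lt_nbhsl.
Unshelve. all: by end_near.
Qed.

(** The second difference is the increment over p of psi(y) = |y + q|^(1+beta) - |y|^(1+beta). The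
    mean value theorem is applied once, to psi; the derivative of psi is then an increment of
    [sgpow], so the singularity of the second derivative at 0 is never met. *)
Lemma second_diff_ge beta x p q M : 0 < beta <= 1 -> 0 <= p -> 0 <= q ->
  - M <= x -> x + p + q <= M ->
  (1 + beta) * beta * M `^ (beta - 1) * (p * q) <=
  `|x + p + q| `^ (1 + beta) - `|x + p| `^ (1 + beta)
  - `|x + q| `^ (1 + beta) + `|x| `^ (1 + beta).
Proof.
move=> /[dup] hb /andP[b0 b1] p0 q0 Mx xM.
pose psi (y : R) := `|y + q| `^ (1 + beta) - `|y| `^ (1 + beta).
pose dpsi (y : R) := (1 + beta) * (sgpow beta (y + q) - sgpow beta y).
have dP (y : R) : is_derive y 1 psi (dpsi y).
  rewrite /dpsi mulrBr; apply: is_deriveB; last exact: is_derive_normr_powR.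
  have d2 : is_derive y 1 (fun z : R => z + q) 1.
    by have := is_derive_shift y 1 q; rewrite /shift.
  have := is_derive1_comp (g := fun z : R => z + q)
    (is_derive_normr_powR (y + q) b0) d2.
  by rewrite mulr1.
have [c] : exists2 c, c \in `[x, x + p] & psi (x + p) - psi x = dpsi c * (x + p - x).
  apply: MVT_segment; first by rewrite lerDl.
  by apply: derivable_within_continuous => y _; have [] := dP y.
rewrite in_itv /= => /andP[xc cp]; rewrite {1 2}/psi [x + p - x]addrAC subrr add0r.
have -> : forall A B C D : R, A - B - (C - D) = A - B - C + D by move=> *; ring.
move=> ->; rewrite [p * q]mulrC [leLHS]mulrA.
apply: ler_wpM2r => //; rewrite /dpsi -!mulrA; apply: ler_wpM2l; first lra.
rewrite mulrA; have -> : q = c + q - c by ring.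
by rewrite [in X in _ <= X](_ : c + (c + q - c) = c + q); [|ring];
  apply: sgpow_sub_ge => //; lra.
Qed.

(** A negative step is reversed by moving the base point to the other end of it; each reversal
    changes the sign of the second difference, hence the absolute value. All four points remain in
    [-M, M]. *)
Lemma second_diff_norm_ge beta x p q M : 0 < beta <= 1 ->
  `|x| + `|p| + `|q| <= M ->
  (1 + beta) * beta * M `^ (beta - 1) * (`|p| * `|q|) <=
  `| `|x + p| `^ (1 + beta) - `|x + p + q| `^ (1 + beta)
  + `|x + q| `^ (1 + beta) - `|x| `^ (1 + beta) |.
Proof.
move=> hb xM; have px := ler_norm x; have := ler_norm (- x); rewrite normrN => nx.
have [p0|p0] := leP 0 p; have [q0|q0] := leP 0 q.
all: move: xM; rewrite ?(ger0_norm p0) ?(ger0_norm q0) ?(ltr0_norm p0) ?(ltr0_norm q0) => xM.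
- rewrite -[X in _ <= X]normrN; apply: le_trans (ler_norm _).
  apply: le_trans (second_diff_ge (x := x) (M := M) hb p0 q0 _ _) _; [lra|lra|].
  by rewrite le_eqVlt; apply/orP; left; apply/eqP; ring.
- apply: le_trans (ler_norm _).
  have q0' : 0 <= - q by lra.
  apply: le_trans (second_diff_ge (x := x + q) (M := M) hb p0 q0' _ _) _; [lra|lra|].
  rewrite le_eqVlt; apply/orP; left; apply/eqP.
  rewrite (_ : x + q + p - q = x + p); last by ring.
  rewrite (_ : x + q + p = x + p + q); last by ring.
  rewrite (_ : x + q - q = x); last by ring.
  by ring.
- apply: le_trans (ler_norm _).
  have p0' : 0 <= - p by lra.
  apply: le_trans (second_diff_ge (x := x + p) (M := M) hb p0' q0 _ _) _; [lra|lra|].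
  rewrite le_eqVlt; apply/orP; left; apply/eqP.
  rewrite (_ : x + p - p = x); last by ring.
  by ring.
- rewrite -[X in _ <= X]normrN; apply: le_trans (ler_norm _).
  have p0' : 0 <= - p by lra.
  have q0' : 0 <= - q by lra.
  apply: le_trans (second_diff_ge (x := x + p + q) (M := M) hb p0' q0' _ _) _; [lra|lra|].
  rewrite le_eqVlt; apply/orP; left; apply/eqP.
  rewrite (_ : x + p + q - p - q = x); last by ring.
  rewrite (_ : x + p + q - p = x + q); last by ring.
  rewrite (_ : x + p + q - q = x + p); last by ring.
  by ring.
Qed.

Definition phase (alpha : R) (k a c : int) : R :=
  frac_symbol alpha a - frac_symbol alpha (a + c - k)
  + frac_symbol alpha c - frac_symbol alpha k.

(** The second difference of |x|^(2 alpha) at k with steps a - k and c - k, since a + c - k = k + (a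
    - k) + (c - k); here beta = 2 alpha - 1. *)
Lemma phase_ge alpha (k a c : int) : 2^-1 < alpha <= 1 ->
  2 * alpha * (2 * alpha - 1) *
  (`|k%:~R| + `|(a - k)%:~R| + `|(c - k)%:~R|) `^ (2 * alpha - 2) *
  (`|(a - k)%:~R| * `|(c - k)%:~R|) <= `|phase alpha k a c|.
Proof.
move=> halpha; have hb : 0 < 2 * alpha - 1 <= 1 by lra.
have := second_diff_norm_ge (x := k%:~R) (p := (a - k)%:~R) (q := (c - k)%:~R)
  hb (lexx _).
rewrite -!rmorphD /= ![k + _]addrC !subrK [a + (c - k)]addrA.
rewrite (_ : 1 + (2 * alpha - 1) = 2 * alpha); last by ring.
by rewrite (_ : 2 * alpha - 1 - 1 = 2 * alpha - 2); last by ring.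
Qed.

Lemma normr_int_ge1 (k : int) : k != 0 -> 1 <= `|k%:~R : R|.
Proof. by move=> k0; rewrite -intr_norm ler1z; lia. Qed.

Lemma phase_neq0 alpha (k a c : int) : 2^-1 < alpha <= 1 -> a != k -> c != k ->
  phase alpha k a c != 0.
Proof.
move=> halpha ak ck; rewrite -normr_gt0; apply: lt_le_trans (phase_ge k a c halpha).
have ak1 : 1 <= `|(a - k)%:~R : R| by rewrite normr_int_ge1 // subr_eq0.
have ck1 : 1 <= `|(c - k)%:~R : R| by rewrite normr_int_ge1 // subr_eq0.
have k0 := normr_ge0 (k%:~R : R).
rewrite !mulr_gt0 ?powR_gt0 //; lra.
Qed.

Lemma japanese_comparable (k d : int) :
  3 * `|k%:~R : R| <= 4 * `|d%:~R| -> jap k <= 2 * jap d.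
Proof.
move=> kd; rewrite -(@ler_pXn2r _ 2) ?nnegrE ?mulr_ge0 ?japanese_ge0 //.
have sqn (j : int) : jap j ^+ 2 = 1 + `|j%:~R : R| ^+ 2.
  by rewrite japanese_sqr real_normK ?num_real.
rewrite exprMn !sqn; move: kd (normr_ge0 (k%:~R : R)) (normr_ge0 (d%:~R : R)).
move: `|k%:~R : R| `|d%:~R : R| => x y xy x0 y0.
have : (3 * x) ^+ 2 <= (4 * y) ^+ 2 by rewrite ler_pXn2r ?nnegrE ?mulr_ge0.
have y2 := sqr_ge0 y; rewrite !exprMn; lra.
Qed.

Lemma jpow_interp_le beta s M (k : int) : 0 <= beta -> 0 < M -> jap k <= M ->
  jpow (s + beta) k * M `^ (1 - beta) <= jpow s k * M.
Proof.
move=> b0 M0 kM; rewrite jpowD -mulrA; apply: ler_wpM2l; first exact: jpow_ge0.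
rewrite -[leRHS]powRr1 ?(ltW M0) //.
rewrite (_ : M `^ 1 = M `^ beta * M `^ (1 - beta)); last first.
  by rewrite -powRD ?subrKC //; apply/implyP; rewrite (gt_eqF M0).
apply: ler_wpM2r; first exact: powR_ge0.
by rewrite ge0_ler_powR // ?nnegrE ?japanese_ge0 ?(ltW M0).
Qed.

(** As M <= 2 <k>, the left side is at most 2 <k>^(s+1), and 1 <= 2 s0 lets the extra power be
    shared between b and c. *)
Lemma jpow_comparable_le beta s s0 M (k a b c : int) :
  0 <= beta <= 1 -> 2^-1 < s0 -> s0 <= s -> 0 < M -> M <= 2 * jap k ->
  jap k <= 2 * jap a -> jap k <= 2 * jap b -> jap k <= 2 * jap c ->
  jpow (s + beta) k * M `^ (1 - beta) <=
  2 * 2 `^ s * 2 `^ s0 * 2 `^ s0 * (jpow s a * jpow s0 b * jpow s0 c).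
Proof.
move=> /andP[b0 b1] hs0 s0s M0 M2 ka kb kc.
have two0 : 0 <= 2 :> R by [].
have s_0 : 0 <= s by lra.
have s0_0 : 0 <= s0 by lra.
have Ja := ler_jpow_dil s_0 two0 ka.
have Jb := ler_jpow_dil s0_0 two0 kb.
have Jc := ler_jpow_dil s0_0 two0 kc.
have b1' : 0 <= 1 - beta by rewrite subr_ge0.
have N2 : M `^ (1 - beta) <= 2 * jpow (1 - beta) k.
  apply: (@le_trans _ _ ((2 * jap k) `^ (1 - beta))).
    by rewrite ge0_ler_powR // nnegrE ?(ltW M0) // mulr_ge0 ?japanese_ge0.
  rewrite powRM; [|exact: two0|exact: japanese_ge0]; rewrite -/(jpow _ _).
  apply: ler_wpM2r; first exact: jpow_ge0.
  by apply: ler1_powR; rewrite ?ler1n // gerBl.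
apply: (@le_trans _ _ (2 * (jpow s k * jpow s0 k * jpow s0 k))).
  apply: le_trans (ler_wpM2l (jpow_ge0 _ _) N2) _.
  rewrite mulrCA; apply: ler_wpM2l; first exact: two0.
  by rewrite -!jpowD; apply: ler_jpow; clear - hs0; lra.
rewrite (_ : _ * (jpow s a * _ * _) = 2 * ((2 `^ s * jpow s a) *
  (2 `^ s0 * jpow s0 b) * (2 `^ s0 * jpow s0 c))); last by ring.
apply: ler_wpM2l; first exact: two0.
apply: ler_pM; [by rewrite mulr_ge0 ?jpow_ge0|exact: jpow_ge0| |exact: Jc].
by apply: ler_pM; [exact: jpow_ge0|exact: jpow_ge0|exact: Ja|exact: Jb].
Qed.

(** The value at j = 0 is 0, since the inverse of 0 is 0; the function is thus square summable over
    all integers. *)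
Definition inv_abs (j : int) : R := `|j%:~R|^-1.

(* When |a - k| + |c - k| is comparable to |k| the phase alone supplies the gain
   <k>^(2 alpha - 1); otherwise a, b and c are all comparable to k, and the
   missing power of <k> is paid by <b>^s0 <c>^s0 with 2 s0 >= 1. *)
Lemma jpow_div_phase alpha s s0 : 2^-1 < alpha <= 1 -> 2^-1 < s0 -> s0 <= s ->
  exists2 C, 0 <= C & forall k a c : int, a != k -> c != k ->
    jpow (s + (2 * alpha - 1)) k / `|phase alpha k a c| <=
    C * (jpow s a + jpow s (a + c - k) + jpow s c +
         inv_abs (a - k) * inv_abs (c - k) *
         (jpow s a * jpow s0 (a + c - k) * jpow s0 c)).
Proof.
move=> halpha hs0 s0s; set beta := 2 * alpha - 1.
set kap := 2 * alpha * beta.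
have kap0 : 0 < kap by rewrite /kap mulr_gt0 //; rewrite /beta; lra.
have s_0 : 0 <= s by lra.
have s0_0 : 0 <= s0 by lra.
(* The factor 1/kap comes from the lower bound on the phase; the two summands are the constants of
   the two regions treated below. *)
exists (kap^-1 * (10 * 3 `^ s + 2 * 2 `^ s * 2 `^ s0 * 2 `^ s0)) => [|k a c ak ck].
  by rewrite mulr_ge0 ?invr_ge0 ?(ltW kap0) // addr_ge0 ?mulr_ge0 ?powR_ge0.
set p := a - k; set q := c - k; set b := a + c - k.
have p1 : 1 <= `|p%:~R : R| by rewrite normr_int_ge1 // subr_eq0.
have q1 : 1 <= `|q%:~R : R| by rewrite normr_int_ge1 // subr_eq0.
have k0 := normr_ge0 (k%:~R : R).
have pq1 : 0 < `|p%:~R : R| * `|q%:~R : R| by nra.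
set M := `|k%:~R : R| + `|p%:~R| + `|q%:~R|.
have M0 : 0 < M by rewrite /M; lra.
have jM : japanese k <= M by apply: le_trans (japanese_le _) _; rewrite /M; lra.
set J := jpow (s + beta) k.
have J0 : 0 <= J by apply: jpow_ge0.
have Mb0 : 0 < M `^ (1 - beta) by rewrite powR_gt0.
set N := M `^ (1 - beta); set V := `|p%:~R : R| * `|q%:~R|.
(* The exponent 2 alpha - 2 in [phase_ge] is -(1 - beta), so the division produces the positive
   power M^(1-beta). *)
have step : J / `|phase alpha k a c| <= kap^-1 * (J * N / V).
  have ph0 : 0 < `|phase alpha k a c| by rewrite normr_gt0 phase_neq0.
  have := phase_ge k a c halpha; rewrite -/p -/q -/M -/beta -/kap -/V.
  have -> : 2 * alpha - 2 = - (1 - beta) by rewrite /beta; ring.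
  rewrite powRN -/N => h.
  have X0 : 0 < kap / N * V by rewrite mulr_gt0 ?divr_gt0.
  apply: (@le_trans _ _ (J / (kap / N * V))); first by rewrite ler_wpM2l // lef_pV2.
  rewrite le_eqVlt; apply/orP; left; apply/eqP; rewrite !invfM invrK; ring.
apply: le_trans step _; rewrite -[leRHS]mulrA; apply: ler_wpM2l.
  by rewrite invr_ge0 ltW.
rewrite ler_pdivrMr // mulrDl mulrDl.
set A := jpow s a + _ + _; set X := jpow s a * _ * _.
have A0 : 0 <= A by rewrite !addr_ge0 ?jpow_ge0.
have X0 : 0 <= X by rewrite !mulr_ge0 ?jpow_ge0.
have ZV : inv_abs p * inv_abs q * X * V = X.
  rewrite /inv_abs -invfM mulrAC mulVf ?mul1r //; exact: lt0r_neq0.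
have V0 : 0 <= V by exact: ltW.
have alg1 (S T Y : R) : 0 <= S -> 0 <= T -> 0 <= Y ->
    S * A * V <= S * (A + Y) * V + T * (A + Y) * V.
  move=> S0 T0 Y0; rewrite -subr_ge0.
  rewrite (_ : _ - _ = S * Y * V + T * (A + Y) * V); last by ring.
  by do ?[assumption|apply: addr_ge0|apply: mulr_ge0].
have alg2 (S T Y : R) : 0 <= S -> 0 <= T -> 0 <= Y ->
    T * Y * V <= S * (A + Y) * V + T * (A + Y) * V.
  move=> S0 T0 Y0; rewrite -subr_ge0.
  rewrite (_ : _ - _ = S * (A + Y) * V + T * A * V); last by ring.
  by do ?[assumption|apply: addr_ge0|apply: mulr_ge0].
have [kpq|kpq] := leP `|k%:~R : R| (4 * (`|p%:~R| + `|q%:~R|)).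
  apply: (@le_trans _ _ (10 * (3 `^ s * A * V))); last first.
    have -> : 10 * (3 `^ s * A * V) = 10 * 3 `^ s * A * V by ring.
    by apply: alg1; rewrite ?mulr_ge0 ?invr_ge0 ?powR_ge0 ?(ltW pq1).
  have h1 : J * N <= jpow s k * M.
    by apply: jpow_interp_le => //; move: halpha; rewrite /beta; clear; lra.
  (* In this region M <= 5 (|p| + |q|), and |p| + |q| <= 2 |p| |q| because both are at least 1. *)
  have M10 : M <= 10 * V.
    move: kpq p1 q1 k0; rewrite /M /V; clear.
    move: `|p%:~R : R| `|q%:~R : R| `|k%:~R : R| => x y z; nra.
  apply: le_trans h1 _; apply: le_trans (ler_wpM2l (jpow_ge0 _ _) M10) _.
  rewrite mulrCA; apply: ler_wpM2l => //; apply: ler_wpM2r; first exact: ltW.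
  by have := jpow_add_le a b c s_0; rewrite /b subKr.
apply: (@le_trans _ _ (2 * 2 `^ s * 2 `^ s0 * 2 `^ s0 * X)); last first.
  rewrite -[in leLHS]ZV mulrA.
  by apply: alg2; rewrite ?mulr_ge0 ?invr_ge0 ?powR_ge0 ?(ltW pq1).
have kj := @normr_le_japanese R k.
(* The numbers a = k + p, c = k + q and b = k + p + q differ from k by less than |k|/4, which is the
   ratio 3/4 required by [japanese_comparable]. *)
have ka : jap k <= 2 * jap a.
  apply: japanese_comparable; have := ler_normD (a%:~R : R) (- p%:~R).
  rewrite -rmorphB /= /p subKr normrN; move: kpq (normr_ge0 (q%:~R : R)).
  rewrite /p; clear; move: `|_ : R| `|_ : R| `|_ : R| `|_ : R| => x y z w; lra.
have kc : jap k <= 2 * jap c.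
  apply: japanese_comparable; have := ler_normD (c%:~R : R) (- q%:~R).
  rewrite -rmorphB /= /q subKr normrN; move: kpq (normr_ge0 (p%:~R : R)).
  rewrite /q; clear; move: `|_ : R| `|_ : R| `|_ : R| `|_ : R| => x y z w; lra.
have kb : jap k <= 2 * jap b.
  apply: japanese_comparable; have := ler_normD (b%:~R - p%:~R : R) (- q%:~R).
  have := ler_normD (b%:~R : R) (- p%:~R).
  rewrite -!rmorphB /= (_ : b - p - q = k); last by rewrite /b /p /q; ring.
  rewrite !normrN; move: kpq; clear.
  move: `|_ : R| `|_ : R| `|_ : R| `|_ : R| `|_ : R| => x y z w v; lra.
apply: jpow_comparable_le ka kb kc; try assumption.
  by move: halpha; rewrite /beta; clear; lra.
apply: le_trans (_ : 2 * `|k%:~R : R| <= _); last by rewrite ler_pM2l.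
move: kpq (normr_ge0 (p%:~R : R)) (normr_ge0 (q%:~R : R)); rewrite /M; clear.
by move: `|k%:~R : R| `|p%:~R : R| `|q%:~R : R| => x y z; lra.
Qed.

End Phase.

(** * Trilinear estimates in weighted l2 spaces *)

Section Multilinear.
Context {R : realType}.
Implicit Types (f g h : int -> R) (S B : seq int) (A : R).

Definition l2le (T : eqType) (f : T -> R) A := l1le (fun k => f k ^+ 2) (A ^+ 2).

Lemma l2le_le (T : eqType) (f g : T -> R) A :
  (forall k, 0 <= f k) -> (forall k, f k <= g k) -> l2le g A -> l2le f A.
Proof.
move=> f0 fg gA S uS; apply: le_trans (gA S uS); apply: ler_sum => k _.
by rewrite ler_pXn2r ?nnegrE // (le_trans (f0 k)).
Qed.

Lemma l2le_add (T : eqType) (f g : T -> R) A A' : 0 <= A -> 0 <= A' ->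
  l2le f A -> l2le g A' -> l2le (fun k => f k + g k) (A + A').
Proof.
by move=> A0 A'0 fA gA S uS; apply: minkowski_le => //; [exact: fA|exact: gA].
Qed.

Lemma l2le_scale (T : eqType) (f : T -> R) A (d : R) :
  l2le f A -> l2le (fun k => d * f k) (d * A).
Proof.
move=> fA S uS; under eq_bigr do rewrite exprMn.
by rewrite -mulr_sumr exprMn ler_wpM2l ?sqr_ge0 // fA.
Qed.

Lemma l2le_widen (T : eqType) (f : T -> R) A A' :
  0 <= A -> A <= A' -> l2le f A -> l2le f A'.
Proof.
move=> A0 AA' fA S uS; apply: le_trans (fA S uS) _.
by rewrite ler_pXn2r ?nnegrE // (le_trans A0).
Qed.

Lemma l2le_eq (T : eqType) (f g : T -> R) A : f =1 g -> l2le f A -> l2le g A.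
Proof. by move=> fg fA S uS; under eq_bigr do rewrite -fg; exact: fA. Qed.

(** The bound by [A] of the H^r norm of a function whose Fourier coefficients have modulus [f]. *)
Definition hle (r : R) f A := l2le (fun k => jpow r k * f k) A.

Lemma hle_le r f g A : (forall k, 0 <= f k) -> (forall k, f k <= g k) ->
  hle r g A -> hle r f A.
Proof.
move=> f0 fg; apply: l2le_le => k; first by rewrite mulr_ge0 ?jpow_ge0.
by rewrite ler_wpM2l ?jpow_ge0.
Qed.

Lemma hle_add r f g A A' : 0 <= A -> 0 <= A' ->
  hle r f A -> hle r g A' -> hle r (fun k => f k + g k) (A + A').
Proof.
move=> A0 A'0 fA gA; have := l2le_add A0 A'0 fA gA.
by apply: l2le_eq => k; rewrite mulrDr.
Qed.

Lemma hle_scale r f A (d : R) : hle r f A -> hle r (fun k => d * f k) (d * A).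
Proof. by move=> /(l2le_scale d); apply: l2le_eq => k; rewrite mulrCA. Qed.

Lemma hle_mono r r' f A : r <= r' -> (forall k, 0 <= f k) ->
  hle r' f A -> hle r f A.
Proof.
move=> rr f0; apply: l2le_le => k; first by rewrite mulr_ge0 ?jpow_ge0.
by apply: ler_wpM2r => //; apply: ler_jpow.
Qed.

(** The embedding of H^s0 into absolutely convergent Fourier series: Cauchy-Schwarz against
    <k>^(-s0), which is in l2 exactly because s0 > 1/2. *)
Lemma l1le_of_hle (s0 : R) : 2^-1 < s0 -> exists2 Z, 0 <= Z &
  forall f A, (forall k, 0 <= f k) -> 0 <= A -> hle s0 f A -> l1le f (Z * A).
Proof.
move=> /l1le_jpow[Z0 HZ]; have Z00 := l1le_ge0 HZ.
exists (Num.sqrt Z0) => [|f A f0 A0 fA S uS]; first exact: sqrtr_ge0.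
rewrite -(@ler_pXn2r _ 2) ?nnegrE ?mulr_ge0 ?sqrtr_ge0 ?sumr_ge0 //.
rewrite exprMn sqr_sqrtr //.
have := cauchy_schwarz S (jpow (- s0)) (fun k => jpow s0 k * f k).
under eq_bigr do rewrite mulrA jpowNr mul1r.
move/le_trans; apply; apply: ler_pM; try exact: HZ; try exact: fA.
all: by apply: sumr_ge0 => k _; exact: sqr_ge0.
Qed.

Lemma l1le_inv_abs : exists W, l1le (fun k => inv_abs k ^+ 2 : R) W.
Proof.
have [|Z HZ] := @l1le_jpow R 1; first by rewrite invf_lt1 ?ltr1n.
exists (2 * Z) => S uS; apply: le_trans (_ : 2 * \sum_(k <- S) jpow (- 1) k ^+ 2 <= _).
  rewrite mulr_sumr; apply: ler_sum => k _.
  rewrite (_ : jpow (- 1) k ^+ 2 = (1 + k%:~R ^+ 2)^-1 :> R); last first.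
    by rewrite -japanese_sqr -exprVn /jpow powR_inv1 ?japanese_ge0.
  rewrite /inv_abs.
  have [->|k0] := eqVneq k 0; first by rewrite normr0 invr0 !expr0n addr0 invr1 mulr1.
  have k1 := @normr_int_ge1 R k k0; rewrite exprVn real_normK ?num_real //.
  have k2 : 1 <= k%:~R ^+ 2 :> R.
    by rewrite -[leRHS]real_normK ?num_real // expr_ge1.
  rewrite ler_pdivlMr ?ltr_wpDr ?sqr_ge0 // ler_pdivrMl ?(lt_le_trans ltr01) //.
  lra.
by rewrite ler_pM2l // HZ.
Qed.

(** A majorant for the cubic convolution. The middle factor stands for the conjugated one, whose
    index a + c - k is forced by the two others. *)
Definition cubic_sum B f g h k : R :=
  \sum_(a <- B) \sum_(c <- B) f a * g (a + c - k) * h c.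

Definition nonres_sum (alpha : R) B f g h k : R :=
  \sum_(a <- B) \sum_(c <- B | (a != k) && (c != k))
    f a * g (a + c - k) * h c / `|phase alpha k a c|.

Lemma cubic_sum_ge0 B f g h k : (forall k, 0 <= f k) -> (forall k, 0 <= g k) ->
  (forall k, 0 <= h k) -> 0 <= cubic_sum B f g h k.
Proof. by move=> *; do 2!(apply: sumr_ge0 => ? _); rewrite !mulr_ge0. Qed.

Lemma nonres_sum_ge0 alpha B f g h k : (forall k, 0 <= f k) ->
  (forall k, 0 <= g k) -> (forall k, 0 <= h k) -> 0 <= nonres_sum alpha B f g h k.
Proof.
by move=> *; do 2!(apply: sumr_ge0 => ? _); rewrite mulr_ge0 ?invr_ge0 ?mulr_ge0.
Qed.

Section Estimates.
Variables (f g h : int -> R) (A1 A0 B1 B0 C1 C0 r s0 : R).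
Hypotheses (f0 : forall k, 0 <= f k) (g0 : forall k, 0 <= g k).
Hypothesis h0 : forall k, 0 <= h k.
Hypotheses (A1_ge0 : 0 <= A1) (A0_ge0 : 0 <= A0) (B1_ge0 : 0 <= B1).
Hypotheses (B0_ge0 : 0 <= B0) (C1_ge0 : 0 <= C1) (C0_ge0 : 0 <= C0).
Hypotheses (fA1 : hle r f A1) (fA0 : hle s0 f A0) (gB1 : hle r g B1).
Hypotheses (gB0 : hle s0 g B0) (hC1 : hle r h C1) (hC0 : hle s0 h C0).
Variable (Z : R).
Hypothesis Z_ge0 : 0 <= Z.
Hypothesis HZ : forall f A, (forall k, 0 <= f k) -> 0 <= A -> hle s0 f A ->
  l1le f (Z * A).

Let jp f' k : R := jpow r k * f' k.

Let jp_ge0 f' : (forall k, 0 <= f' k) -> forall k, 0 <= jp f' k.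
Proof. by move=> ? k; rewrite mulr_ge0 ?jpow_ge0. Qed.

(** The right side of a fractional Leibniz rule: the weight <.>^r falls on one factor at a time, and
    that factor is taken in l2, the two others in l1. *)
Definition leibniz_sum B k : R := cubic_sum B (jp f) g h k +
  cubic_sum B f (jp g) h k + cubic_sum B f g (jp h) k.

Lemma leibniz_sum_l2le B : uniq B ->
  l2le (leibniz_sum B) (Z ^+ 2 * (A1 * B0 * C0 + A0 * B1 * C0 + A0 * B0 * C1)).
Proof.
move=> uB.
have -> : Z ^+ 2 * (A1 * B0 * C0 + A0 * B1 * C0 + A0 * B0 * C1) =
  A1 * (Z * B0) * (Z * C0) + Z * A0 * B1 * (Z * C0) + Z * A0 * (Z * B0) * C1.
  ring.
apply: l2le_add; rewrite ?addr_ge0 ?mulr_ge0 //.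
  apply: l2le_add; rewrite ?addr_ge0 ?mulr_ge0 // => S uS.
    by apply: young_fst => //; [exact: jp_ge0|exact: HZ|exact: HZ].
  by apply: young_mid => //; [exact: jp_ge0|exact: HZ|exact: HZ].
by move=> S uS; apply: young_lst => //; [exact: jp_ge0|exact: HZ|exact: HZ].
Qed.

Lemma cubic_sum_hle B : 0 <= r -> uniq B ->
  hle r (cubic_sum B f g h)
    (3 `^ r * (Z ^+ 2 * (A1 * B0 * C0 + A0 * B1 * C0 + A0 * B0 * C1))).
Proof.
move=> r0 uB; have := l2le_scale (3 `^ r) (leibniz_sum_l2le uB).
apply: l2le_le => k; first by rewrite mulr_ge0 ?jpow_ge0 ?cubic_sum_ge0.
rewrite /leibniz_sum /cubic_sum -!big_split /= !mulr_sumr; apply: ler_sum => a _.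
rewrite -!big_split /= !mulr_sumr; apply: ler_sum => c _; rewrite /jp.
have := jpow_add_le a (a + c - k) c r0; rewrite subKr.
have fgh : 0 <= f a * g (a + c - k) * h c by rewrite !mulr_ge0.
move/(ler_wpM2r fgh) => /le_trans; apply; rewrite le_eqVlt; apply/orP; left.
move: (jpow r a) (jpow r (a + c - k)) (jpow r c) (3 `^ r) => x y z w.
by apply/eqP; ring.
Qed.

(** The kernel bound assumed on 1/|phase| splits the sum in two: three Leibniz terms, estimated by
    Young's inequality with constant Z^2, and a term with weights 1/(|a - k| |c - k|), estimated by
    [l2_trilinear] with constant W. *)
Lemma nonres_sum_hle alpha C W B : 0 <= C ->
  (forall k a c : int, a != k -> c != k ->
    jpow (r + (2 * alpha - 1)) k / `|phase alpha k a c| <=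
    C * (jpow r a + jpow r (a + c - k) + jpow r c +
         inv_abs (a - k) * inv_abs (c - k) *
         (jpow r a * jpow s0 (a + c - k) * jpow s0 c))) ->
  l1le (fun k => inv_abs k ^+ 2) W -> uniq B ->
  hle (r + (2 * alpha - 1)) (nonres_sum alpha B f g h)
    (C * ((Z ^+ 2 + W) * (A1 * B0 * C0 + A0 * B1 * C0 + A0 * B0 * C1))).
Proof.
move=> C_ge0 HC HW uB; have W0 := l1le_ge0 HW.
set Q := A1 * B0 * C0 + A0 * B1 * C0 + A0 * B0 * C1.
pose X k := \sum_(a <- B) \sum_(c <- B) inv_abs (a - k) * inv_abs (c - k) *
  (jpow r a * f a * (jpow s0 (a + c - k) * g (a + c - k)) * (jpow s0 c * h c)).
have H1 : l2le (fun k => leibniz_sum B k + X k) (Z ^+ 2 * Q + W * (A1 * B0 * C0)).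
  apply: l2le_add; rewrite ?addr_ge0 ?mulr_ge0 ?sqr_ge0 ?addr_ge0 ?mulr_ge0 //.
    exact: leibniz_sum_l2le.
  by move=> S uS; apply: (l2_trilinear (w := fun j => inv_abs j)
    (f := fun k => jpow r k * f k) (g := fun k => jpow s0 k * g k)
    (h := fun k => jpow s0 k * h k)).
have Q0 : 0 <= A1 * B0 * C0 by rewrite !mulr_ge0.
have Q1 : 0 <= A0 * B1 * C0 + A0 * B0 * C1 by rewrite addr_ge0 ?mulr_ge0.
have {H1} : l2le (fun k => leibniz_sum B k + X k) ((Z ^+ 2 + W) * Q).
  apply: l2le_widen H1.
    by rewrite addr_ge0 // !mulr_ge0 ?sqr_ge0 // /Q -addrA addr_ge0.
  by rewrite mulrDl lerD2l ler_wpM2l // /Q -addrA lerDl.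
move/(l2le_scale C); apply: l2le_le => k.
  by rewrite mulr_ge0 ?jpow_ge0 ?nonres_sum_ge0.
rewrite /leibniz_sum /nonres_sum /cubic_sum /X -!big_split /= !mulr_sumr.
apply: ler_sum => a _; rewrite -!big_split /= mulr_sumr big_mkcond mulr_sumr /=.
apply: ler_sum => c _; rewrite /jp.
have fgh : 0 <= f a * g (a + c - k) * h c by rewrite !mulr_ge0.
have -> (w : R) : C * (jpow r a * f a * g (a + c - k) * h c +
    f a * (jpow r (a + c - k) * g (a + c - k)) * h c +
    f a * g (a + c - k) * (jpow r c * h c) +
    w * (jpow r a * f a * (jpow s0 (a + c - k) * g (a + c - k)) *
      (jpow s0 c * h c))) =
  C * (jpow r a + jpow r (a + c - k) + jpow r c + w *
         (jpow r a * jpow s0 (a + c - k) * jpow s0 c)) *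
  (f a * g (a + c - k) * h c).
  move: (jpow r a) (jpow r (a + c - k)) (jpow r c) (jpow s0 (a + c - k)) => x y z t.
  by move: (jpow s0 c) => u; ring.
case: ifPn => [/andP[ak ck]|_].
  rewrite mulrCA mulrC; apply: ler_wpM2r => //; exact: HC.
rewrite mulr_ge0 // mulr_ge0 // addr_ge0 ?mulr_ge0 ?addr_ge0 ?jpow_ge0 //.
all: by rewrite /inv_abs invr_ge0.
Qed.

End Estimates.
End Multilinear.

(** * Fourier coefficients on the torus *)

Section Complex.
Context {R : realType}.
Local Notation re := (@complex.Re R).
Local Notation im := (@complex.Im R).
Local Notation nc := (@ComplexField.Normc.normc R).
Implicit Types (z w : R[i]) (x y : R).

Lemma reD z w : re (z + w) = re z + re w. Proof. by case: z; case: w. Qed.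
Lemma imD z w : im (z + w) = im z + im w. Proof. by case: z; case: w. Qed.
Lemma reN z : re (- z) = - re z. Proof. by case: z. Qed.
Lemma imN z : im (- z) = - im z. Proof. by case: z. Qed.
Lemma reM z w : re (z * w) = re z * re w - im z * im w.
Proof. by case: z; case: w. Qed.
Lemma imM z w : im (z * w) = re z * im w + im z * re w.
Proof. by case: z; case: w. Qed.
Lemma reJ z : re (conjc z) = re z. Proof. by case: z. Qed.
Lemma imJ z : im (conjc z) = - im z. Proof. by case: z. Qed.
Lemma reC x : re (x%:C)%C = x. Proof. by []. Qed.
Lemma imC x : im (x%:C)%C = 0. Proof. by []. Qed.

Definition reimE := (reD, imD, reN, imN, reM, imM, reJ, imJ, reC, imC).

Lemma complex_eq z w : re z = re w -> im z = im w -> z = w.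
Proof. by case: z => a b; case: w => c d /= -> ->. Qed.

Lemma re_sum (I : Type) (s : seq I) (P : pred I) (F : I -> R[i]) :
  re (\sum_(i <- s | P i) F i) = \sum_(i <- s | P i) re (F i).
Proof. by elim/big_ind2 : _ => // z x w y <- <-; rewrite reD. Qed.

Lemma im_sum (I : Type) (s : seq I) (P : pred I) (F : I -> R[i]) :
  im (\sum_(i <- s | P i) F i) = \sum_(i <- s | P i) im (F i).
Proof. by elim/big_ind2 : _ => // z x w y <- <-; rewrite imD. Qed.

Lemma normc_ge0 z : 0 <= nc z. Proof. by case: z => a b; apply: sqrtr_ge0. Qed.

Lemma normc_sqr z : nc z ^+ 2 = re z ^+ 2 + im z ^+ 2.
Proof. by case: z => a b; rewrite /= sqr_sqrtr // addr_ge0 ?sqr_ge0. Qed.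

Lemma normcM z w : nc (z * w) = nc z * nc w.
Proof. exact: ComplexField.Normc.normcM. Qed.

Lemma ler_normcD z w : nc (z + w) <= nc z + nc w.
Proof. exact: le_normcD. Qed.

Lemma normcN z : nc (- z) = nc z. Proof. exact: normcN. Qed.

Lemma ler_normcB z w : nc (z - w) <= nc z + nc w.
Proof. by rewrite -(normcN w) ler_normcD. Qed.

Lemma normc_distC z w : nc (z - w) = nc (w - z).
Proof. by rewrite -normcN opprB. Qed.

Lemma normcC x : nc (x%:C)%C = `|x|.
Proof. by rewrite /= expr0n addr0 sqrtr_sqr. Qed.

Lemma normc0 : nc 0 = 0. Proof. by rewrite (normcC 0) normr0. Qed.

Lemma normc_conj z : nc (conjc z) = nc z.
Proof. by case: z => a b /=; rewrite sqrrN. Qed.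

Lemma normc_eq0 z : nc z = 0 -> z = 0. Proof. exact: ComplexField.Normc.eq0_normc. Qed.

Lemma ler_normc_sum (I : Type) (s : seq I) (P : pred I) (F : I -> R[i]) :
  nc (\sum_(i <- s | P i) F i) <= \sum_(i <- s | P i) nc (F i).
Proof.
elim/big_ind2 : _ => [|z x w y zx wy|//]; first by rewrite normc0.
by apply: le_trans (ler_normcD _ _) _; apply: lerD.
Qed.

Lemma ler_re_normc z : `|re z| <= nc z.
Proof.
rewrite -(@ler_pXn2r _ 2) ?nnegrE ?normc_ge0 // normc_sqr.
by rewrite real_normK ?num_real // lerDl sqr_ge0.
Qed.

Lemma ler_im_normc z : `|im z| <= nc z.
Proof.
rewrite -(@ler_pXn2r _ 2) ?nnegrE ?normc_ge0 // normc_sqr.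
by rewrite real_normK ?num_real // lerDr sqr_ge0.
Qed.

Lemma ler_normc_reim z : nc z <= `|re z| + `|im z|.
Proof.
rewrite -(@ler_pXn2r _ 2) ?nnegrE ?normc_ge0 ?addr_ge0 // normc_sqr.
rewrite sqrrD !real_normK ?num_real // lerD2r lerDl.
by rewrite mulrn_wge0 // mulr_ge0.
Qed.

Lemma cis0 : cis 0 = 1 :> R[i].
Proof. by rewrite /cis cos0 sin0. Qed.

Lemma cisD x y : cis (x + y) = cis x * cis y.
Proof.
by apply: complex_eq; rewrite ?reM ?imM /= ?cosD ?sinD; ring.
Qed.

Lemma cisN x : cis (- x) = conjc (cis x).
Proof. by rewrite /cis cosN sinN. Qed.

Lemma normc_cis x : nc (cis x) = 1.
Proof. by rewrite /cis /= cos2Dsin2 sqrtr1. Qed.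

Lemma cisNK x : cis (- x) * cis x = 1.
Proof. by rewrite -cisD addNr cis0. Qed.

Lemma cis_intr_2pi (k : int) x : cis (k%:~R * (x + 2 * pi)) = cis (k%:~R * x).
Proof.
rewrite mulrDr cisD; suff -> : cis (k%:~R * (2 * pi)) = 1 :> R[i] by rewrite mulr1.
have H (n : nat) : cis (n%:R * (2 * pi)) = 1 :> R[i].
  elim: n => [|n IH]; first by rewrite mul0r cis0.
  rewrite -natr1 mulrDl mul1r cisD IH mul1r /cis mulr_natl cos2pi sin2pi //.
case: k => n; first exact: H.
by rewrite NegzE rmorphN mulNr /= cisN H conjc1.
Qed.

End Complex.

Section Integrals.
Context {R : realType}.
Local Notation mu := (@lebesgue_measure R).
Local Notation re := (@complex.Re R).
Local Notation im := (@complex.Im R).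
Local Notation nc := (@ComplexField.Normc.normc R).
Local Notation D := [set` `[0%R, (2 * pi)%R : R]].
Implicit Types (f g h : R -> R[i]) (z w : R[i]) (k : int).

Definition cmeasurable f := measurable_fun setT (re \o f) /\
  measurable_fun setT (im \o f).

Definition cintegrable f := mu.-integrable D (EFin \o (re \o f)) /\
  mu.-integrable D (EFin \o (im \o f)).

Lemma pi2_gt0 : 0 < 2 * pi :> R. Proof. by rewrite mulr_gt0 ?pi_gt0. Qed.

Lemma mu_torus : mu D = (2 * pi)%:E.
Proof. by rewrite lebesgue_measure_itv /= lte_fin pi2_gt0 -EFinB subr0. Qed.

Lemma mu_torus_lty : (mu D < +oo)%E.
Proof. by rewrite mu_torus ltry. Qed.

Lemma cmeasurableD f g : cmeasurable f -> cmeasurable g ->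
  cmeasurable (fun x => f x + g x).
Proof.
move=> [rf jf] [rg jg]; split.
- by rewrite (_ : _ \o _ = (re \o f) \+ (re \o g));
    [exact: measurable_funD|apply/funext => x /=; rewrite reD].
- by rewrite (_ : _ \o _ = (im \o f) \+ (im \o g));
    [exact: measurable_funD|apply/funext => x /=; rewrite imD].
Qed.

Lemma cmeasurableM f g : cmeasurable f -> cmeasurable g ->
  cmeasurable (fun x => f x * g x).
Proof.
move=> [rf jf] [rg jg]; split.
- rewrite (_ : _ \o _ = ((re \o f) \* (re \o g)) \- ((im \o f) \* (im \o g))).
    by apply: measurable_funB; apply: measurable_funM.
  by apply/funext => x /=; rewrite reM.
- rewrite (_ : _ \o _ = ((re \o f) \* (im \o g)) \+ ((im \o f) \* (re \o g))).
    by apply: measurable_funD; apply: measurable_funM.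
  by apply/funext => x /=; rewrite imM.
Qed.

Lemma cmeasurable_cst z : cmeasurable (fun=> z).
Proof. by split; exact: measurable_cst. Qed.

Lemma cmeasurable_cis (c d : R) : cmeasurable (fun x => cis (c * x + d)).
Proof.
have H : continuous (fun x : R => c * x + d).
  by move=> x; apply: cvgD; [apply: cvgMr; exact: cvg_id|exact: cvg_cst].
split; apply: continuous_measurable_fun => x.
- by apply: (@continuous_comp _ _ _ (fun x => c * x + d) cos); [exact: H|exact: continuous_cos].
- by apply: (@continuous_comp _ _ _ (fun x => c * x + d) sin); [exact: H|exact: continuous_sin].
Qed.

Lemma cmeasurable_sum (I : Type) (s : seq I) (F : I -> R -> R[i]) :
  (forall i, cmeasurable (F i)) -> cmeasurable (fun x => \sum_(i <- s) F i x).
Proof.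
move=> mF; elim: s => [|i s IH].
  by under eq_fun do rewrite big_nil; exact: cmeasurable_cst.
by under eq_fun do rewrite big_cons; exact: cmeasurableD.
Qed.

Lemma measurable_normc_sqr f : cmeasurable f ->
  measurable_fun setT (fun x => nc (f x) ^+ 2).
Proof.
move=> [rf jf]; under eq_fun do rewrite normc_sqr.
by apply: measurable_funD; apply: measurable_funX.
Qed.

Lemma cintegrableD f g : cintegrable f -> cintegrable g ->
  cintegrable (fun x => f x + g x).
Proof.
move=> [rf jf] [rg jg]; split.
- apply: eq_integrable (integrableD _ rf rg) => //= x _.
  by rewrite -EFinD -reD.
- apply: eq_integrable (integrableD _ jf jg) => //= x _.
  by rewrite -EFinD -imD.
Qed.

Lemma integrable_torus_cst (c : R) : mu.-integrable D (EFin \o cst c).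
Proof.
apply: measurable_bounded_integrable => //; first exact: mu_torus_lty.
exists `|c|; split; first exact: num_real.
by move=> y cy x _ /=; exact: ltW.
Qed.

Lemma Rintegral_torus_cst (c : R) : \int[mu]_(x in D) c = 2 * pi * c.
Proof.
rewrite Rintegral_cst // mulrC; congr (_ * c).
by transitivity (fine (2 * pi : R)%:E) => //; congr fine; exact: mu_torus.
Qed.

Lemma aeS (P Q : R -> Prop) : (forall x, P x -> Q x) ->
  {ae mu, forall x, P x} -> {ae mu, forall x, Q x}.
Proof. by move=> PQ; apply: (@filterS _ _ (ae_filter_ringOfSetsType mu)). Qed.

Lemma aeS2 (P Q S : R -> Prop) : (forall x, P x -> Q x -> S x) ->
  {ae mu, forall x, P x} -> {ae mu, forall x, Q x} -> {ae mu, forall x, S x}.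
Proof. by move=> PQ; apply: (@filterS2 _ _ (ae_filter_ringOfSetsType mu)). Qed.

Lemma cintegrableM f g (M : R) : cintegrable f -> cmeasurable g ->
  (forall x, nc (g x) <= M) -> cintegrable (fun x => g x * f x).
Proof.
move=> [rf jf] [rg jg] gM.
have K (g' f' : R -> R) : measurable_fun setT g' ->
    (forall x, `|g' x| <= M) -> mu.-integrable D (EFin \o f') ->
    mu.-integrable D (EFin \o (g' \* f')).
  move=> mg' g'M f'i.
  have bg' : [bounded g' x | x in D].
    exists M; split; first exact: num_real.
    by move=> y My x _ /=; apply: le_trans (g'M x) _; apply: ltW.
  have mD : measurable_fun D g' by apply: measurable_funTS.
  have := integrableMr (mu := mu) (measurable_itv _) mD bg' f'i.
  by apply: eq_integrable.
have rM x : `|re (g x)| <= M by apply: le_trans (ler_re_normc _) (gM x).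
have jM x : `|im (g x)| <= M by apply: le_trans (ler_im_normc _) (gM x).
split.
- apply: eq_integrable (integrableB _ (K _ _ rg rM rf) (K _ _ jg jM jf)) => //= x _.
  by rewrite -EFinB -reM.
- apply: eq_integrable (integrableD _ (K _ _ rg rM jf) (K _ _ jg jM rf)) => //= x _.
  by rewrite -EFinD -imM.
Qed.

Lemma cintegrableZ f z : cintegrable f -> cintegrable (fun x => z * f x).
Proof.
by move=> fi; apply: (cintegrableM (g := fun=> z) (M := nc z)) => //; exact: cmeasurable_cst.
Qed.

Lemma cintegrable_bounded f (M : R) : cmeasurable f ->
  (forall x, nc (f x) <= M) -> cintegrable f.
Proof.
move=> mf fM; have : cintegrable (fun x => f x * 1).
  apply: (cintegrableM (M := M)) => //; split.
  - exact: (integrable_torus_cst 1).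
  - exact: (integrable_torus_cst 0).
by rewrite (_ : (fun x => f x * 1) = f) //; apply/funext => x; rewrite mulr1.
Qed.

Lemma cintegrable_cst z : cintegrable (fun=> z).
Proof. by apply: (cintegrable_bounded (M := nc z)) => //; exact: cmeasurable_cst. Qed.

Lemma cintegrable_sum (I : Type) (s : seq I) (F : I -> R -> R[i]) :
  (forall i, cintegrable (F i)) -> cintegrable (fun x => \sum_(i <- s) F i x).
Proof.
move=> iF; elim: s => [|i s IH].
  by under eq_fun do rewrite big_nil; exact: cintegrable_cst.
by under eq_fun do rewrite big_cons; exact: cintegrableD.
Qed.

Lemma L2T_cmeasurable f : L2T f -> cmeasurable f.
Proof. by case. Qed.

Lemma L2T_cintegrable f : L2T f -> cintegrable f.
Proof.
move=> [_ rf jf f2].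
have f2i : mu.-integrable D (EFin \o (fun x => 1 + nc (f x) ^+ 2)).
  apply: (@integrableD _ _ _ mu D _ (EFin \o cst 1) (fun x => (nc (f x) ^+ 2)%:E)) => //.
    exact: (integrable_torus_cst 1).
  apply/integrableP; split.
    by apply/measurable_EFinP; apply: measurable_funTS; apply: measurable_normc_sqr.
  by under eq_integral do rewrite gee0_abs ?lee_fin ?sqr_ge0 //.
have b z : nc z <= 1 + nc z ^+ 2.
  by have := sqr_ge0 (nc z - 2^-1); rewrite sqrrB; lra.
split; apply: le_integrable f2i => //.
- by apply/measurable_EFinP; apply: measurable_funTS.
- move=> x _ /=; rewrite lee_fin [leRHS]ger0_norm ?addr_ge0 ?sqr_ge0 //.
  by apply: le_trans (ler_re_normc _) (b _).
- by apply/measurable_EFinP; apply: measurable_funTS.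
- move=> x _ /=; rewrite lee_fin [leRHS]ger0_norm ?addr_ge0 ?sqr_ge0 //.
  by apply: le_trans (ler_im_normc _) (b _).
Qed.

Lemma torus_cintD f g : cintegrable f -> cintegrable g ->
  torus_cint (fun x => f x + g x) = torus_cint f + torus_cint g.
Proof.
move=> [rf jf] [rg jg]; apply: complex_eq; rewrite ?reD ?imD /=.
- under eq_Rintegral do rewrite reD; exact: RintegralD.
- under eq_Rintegral do rewrite imD; exact: RintegralD.
Qed.

Lemma torus_cintZ f z : cintegrable f ->
  torus_cint (fun x => z * f x) = z * torus_cint f.
Proof.
move=> [rf jf]; have Z (c : R) (h : R -> R) : mu.-integrable D (EFin \o h) ->
    mu.-integrable D (EFin \o (fun x => c * h x)).
  by move=> hi; apply: eq_integrable (integrableZl _ c hi).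
apply: complex_eq; rewrite ?reM ?imM /=.
- under eq_Rintegral do rewrite reM.
  by rewrite RintegralB //; [rewrite !RintegralZl|exact: Z|exact: Z].
- under eq_Rintegral do rewrite imM.
  by rewrite RintegralD //; [rewrite !RintegralZl|exact: Z|exact: Z].
Qed.

Lemma torus_cint_cst z : torus_cint (fun=> z) = (2 * pi)%:C%C * z.
Proof.
by apply: complex_eq; rewrite /torus_cint ?reM ?imM /= !Rintegral_torus_cst; ring.
Qed.

Lemma torus_cint_sum (I : Type) (s : seq I) (F : I -> R -> R[i]) :
  (forall i, cintegrable (F i)) ->
  torus_cint (fun x => \sum_(i <- s) F i x) = \sum_(i <- s) torus_cint (F i).
Proof.
move=> iF; elim: s => [|i s IH].
  rewrite big_nil; under eq_fun do rewrite big_nil.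
  by rewrite torus_cint_cst mulr0.
rewrite big_cons -IH -torus_cintD //; last exact: cintegrable_sum.
by congr torus_cint; apply/funext => x; rewrite big_cons.
Qed.

Lemma torus_cint_ae f g : cmeasurable f -> cmeasurable g ->
  {ae mu, forall x, D x -> f x = g x} -> torus_cint f = torus_cint g.
Proof.
move=> [rf jf] [rg jg] fg; apply: complex_eq => /=; congr fine.
- apply: ae_eq_integral => //.
  + by apply/measurable_EFinP; apply: measurable_funTS.
  + by apply/measurable_EFinP; apply: measurable_funTS.
  + by apply: (aeS _ fg) => x /= fgx Dx; rewrite fgx.
- apply: ae_eq_integral => //.
  + by apply/measurable_EFinP; apply: measurable_funTS.
  + by apply/measurable_EFinP; apply: measurable_funTS.
  + by apply: (aeS _ fg) => x /= fgx Dx; rewrite fgx.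
Qed.

Lemma normr_Rintegral_ae_le (h : R -> R) (M : R) : measurable_fun setT h ->
  mu.-integrable D (EFin \o h) -> 0 <= M ->
  {ae mu, forall x, D x -> `|h x| <= M} ->
  `|\int[mu]_(x in D) h x| <= 2 * pi * M.
Proof.
move=> mh hi M0 hM; apply: le_trans (le_normr_Rintegral _ hi) _ => //.
have nhi : mu.-integrable D (EFin \o (Num.norm \o h)) by exact: integrable_norm.
have -> : 2 * pi * M = \int[mu]_(x in D) M.
  by rewrite Rintegral_torus_cst.
apply: fine_le.
- exact: integrable_fin_num nhi.
- exact: (integrable_fin_num _ (integrable_torus_cst M)).
apply: ae_ge0_le_integral => //.
- by apply/measurable_EFinP; apply: measurable_funTS; apply: measurableT_comp.
Qed.

(** Real and imaginary parts are estimated separately, which turns 2 pi into 4 pi; the factor 2 in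
    [normc_fcoef_le] has the same origin. *)
Lemma normc_torus_cint_le f (M : R) : cmeasurable f -> cintegrable f -> 0 <= M ->
  {ae mu, forall x, D x -> nc (f x) <= M} -> nc (torus_cint f) <= 4 * pi * M.
Proof.
move=> [rf jf] [rfi jfi] M0 fM; apply: le_trans (ler_normc_reim _) _.
rewrite (_ : 4 * pi * M = 2 * pi * M + 2 * pi * M); last by ring.
apply: lerD; apply: normr_Rintegral_ae_le => //.
- apply: (aeS _ fM) => x fMx Dx; exact: le_trans (ler_re_normc _) (fMx Dx).
- apply: (aeS _ fM) => x fMx Dx; exact: le_trans (ler_im_normc _) (fMx Dx).
Qed.

Let ck k : cmeasurable (fun x => cis (- (k%:~R * x))).
Proof.
under eq_fun do rewrite -mulNr -[_ * _]addr0; exact: cmeasurable_cis.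
Qed.

Let ckb k (x : R) : nc (cis (- (k%:~R * x))) <= 1.
Proof. by rewrite normc_cis. Qed.

Lemma cintegrable_fcoef f k : cintegrable f ->
  cintegrable (fun x => f x * cis (- (k%:~R * x))).
Proof.
move=> fi; under eq_fun do rewrite mulrC; exact: cintegrableM fi (ck k) (ckb k).
Qed.

Lemma fcoefD f g k : cintegrable f -> cintegrable g ->
  fcoef (fun x => f x + g x) k = fcoef f k + fcoef g k.
Proof.
move=> fi gi; rewrite /fcoef -mulrDr -torus_cintD; try exact: cintegrable_fcoef.
by under eq_fun do rewrite mulrDl.
Qed.

Lemma fcoefZ f z k : cintegrable f -> fcoef (fun x => z * f x) k = z * fcoef f k.
Proof.
move=> fi; rewrite /fcoef mulrCA -[z * torus_cint _]torus_cintZ; last exact: cintegrable_fcoef.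
by under eq_fun do rewrite -mulrA.
Qed.

Lemma fcoefB f g k : cintegrable f -> cintegrable g ->
  fcoef (fun x => f x - g x) k = fcoef f k - fcoef g k.
Proof.
move=> fi gi; under eq_fun do rewrite -mulN1r.
by rewrite fcoefD ?fcoefZ ?mulN1r //; exact: cintegrableZ.
Qed.

Lemma fcoef_sum (I : Type) (s : seq I) (F : I -> R -> R[i]) k :
  (forall i, cintegrable (F i)) ->
  fcoef (fun x => \sum_(i <- s) F i x) k = \sum_(i <- s) fcoef (F i) k.
Proof.
move=> iF; rewrite /fcoef -mulr_sumr -torus_cint_sum.
  by under eq_fun do rewrite mulr_suml.
by move=> i; exact: cintegrable_fcoef.
Qed.

Lemma fcoef_ae f g k : cmeasurable f -> cmeasurable g ->
  {ae mu, forall x, D x -> f x = g x} -> fcoef f k = fcoef g k.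
Proof.
move=> mf mg fg; rewrite /fcoef; congr (_ * _); apply: torus_cint_ae.
- exact: cmeasurableM.
- exact: cmeasurableM.
by apply: (aeS _ fg) => x fgx Dx; rewrite fgx.
Qed.

Lemma normc_fcoef_le f k (M : R) : cmeasurable f -> cintegrable f -> 0 <= M ->
  {ae mu, forall x, D x -> nc (f x) <= M} -> nc (fcoef f k) <= 2 * M.
Proof.
move=> mf fi M0 fM; rewrite /fcoef normcM normcC ger0_norm; last first.
  by rewrite invr_ge0 ltW ?pi2_gt0.
rewrite ler_pdivrMl ?pi2_gt0 // (_ : 2 * pi * (2 * M) = 4 * pi * M); last by ring.
apply: normc_torus_cint_le => //; first exact: cmeasurableM.
  exact: cintegrable_fcoef.
by apply: (aeS _ fM) => x fMx Dx; rewrite normcM normc_cis mulr1 fMx.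
Qed.

Lemma L2T_bounded f (M : R) : (forall x, f (x + 2 * pi) = f x) -> cmeasurable f ->
  (forall x, nc (f x) <= M) -> L2T f.
Proof.
move=> fp mf fM; case: (mf) => rf jf; split => //.
apply: (@le_lt_trans _ _ (\int[mu]_(x in D) (M ^+ 2)%:E)%E).
  apply: ge0_le_integral => //.
  - by move=> x _; rewrite lee_fin sqr_ge0.
  - by apply/measurable_EFinP; apply: measurable_funTS; apply: measurable_normc_sqr.
  - by move=> x _; rewrite lee_fin ler_pXn2r ?nnegrE ?normc_ge0 // (le_trans (normc_ge0 (f 0))).
rewrite integral_cst // lte_mul_pinfty ?lee_fin ?sqr_ge0 //.
exact: mu_torus_lty.
Qed.

Lemma L2TD f g : L2T f -> L2T g -> L2T (fun x => f x + g x).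
Proof.
move=> [fp rf jf f2] [gp rg jg g2].
have [rfg jfg] : cmeasurable (fun x => f x + g x) by exact: cmeasurableD.
have mf : measurable_fun D (fun x => (2 * nc (f x) ^+ 2)%:E).
  apply/measurable_EFinP; apply: measurable_funTS; apply: measurable_funM => //.
  exact: measurable_normc_sqr.
have mg : measurable_fun D (fun x => (2 * nc (g x) ^+ 2)%:E).
  apply/measurable_EFinP; apply: measurable_funTS; apply: measurable_funM => //.
  exact: measurable_normc_sqr.
split => //; first by move=> x; rewrite fp gp.
apply: (@le_lt_trans _ _ (\int[mu]_(x in D)
    ((2 * nc (f x) ^+ 2)%:E + (2 * nc (g x) ^+ 2)%:E))%E).
  apply: ge0_le_integral => //.
  - by move=> x _; rewrite lee_fin sqr_ge0.
  - by apply/measurable_EFinP; apply: measurable_funTS; apply: measurable_normc_sqr.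
  - exact: emeasurable_funD.
  - move=> x _; rewrite -EFinD lee_fin.
    have := ler_normcD (f x) (g x); have := normc_ge0 (f x + g x).
    have := normc_ge0 (f x); have := normc_ge0 (g x).
    move: (nc (f x)) (nc (g x)) (nc (f x + g x)) => a b c b0 a0 c0 cab.
    have : c ^+ 2 <= (a + b) ^+ 2 by rewrite ler_pXn2r ?nnegrE ?addr_ge0.
    have := sqr_ge0 (a - b); rewrite sqrrB sqrrD; lra.
rewrite ge0_integralD //.
- under eq_integral do rewrite EFinM; under [X in (_ + X)%E]eq_integral do rewrite EFinM.
  rewrite !ge0_integralZl ?lte_add_pinfty ?lte_mul_pinfty //.
  + by apply/measurable_EFinP; apply: measurable_funTS; apply: measurable_normc_sqr.
  + by move=> x _; rewrite lee_fin sqr_ge0.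
  + by apply/measurable_EFinP; apply: measurable_funTS; apply: measurable_normc_sqr.
  + by move=> x _; rewrite lee_fin sqr_ge0.
- by move=> x _; rewrite lee_fin mulr_ge0 ?sqr_ge0.
- by move=> x _; rewrite lee_fin mulr_ge0 ?sqr_ge0.
Qed.

Lemma L2TZ f z : L2T f -> L2T (fun x => z * f x).
Proof.
move=> [fp rf jf f2].
have [rfg jfg] : cmeasurable (fun x => z * f x).
  by apply: cmeasurableM => //; exact: cmeasurable_cst.
split => //; first by move=> x; rewrite fp.
under eq_integral do rewrite normcM exprMn EFinM.
rewrite ge0_integralZl ?lte_mul_pinfty ?lee_fin ?sqr_ge0 //.
- by apply/measurable_EFinP; apply: measurable_funTS; apply: measurable_normc_sqr.
- by move=> x _; rewrite lee_fin sqr_ge0.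
Qed.

Lemma L2TB f g : L2T f -> L2T g -> L2T (fun x => f x - g x).
Proof.
by move=> lf /(L2TZ (-1)) lg; under eq_fun do rewrite -mulN1r; exact: L2TD.
Qed.

End Integrals.

(** * Uniqueness of Fourier coefficients and absolutely summable series *)

Section Uniqueness.
Context {R : realType}.
Local Notation mu := (@lebesgue_measure R).
Local Notation re := (@complex.Re R).
Local Notation im := (@complex.Im R).
Local Notation D := [set` `[0%R, (2 * pi)%R : R]].
Implicit Types (f g h : R -> R[i]) (z w : R[i]) (k m : int).

Definition fnull f := forall k, fcoef f k = 0.

Lemma fnullD f g : cintegrable f -> cintegrable g -> fnull f -> fnull g ->
  fnull (fun x => f x + g x).
Proof. by move=> fi gi f0 g0 k; rewrite fcoefD // f0 g0 addr0. Qed.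

Lemma fnullZ f z : cintegrable f -> fnull f -> fnull (fun x => z * f x).
Proof. by move=> fi f0 k; rewrite fcoefZ // f0 mulr0. Qed.

Lemma fnull_cis f m : fnull f -> fnull (fun x => cis (m%:~R * x) * f x).
Proof.
move=> f0 k; rewrite -[RHS](f0 (k - m)) /fcoef; congr (_ * torus_cint _).
apply/funext => x; rewrite mulrAC -cisD mulrC; congr (_ * cis _).
by rewrite rmorphB /=; ring.
Qed.

Let cis_meas m : cmeasurable (fun x : R => cis (m%:~R * x)).
Proof. by under eq_fun do rewrite -[_ * _]addr0; exact: cmeasurable_cis. Qed.

Lemma cintegrable_cisM f m : cintegrable f ->
  cintegrable (fun x => cis (m%:~R * x) * f x).
Proof.
move=> fi; apply: (cintegrableM (M := 1)) => //.
by move=> x; rewrite normc_cis.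
Qed.

Definition bump (a b theta x : R) : R := a + b * cos (x - theta).

Lemma bumpE (a b theta x : R) : (bump a b theta x)%:C%C =
  a%:C%C + (b / 2)%:C%C * (cis (- theta) * cis (1%:~R * x))
         + (b / 2)%:C%C * (cis theta * cis ((-1)%:~R * x)).
Proof.
rewrite -!cisD mul1r mulN1r /bump.
rewrite (_ : cis (theta - x) = conjc (cis (x - theta))); last first.
  by rewrite -cisN opprB.
rewrite (_ : - theta + x = x - theta) 1?addrC //.
by apply: complex_eq; rewrite !reimE /=; field.
Qed.

(** Multiplication by e^(imx) only shifts the coefficients, so the vanishing of all of them survives
    multiplication by a trigonometric polynomial of degree one, and by iteration by all the
    polynomials [threshold] of it. *)
Lemma bump_integrable_null f (a b theta : R) : cintegrable f -> fnull f ->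
  cintegrable (fun x => (bump a b theta x)%:C%C * f x) /\
  fnull (fun x => (bump a b theta x)%:C%C * f x).
Proof.
move=> fi f0.
have -> : (fun x => (bump a b theta x)%:C%C * f x) = (fun x => a%:C%C * f x +
    ((b / 2)%:C%C * cis (- theta)) * (cis (1%:~R * x) * f x) +
    ((b / 2)%:C%C * cis theta) * (cis ((-1)%:~R * x) * f x)).
  apply/funext => x; rewrite bumpE !mulrDl; congr (_ + _ + _);
    by rewrite !mulrA.
have i1 m z : cintegrable (fun x => z * (cis (m%:~R * x) * f x)).
  by apply: cintegrableZ; exact: cintegrable_cisM.
have n1 m z : fnull (fun x => z * (cis (m%:~R * x) * f x)).
  by apply: fnullZ; [exact: cintegrable_cisM|exact: fnull_cis].
have i2 := cintegrableZ a%:C%C fi; have n2 := fnullZ a%:C%C fi f0.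
split; first by apply: cintegrableD => //; exact: cintegrableD.
by apply: fnullD => //; [exact: cintegrableD|exact: fnullD].
Qed.

Lemma bumpX_integrable_null f (a b theta : R) n : cintegrable f -> fnull f ->
  cintegrable (fun x => (bump a b theta x ^+ n)%:C%C * f x) /\
  fnull (fun x => (bump a b theta x ^+ n)%:C%C * f x).
Proof.
move=> fi f0; elim: n => [|n [IHi IH0]].
  by under eq_fun do rewrite expr0 mul1r.
rewrite (_ : (fun x => (bump a b theta x ^+ n.+1)%:C%C * f x) =
  (fun x => (bump a b theta x)%:C%C * ((bump a b theta x ^+ n)%:C%C * f x))).
  exact: bump_integrable_null.
by apply/funext => x; rewrite exprS rmorphM mulrA.
Qed.

(* For a trigonometric polynomial G with values in [0, 1], the polynomials
   (1 - G^n)^(2^n) of G converge to 1 where G < 1/2 and to 0 where G > 1/2. *)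
Definition threshold (G : R) (n m : nat) : R := (1 - G ^+ n) ^+ m.

Lemma threshold_integrable_null f (a b theta : R) (n m : nat) : cintegrable f -> fnull f ->
  cintegrable (fun x => (threshold (bump a b theta x) n m)%:C%C * f x) /\
  fnull (fun x => (threshold (bump a b theta x) n m)%:C%C * f x).
Proof.
move=> fi f0; elim: m => [|m [IHi IH0]].
  by under eq_fun do rewrite /threshold expr0 mul1r.
rewrite (_ : (fun x => (threshold (bump a b theta x) n m.+1)%:C%C * f x) =
  (fun x => (threshold (bump a b theta x) n m)%:C%C * f x +
    (-1) * ((bump a b theta x ^+ n)%:C%C *
            ((threshold (bump a b theta x) n m)%:C%C * f x)))).
  have [i2 n2] := bumpX_integrable_null a b theta n IHi IH0.
  split; first by apply: cintegrableD => //; exact: cintegrableZ.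
  by apply: fnullD => //; [exact: cintegrableZ|exact: fnullZ].
apply/funext => x; rewrite /threshold exprS rmorphM rmorphB /= rmorph1; ring.
Qed.

Lemma bernoulli_ineq (x : R) n : -1 <= x -> 1 + n%:R * x <= (1 + x) ^+ n.
Proof.
move=> x1; elim: n => [|n IH]; first by rewrite mul0r addr0 expr0.
rewrite exprS; have x1' : 0 <= 1 + x by lra.
apply: le_trans (ler_wpM2l x1' IH); rewrite -natr1.
have : 0 <= n%:R * x ^+ 2 by rewrite mulr_ge0 ?sqr_ge0.
lra.
Qed.

(** Bernoulli's inequality bounds (1 - G^n)^(2^n) from below by 1 - (2G)^n. *)
Lemma cvg_threshold_lt (G : R) : 0 <= G < 2^-1 ->
  threshold G n (2 ^ n) @[n --> \oo] --> (1 : R).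
Proof.
move=> /andP[G0 G1].
have Gn n : 0 <= G ^+ n <= 1 by rewrite exprn_ge0 // exprn_ile1 //; lra.
apply: (@squeeze_cvgr _ _ _ _ (fun n => 1 - (2 * G) ^+ n) (fun=> 1)).
- apply: nearW => n; have /andP[g0 g1] := Gn n; rewrite /threshold.
  rewrite exprn_ile1 ?subr_ge0 ?gerBl // andbT.
  have := @bernoulli_ineq (- G ^+ n) (2 ^ n); rewrite lerN2 => /(_ g1).
  by rewrite mulrN natrX -exprMn.
- rewrite -[X in _ --> X]subr0; apply: cvgB; first exact: cvg_cst.
  by apply: cvg_expr; rewrite ger0_norm; lra.
- exact: cvg_cst.
Qed.

(** With m = 2^n, the product of (1 - G^n)^m and (1 + G^n)^m is at most 1, and the second factor is
    at least m G^n = (2G)^n by Bernoulli, which tends to infinity. *)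
Lemma cvg_threshold_gt (G : R) : 2^-1 < G <= 1 ->
  threshold G n (2 ^ n) @[n --> \oo] --> (0 : R).
Proof.
move=> /andP[G1 G0].
have Gn n : 0 <= G ^+ n <= 1 by rewrite exprn_ge0 ?exprn_ile1 //; lra.
apply: (@squeeze_cvgr _ _ _ _ (fun=> 0) (fun n => (2 * G)^-1 ^+ n)).
- apply: nearW => n; have /andP[g0 g1] := Gn n; rewrite /threshold.
  rewrite exprn_ge0 ?subr_ge0 //= exprVn exprMn -natrX.
  have G2 : 0 < (2 ^ n)%:R * G ^+ n.
    by rewrite mulr_gt0 ?exprn_gt0 ?ltr0n ?expn_gt0 //; lra.
  rewrite -[leRHS]mul1r ler_pdivlMr //.
  have h := @bernoulli_ineq (G ^+ n) (2 ^ n).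
  apply: (@le_trans _ _ ((1 - G ^+ n) ^+ (2 ^ n) * (1 + G ^+ n) ^+ (2 ^ n))).
    apply: ler_wpM2l; first by rewrite exprn_ge0 ?subr_ge0.
    by apply: le_trans (h _); lra.
  rewrite -exprMn exprn_ile1 //.
    by rewrite mulr_ge0 ?subr_ge0 // addr_ge0.
  by rewrite -subr_sqr expr1n gerBl sqr_ge0.
- exact: cvg_cst.
- apply: cvg_expr; rewrite ger0_norm ?invr_ge0 ?invf_lt1; lra.
Qed.

(** A trigonometric polynomial of degree one in y equal to 1/2 + sin(y/2) sin((x - y)/2)/2: on (0, 2
    pi) it exceeds 1/2 precisely for y < x, so its thresholds approximate the indicator of y > x. *)
Definition arc_bump (x y : R) : R :=
  bump (2^-1 - cos (x / 2) / 4) 4^-1 (x / 2) y.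

Lemma arc_bumpE (x y : R) :
  arc_bump x y = 2^-1 + 2^-1 * (sin (y / 2) * sin ((x - y) / 2)).
Proof.
rewrite /arc_bump /bump.
have -> : y - x / 2 = y / 2 - (x - y) / 2 by field.
have -> : x / 2 = y / 2 + (x - y) / 2 by field.
rewrite cosB cosD; by field.
Qed.

Lemma arc_bump_itv (x y : R) : 0 <= arc_bump x y <= 1.
Proof.
rewrite arc_bumpE.
have : `|sin (y / 2) * sin ((x - y) / 2)| <= 1.
  by rewrite normrM -[leRHS]mulr1 ler_pM // sin_max.
by rewrite ler_norml => /andP[]; lra.
Qed.

Lemma arc_bump_gt (x y : R) : 0 < y -> y < x -> x < 2 * pi -> 2^-1 < arc_bump x y.
Proof.
move=> y0 yx xp; rewrite arc_bumpE ltrDl !mulr_gt0 ?invr_gt0 //.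
- by rewrite sin_gt0_pi //; lra.
- by rewrite sin_gt0_pi //; lra.
Qed.

Lemma arc_bump_lt (x y : R) : 0 < x -> x < y -> y < 2 * pi -> arc_bump x y < 2^-1.
Proof.
move=> x0 xy yp; rewrite arc_bumpE (_ : (x - y) / 2 = - ((y - x) / 2)); last by lra.
rewrite sinN mulrN mulrN.
rewrite gtrDl oppr_lt0 !mulr_gt0 ?invr_gt0 //.
- by rewrite sin_gt0_pi //; lra.
- by rewrite sin_gt0_pi //; lra.
Qed.

Lemma ae_neq (c : R) : {ae mu, forall y, y != c}.
Proof.
exists [set c]; split; [exact: measurable_set1|exact: lebesgue_measure_set1|].
by move=> y /= /negP; rewrite negbK => /eqP.
Qed.

Lemma measurable_threshold (x : R) (n m : nat) :
  measurable_fun setT (fun y => threshold (arc_bump x y) n m).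
Proof.
apply: measurable_funX; apply: measurable_funB => //; apply: measurable_funX.
apply: measurable_funD => //; apply: measurable_funM => //.
apply: (measurableT_comp (f := @cos R)).
  by apply: continuous_measurable_fun; exact: continuous_cos.
exact: measurable_funB.
Qed.

(** Dominated convergence along m = 2^n: away from 0, x and 2 pi, where [arc_bump] equals 1/2, the
    thresholds converge to the indicator of (x, 2 pi), and they stay in [0, 1]. *)
Lemma Rintegral_tail_eq0 (h : R -> R) (x : R) : measurable_fun setT h ->
  mu.-integrable D (EFin \o h) -> 0 < x -> x < 2 * pi ->
  (forall n m : nat, \int[mu]_(y in D) (threshold (arc_bump x y) n m * h y) = 0) ->
  \int[mu]_(y in `]x, 2 * pi]) h y = 0.
Proof.
move=> mh hi x0 xp H.
pose f_ n y := (threshold (arc_bump x y) n (2 ^ n) * h y)%:E.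
pose f y := ((h \_ [set` `]x, +oo[]) y)%:E.
have thr n y : 0 <= threshold (arc_bump x y) n (2 ^ n) <= 1.
  have /andP[g0 g1] := arc_bump_itv x y.
  have g01 : 0 <= 1 - arc_bump x y ^+ n <= 1.
    by rewrite subr_ge0 exprn_ile1 // gerBl exprn_ge0.
  by rewrite exprn_ge0 ?exprn_ile1 //; case/andP: g01.
have [] := @dominated_convergence _ _ _ mu D (measurable_itv _) f_ f
  (fun y => `|h y|%:E).
- move=> n; apply/measurable_EFinP; apply: measurable_funTS.
  by apply: measurable_funM => //; exact: measurable_threshold.
- apply/measurable_EFinP; apply: measurable_funTS.
  by apply/(measurable_restrictT _ _).1 => //; exact: measurable_funTS.
- have thr_cvg (l y : R) : threshold (arc_bump x y) n (2 ^ n) @[n --> \oo] --> l ->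
      f_ n y @[n --> \oo] --> (l * h y)%:E.
    move=> tl; apply: cvg_EFin; first exact: nearW.
    by apply: cvgMl.
  have ne2 : {ae mu, forall y, y != 0 /\ y != 2 * pi}.
    by apply: (aeS2 _ (ae_neq 0) (ae_neq (2 * pi))) => y.
  apply: (aeS2 _ ne2 (ae_neq x)) => y [y0 ypi] yx.
  rewrite /= in_itv /= => /andP[y0' yp'].
  have {y0 y0'}y0 : 0 < y by rewrite lt_neqAle eq_sym y0.
  have {ypi yp'}yp : y < 2 * pi by rewrite lt_neqAle ypi.
  have /andP[g0 g1] := arc_bump_itv x y.
  rewrite /f patchE; case: ifPn => [|].
    rewrite inE /= in_itv /= andbT => xy; rewrite -[h y]mul1r.
    by apply: thr_cvg; apply: cvg_threshold_lt; rewrite g0 arc_bump_lt.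
  rewrite notin_setE /= in_itv /= andbT => /negP; rewrite -leNgt le_eqVlt (negPf yx) /=.
  rewrite (_ : point = 0 * h y) => [yx'|]; last by rewrite mul0r.
  by apply: thr_cvg; apply: cvg_threshold_gt; rewrite g1 arc_bump_gt.
- exact: integrable_norm hi.
- apply: aeW => y n Dy; rewrite /f_ lee_fin normrM.
  have /andP[t0 t1] := thr n y; rewrite ger0_norm //.
  by rewrite ler_piMl.
move=> fi _; rewrite (_ : [sequence _]_n = cst 0%E); last first.
  apply/funext => n /=; rewrite -[LHS]fineK; first by rewrite [fine _]H.
  apply: integrable_fin_num => //.
  have := integrableMr (mu := mu) (measurable_itv `[0%R, (2 * pi)%R])
    (measurable_funTS (measurable_threshold x n (2 ^ n))) _ hi.
  apply; exists 1; split; first exact: num_real.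
  move=> M M1 y _ /=; have /andP[t0 t1] := thr n y; rewrite ger0_norm //.
  by apply: le_trans t1 (ltW M1).
move=> /(cvg_unique _ (cvg_cst _)) -/(_ _) f0.
have : \int[mu]_(y in D) (h \_ [set` `]x, +oo[]) y = 0 by rewrite /Rintegral -f0.
rewrite -Rintegral_mkcondr; congr (_ = _); congr (Rintegral _ _ _).
apply/seteqP; split => y /=; rewrite !in_itv /= ?andbT.
  by case=> /andP[_ ->] ->.
by move=> /andP[xy ->]; rewrite xy andbT (le_trans (ltW x0)) // ltW.
Qed.

(** All integrals over tails vanish, as does the full integral, so the primitive of h from 0 is zero
    on (0, 2 pi); Lebesgue differentiation then gives h = 0 almost everywhere. *)
Lemma Rintegral_tail_ae_eq0 (h : R -> R) : measurable_fun setT h ->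
  mu.-integrable D (EFin \o h) ->
  (forall theta a b (n m : nat),
    \int[mu]_(y in D) (threshold (bump a b theta y) n m * h y) = 0) ->
  {ae mu, forall x, D x -> h x = 0}.
Proof.
move=> mh hi H; pose hD := h \_ D.
have mD : measurable D by exact: measurable_itv.
have hDi y : mu.-integrable [set` Interval (BLeft 0) (BRight y)] (EFin \o hD).
  apply: (integrableS (E := setT)) => //.
  have := (integrable_mkcond (mu := mu) (EFin \o h) mD).1 hi.
  by apply: eq_integrable => // x _; rewrite /hD /= !patchE; case: ifPn.
have hDl : locally_integrable setT hD by exact: integrable_locally.
have HF := FTC1 hDi hDl.
have int0 : \int[mu]_(y in D) h y = 0.
  (* The exponent m = 0 makes the threshold the constant 1. *)
  have := H 0 0 0 0%N 0%N; under eq_Rintegral do rewrite /threshold expr0 mul1r.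
  by [].
have F0 x : 0 < x -> x < 2 * pi -> \int[mu]_(t in `[0, x]) hD t = 0.
  move=> x0 xp; have T0 := Rintegral_tail_eq0 mh hi x0 xp (H _ _ _).
  transitivity (\int[mu]_(t in `[0, x]) h t).
    apply: eq_Rintegral => t; rewrite inE /= in_itv /= => /andP[t0 tx].
    by rewrite /hD patchE mem_set //= in_itv /= t0 (le_trans tx) // ltW.
  have := Rintegral_itvB hi (x := x); rewrite !bnd_simp => /(_ (ltW x0) (ltW xp)).
  by rewrite T0 int0 sub0r => /eqP; rewrite oppr_eq0 => /eqP.
have ne2 : {ae mu, forall y : R, y != 0 /\ y != 2 * pi}.
  by apply: (aeS2 _ (ae_neq 0) (ae_neq (2 * pi))) => y.
apply: (aeS2 _ ne2 HF) => x [x0 xpi] + xD.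
move: (xD); rewrite /= in_itv /= => /andP[x0' xp'].
have {x0 x0'}x0 : 0 < x by rewrite lt_neqAle eq_sym x0.
have {xpi xp'}xp : x < 2 * pi by rewrite lt_neqAle xpi.
rewrite lte_fin => /(_ x0) [_].
rewrite /hD patchE mem_set // => <-; rewrite derive1E.
rewrite (@near_eq_derive _ _ _ _ (cst 0)) ?derive_cst //.
near=> y; apply: F0; near: y; [exact: lt_nbhsr|exact: lt_nbhsl].
Unshelve. all: by end_near.
Qed.

(** The coefficient at frequency 0 of threshold times f vanishes. As the thresholds are real valued,
    this statement splits into the real and the imaginary part of f. *)
Theorem fourier_uniqueness f : cmeasurable f -> cintegrable f -> fnull f ->
  {ae mu, forall x, D x -> f x = 0}.
Proof.
move=> [rf jf] fi f0; have [rfi jfi] := fi.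
have H a b theta (n m : nat) : torus_cint (fun x =>
    (threshold (bump a b theta x) n m)%:C%C * f x) = 0.
  have [_ /(_ 0)] := threshold_integrable_null a b theta n m fi f0.
  rewrite /fcoef => /eqP; rewrite mulf_eq0 => /orP[/eqP []|/eqP].
    by move/eqP; rewrite invr_eq0 (gt_eqF pi2_gt0).
  by under eq_fun do rewrite rmorph0 mul0r oppr0 cis0 mulr1.
have fr : {ae mu, forall x, D x -> re (f x) = 0}.
  apply: Rintegral_tail_ae_eq0 => // theta a b n m.
  have /(congr1 re) := H a b theta n m.
  by rewrite /torus_cint /=; under eq_Rintegral do rewrite reM reC imC mul0r subr0.
have fj : {ae mu, forall x, D x -> im (f x) = 0}.
  apply: Rintegral_tail_ae_eq0 => // theta a b n m.
  have /(congr1 im) := H a b theta n m.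
  by rewrite /torus_cint /=; under eq_Rintegral do rewrite imM reC imC mul0r addr0.
by apply: (aeS2 _ fr fj) => x rx jx Dx; apply: complex_eq; rewrite ?rx ?jx.
Qed.

End Uniqueness.

(** * Absolutely summable Fourier series *)

Section Series.
Context {R : realType}.
Local Notation mu := (@lebesgue_measure R).
Local Notation re := (@complex.Re R).
Local Notation im := (@complex.Im R).
Local Notation nc := (@ComplexField.Normc.normc R).
Local Notation D := [set` `[0%R, (2 * pi)%R : R]].
Implicit Types (f g h : R -> R[i]) (z w : R[i]) (k m : int).
Implicit Types (c : int -> R[i]) (S : seq int) (K : nat).

Definition tail_le (F : int -> R) K (e : R) := forall S, uniq S ->
  (forall k, k \in S -> (K < `|k|)%N) -> \sum_(k <- S) F k <= e.

Lemma tail_le_l1le (F : int -> R) K A : l1le F A -> tail_le F K A.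
Proof. by move=> FA S uS _; exact: FA. Qed.

(** A finite set S0 whose sum is within e of the supremum of all finite sums lies in some box; any
    finite set outside that box is disjoint from S0 and can add at most e. *)
Lemma tail_le_small (F : int -> R) A (e : R) : (forall k, 0 <= F k) -> l1le F A ->
  0 < e -> exists K0, forall K, (K0 <= K)%N -> tail_le F K e.
Proof.
move=> F0 FA e0; pose E := [set x | exists2 S, uniq S & x = \sum_(k <- S) F k].
have hE : has_sup E.
  split; first by exists 0, [::]; rewrite ?big_nil.
  by exists A => _ [S uS ->]; exact: FA.
have [_ [S0 uS0 ->] S0e] := sup_adherent e0 hE.
have [K0 SK0] := sub_box S0; exists K0 => K K0K S uS SK.
suff : \sum_(k <- S ++ S0) F k <= sup E by rewrite big_cat /=; lra.
apply: sup_ubound; first by case: hE.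
exists (S ++ S0) => //; rewrite cat_uniq uS uS0 andbT /=; apply/hasPn => k kS0.
apply/negP => /SK; move/SK0: kS0; rewrite mem_box => kK0.
by rewrite ltnNge (leq_trans kK0).
Qed.

Lemma sum_box_split (V : nmodType) (F : int -> V) K K' : (K <= K')%N ->
  \sum_(k <- box K') F k = \sum_(k <- box K) F k +
    \sum_(k <- [seq k <- box K' | (K < `|k|)%N]) F k.
Proof.
move=> KK'; rewrite (bigID (fun k : int => (`|k| <= K)%N)); congr (_ + _).
  rewrite -big_filter; apply: perm_big; apply: uniq_perm.
  - by rewrite filter_uniq ?box_uniq.
  - exact: box_uniq.
  move=> k; rewrite mem_filter !mem_box; case: leqP => //= kK.
  by rewrite (leq_trans kK).
by rewrite big_filter; apply: eq_bigl => k; rewrite -ltnNge.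
Qed.

Definition trig S c (x : R) : R[i] := \sum_(k <- S) c k * cis (k%:~R * x).

Lemma trig_periodic S c x : trig S c (x + 2 * pi) = trig S c x.
Proof. by apply: eq_bigr => k _; rewrite cis_intr_2pi. Qed.

Lemma normc_trig_le S c x : nc (trig S c x) <= \sum_(k <- S) nc (c k).
Proof.
apply: le_trans (ler_normc_sum _ _ _) _.
by apply: ler_sum => k _; rewrite normcM normc_cis mulr1.
Qed.

Let cis_meas m : cmeasurable (fun x : R => cis (m%:~R * x)).
Proof. by under eq_fun do rewrite -[_ * _]addr0; exact: cmeasurable_cis. Qed.

Lemma cmeasurable_trig S c : cmeasurable (trig S c).
Proof.
apply: cmeasurable_sum => k; apply: cmeasurableM; last exact: cis_meas.
exact: cmeasurable_cst.
Qed.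

Lemma cintegrable_trig S c : cintegrable (trig S c).
Proof.
apply: (cintegrable_bounded (M := \sum_(k <- S) nc (c k))).
  exact: cmeasurable_trig.
by move=> x; exact: normc_trig_le.
Qed.

Lemma Rintegral_is_derive (F f : R -> R) (a b : R) : a < b ->
  (forall x : R, is_derive x 1 F (f x)) -> continuous f ->
  \int[mu]_(x in `[a, b]) f x = F b - F a.
Proof.
move=> ab dF cf; have cF : continuous F.
  move=> x; apply: differentiable_continuous; apply/derivable1_diffP.
  by have [] := dF x.
rewrite /Rintegral (continuous_FTC2 (F := F)) //.
- exact: continuous_subspaceT.
- split; first by move=> x _; have [] := dF x.
  + by apply: cvg_at_right_filter; exact: cF.
  + by apply: cvg_at_left_filter; exact: cF.
- by move=> x _; rewrite derive1E; have [_ ->] := dF x.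
Qed.

Lemma Rintegral_cos_sin m : m != 0 ->
  \int[mu]_(x in D) cos (m%:~R * x) = 0 /\ \int[mu]_(x in D) sin (m%:~R * x) = 0.
Proof.
move=> m0; have m0' : m%:~R != 0 :> R by rewrite intr_eq0.
have p0 : 0 < 2 * pi :> R by exact: pi2_gt0.
have dl (x : R) : is_derive x 1 (fun y : R => m%:~R * y) (m%:~R).
  have : is_derive x 1 (m%:~R \*: @id R) (m%:~R *: 1) by apply: is_deriveZ.
  by rewrite /GRing.scale /= mulr1.
have cl : continuous (fun y : R => m%:~R * y :> R).
  by move=> x; apply: cvgMr; exact: cvg_id.
have := cis_intr_2pi m (0 : R); rewrite add0r mulr0 cis0 => -[cm sm].
split.
- have dS (x : R) : is_derive x 1 (fun y => (m%:~R)^-1 * sin (m%:~R * y))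
      (cos (m%:~R * x)).
    have := is_derive1_comp (is_derive_sin _) (dl x).
    move=> /(is_deriveZ (m%:~R)^-1); rewrite /GRing.scale /=.
    by rewrite mulrCA mulVf ?mulr1.
  rewrite (Rintegral_is_derive p0 dS); first by rewrite sm !(mulr0, sin0) subrr.
  move=> x; apply: (@continuous_comp _ _ _ (fun y : R => m%:~R * y) cos).
    exact: cl.
  exact: continuous_cos.
- have dC (x : R) : is_derive x 1 (fun y => - (m%:~R)^-1 * cos (m%:~R * y))
      (sin (m%:~R * x)).
    have := is_derive1_comp (is_derive_cos _) (dl x).
    move=> /(is_deriveZ (- (m%:~R)^-1)); rewrite /GRing.scale /=.
    by rewrite !mulNr mulrN opprK mulrCA mulVf ?mulr1.
  rewrite (Rintegral_is_derive p0 dC); first by rewrite cm mulr0 cos0 subrr.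
  move=> x; apply: (@continuous_comp _ _ _ (fun y : R => m%:~R * y) sin).
    exact: cl.
  exact: continuous_sin.
Qed.

Lemma cintegrable_cis m : cintegrable (fun x : R => cis (m%:~R * x)).
Proof.
apply: (cintegrable_bounded (M := 1)); first exact: cis_meas.
by move=> x; rewrite normc_cis.
Qed.

Lemma torus_cint_cis m : torus_cint (fun x : R => cis (m%:~R * x)) =
  (2 * pi)%:C%C * (m == 0)%:R.
Proof.
have [->|m0] := eqVneq m 0.
  by rewrite -torus_cint_cst; under eq_fun do rewrite mul0r cis0.
by have [c0 s0] := Rintegral_cos_sin m0; rewrite mulr0 /torus_cint /= c0 s0.
Qed.

Lemma fcoef_cis m k : fcoef (fun x : R => cis (m%:~R * x)) k = (m == k)%:R.
Proof.
rewrite /fcoef; under eq_fun do rewrite -cisD -mulrBl -rmorphB /=.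
rewrite torus_cint_cis subr_eq0 mulrA -rmorphM mulVf ?mul1r //.
by rewrite gt_eqF ?pi2_gt0.
Qed.

Lemma fcoef_trig S c k : uniq S -> fcoef (trig S c) k = if k \in S then c k else 0.
Proof.
move=> uS; rewrite /trig fcoef_sum => [|m]; last first.
  by apply: cintegrableZ; exact: cintegrable_cis.
under eq_bigr => m _.
  rewrite fcoefZ ?fcoef_cis; last exact: cintegrable_cis.
  over.
case: ifPn => kS.
  rewrite (bigD1_seq k) //= eqxx mulr1 big1 ?addr0 // => m /negPf ->.
  by rewrite mulr0.
rewrite big_seq big1 // => m mS; case: eqP => [mk|_]; last by rewrite mulr0.
by rewrite mk (negPf kS) in mS.
Qed.

(** The limit along symmetric partial sums; [limn] is meaningful where these converge, in particular
    when [c] is absolutely summable. *)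
Definition fourier_series c (x : R) : R[i] :=
  Complex (limn (fun K => re (trig (box K) c x)))
          (limn (fun K => im (trig (box K) c x))).

Lemma cvg_of_tail (u : nat -> R) : (forall e : R, 0 < e -> exists K0, forall K,
  (K0 <= K)%N -> `|u K - u K0| <= e) -> cvgn u.
Proof.
move=> H; apply/cauchy_cvgP/cauchy_exP => e e0.
have [|K0 HK] := H (e / 2); first by rewrite divr_gt0.
exists (u K0); exists K0 => // K /= K0K; rewrite /ball /= distrC.
by apply: le_lt_trans (HK _ K0K) _; rewrite ltr_pdivrMr ?mulr_natr ?mulr2n ?ltrDl.
Qed.

Lemma cvgn_le (u : nat -> R) (l e : R) N : u K @[K --> \oo] --> l ->
  (forall K, (N <= K)%N -> u K <= e) -> l <= e.
Proof.
move=> ul ue; rewrite -(cvg_lim _ ul) //; apply: limr_le; first exact: cvgP ul.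
by exists N => // K /=; exact: ue.
Qed.

Section Absolute.
Variables (c : int -> R[i]) (A : R).
Hypothesis cA : l1le (fun k => nc (c k)) A.

Lemma normc_trig_diff_le K K' (e x : R) : (K <= K')%N ->
  tail_le (fun k => nc (c k)) K e ->
  nc (trig (box K') c x - trig (box K) c x) <= e.
Proof.
move=> KK' tKe; rewrite /trig (sum_box_split _ KK') addrC addKr.
apply: le_trans (normc_trig_le _ _ _) _; apply: tKe.
  by rewrite filter_uniq ?box_uniq.
by move=> k; rewrite mem_filter => /andP[].
Qed.

Let reim_tail (x e : R) : 0 < e -> exists K0, forall K, (K0 <= K)%N ->
  nc (trig (box K) c x - trig (box K0) c x) <= e.
Proof.
move=> e0; have [K0 HK0] := tail_le_small (fun k => normc_ge0 (c k)) cA e0.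
by exists K0 => K K0K; apply: normc_trig_diff_le => //; exact: HK0.
Qed.

Lemma cvg_re_trig x : re (trig (box K) c x) @[K --> \oo] --> re (fourier_series c x).
Proof.
apply: cvg_of_tail => e /(reim_tail x)[K0 HK]; exists K0 => K /HK.
by apply: le_trans; rewrite -reN -reD; exact: ler_re_normc.
Qed.

Lemma cvg_im_trig x : im (trig (box K) c x) @[K --> \oo] --> im (fourier_series c x).
Proof.
apply: cvg_of_tail => e /(reim_tail x)[K0 HK]; exists K0 => K /HK.
by apply: le_trans; rewrite -imN -imD; exact: ler_im_normc.
Qed.

(** The partial sums of real and imaginary parts converge separately, each within e, whence the
    factor 2. *)
Lemma fourier_series_tail K (e x : R) : tail_le (fun k => nc (c k)) K e ->
  nc (fourier_series c x - trig (box K) c x) <= 2 * e.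
Proof.
move=> tKe; apply: le_trans (ler_normc_reim _) _; rewrite mulr_natl mulr2n.
apply: lerD.
- rewrite reD reN.
  have : `|re (trig (box K') c x) - re (trig (box K) c x)| @[K' --> \oo] -->
      `|re (fourier_series c x) - re (trig (box K) c x)|.
    by apply: cvg_norm; apply: cvgB; [exact: cvg_re_trig|exact: cvg_cst].
  move=> /(@cvgn_le _ _ _ K); apply => K' KK'; rewrite -reN -reD.
  by apply: le_trans (ler_re_normc _) _; exact: normc_trig_diff_le KK' tKe.
- rewrite imD imN.
  have : `|im (trig (box K') c x) - im (trig (box K) c x)| @[K' --> \oo] -->
      `|im (fourier_series c x) - im (trig (box K) c x)|.
    by apply: cvg_norm; apply: cvgB; [exact: cvg_im_trig|exact: cvg_cst].
  move=> /(@cvgn_le _ _ _ K); apply => K' KK'; rewrite -imN -imD.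
  by apply: le_trans (ler_im_normc _) _; exact: normc_trig_diff_le KK' tKe.
Qed.

Lemma fourier_series_periodic x :
  fourier_series c (x + 2 * pi) = fourier_series c x.
Proof.
by rewrite /fourier_series; under eq_fun do rewrite trig_periodic;
  under [X in Complex _ (limn X)]eq_fun do rewrite trig_periodic.
Qed.

Lemma normc_fourier_series_le x : nc (fourier_series c x) <= 3 * A.
Proof.
have := fourier_series_tail (K := 0) x (tail_le_l1le cA).
have h : nc (trig (box 0) c x) <= A.
  by apply: le_trans (normc_trig_le _ _ _) _; apply: cA; exact: box_uniq.
have := ler_normcD (fourier_series c x - trig (box 0) c x) (trig (box 0) c x).
by rewrite subrK; lra.
Qed.

Lemma cmeasurable_fourier_series : cmeasurable (fourier_series c).
Proof.
have mt K := cmeasurable_trig (box K) c.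
split.
- apply: (measurable_fun_cvg (h := fun K => re \o trig (box K) c)).
    by move=> K; case: (mt K).
  by move=> x _; exact: cvg_re_trig.
- apply: (measurable_fun_cvg (h := fun K => im \o trig (box K) c)).
    by move=> K; case: (mt K).
  by move=> x _; exact: cvg_im_trig.
Qed.

Lemma fourier_series_L2T : L2T (fourier_series c).
Proof.
apply: (L2T_bounded (M := 3 * A)); first exact: fourier_series_periodic.
  exact: cmeasurable_fourier_series.
exact: normc_fourier_series_le.
Qed.

Lemma fcoef_fourier_series k : fcoef (fourier_series c) k = c k.
Proof.
apply/eqP; rewrite -subr_eq0; apply/eqP; apply: normc_eq0.
apply: le_anti; rewrite normc_ge0 andbT.
apply/ler_addgt0Pl => e e0; rewrite addr0.
(* A quarter, because [fourier_series_tail] and [normc_fcoef_le] each lose a factor 2. *)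
have e4 : 0 < e / 4 by rewrite divr_gt0.
have [K0 HK0] := tail_le_small (fun k => normc_ge0 (c k)) cA e4.
pose K := maxn K0 `|k|%N.
have tK : tail_le (fun k => nc (c k)) K (e / 4) by apply: HK0; rewrite leq_maxl.
have iS : cintegrable (fourier_series c) by exact: L2T_cintegrable fourier_series_L2T.
have iT := cintegrable_trig (box K) c.
have <- : fcoef (trig (box K) c) k = c k.
  by rewrite fcoef_trig ?box_uniq // mem_box leq_maxr.
rewrite -fcoefB //; apply: le_trans (normc_fcoef_le (M := 2 * (e / 4)) _ _ _ _ _) _.
- have := cmeasurableD cmeasurable_fourier_series
    (cmeasurableM (cmeasurable_cst (-1)) (cmeasurable_trig (box K) c)).
  by under eq_fun do rewrite mulN1r.
- have := cintegrableD iS (cintegrableZ (-1) iT).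
  by under eq_fun do rewrite mulN1r.
- by rewrite mulr_ge0 // ltW.
- by apply: aeW => x _; exact: fourier_series_tail.
- by lra.
Qed.

End Absolute.

(** The function and the sum of its series have the same coefficients, so [fourier_uniqueness]
    applies to their difference. *)
Lemma fourier_inversion f A : cmeasurable f -> cintegrable f ->
  l1le (fun k => nc (fcoef f k)) A ->
  {ae mu, forall x, D x -> f x = fourier_series (fcoef f) x}.
Proof.
move=> mf fi fA; have gL := fourier_series_L2T fA.
have mg := L2T_cmeasurable gL; have gi := L2T_cintegrable gL.
have := @fourier_uniqueness R (fun x => f x - fourier_series (fcoef f) x).
have md : cmeasurable (fun x => f x - fourier_series (fcoef f) x).
  have := cmeasurableD mf (cmeasurableM (cmeasurable_cst (-1)) mg).
  by under eq_fun do rewrite mulN1r.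
have di : cintegrable (fun x => f x - fourier_series (fcoef f) x).
  by have := cintegrableD fi (cintegrableZ (-1) gi); under eq_fun do rewrite mulN1r.
move=> /(_ md di) H; apply: (aeS _ (H _)) => [x Hx Dx|k].
  by apply/eqP; rewrite -subr_eq0 Hx.
by rewrite fcoefB // (fcoef_fourier_series fA) subrr.
Qed.

End Series.

(** * Multipliers, the cubic term and the L2 norm under frequency truncation *)

Section Nonlinearity.
Context {R : realType}.
Local Notation mu := (@lebesgue_measure R).
Local Notation re := (@complex.Re R).
Local Notation nc := (@ComplexField.Normc.normc R).
Local Notation D := [set` `[0%R, (2 * pi)%R : R]].
Implicit Types (f g h : R -> R[i]) (z w : R[i]) (k : int).
Implicit Types (c : int -> R[i]) (S B : seq int) (K : nat).

(** A unimodular symbol preserves the l1 bound, so the series with coefficients m_k times those of f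
    is a witness and [xget] does not return its default. *)
Lemma fourier_multiplierP (m : int -> R[i]) f A :
  (forall k, nc (m k) = 1) -> l1le (fun k => nc (fcoef f k)) A ->
  L2T (fourier_multiplier m f) /\
  forall k, fcoef (fourier_multiplier m f) k = m k * fcoef f k.
Proof.
move=> m1 fA; have mfA : l1le (fun k => nc (m k * fcoef f k)) A.
  by move=> S uS; under eq_bigr do rewrite normcM m1 mul1r; exact: fA.
have : exists g, [set g | L2T g /\ forall k, fcoef g k = m k * fcoef f k] g.
  exists (fourier_series (fun k => m k * fcoef f k)); split.
    exact: fourier_series_L2T mfA.
  by move=> k; rewrite (fcoef_fourier_series mfA).
by move=> [g gP]; have := xgetI (fun=> 0) gP.
Qed.

Definition ccubic B c k : R[i] := \sum_(a <- B) \sum_(b <- B) \sum_(l <- B)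
  c a * c b * conjc (c l) * (a + b - l == k)%:R.

Lemma conjcM z w : conjc (z * w) = conjc z * conjc w.
Proof. exact: rmorphM. Qed.

Lemma conjc_sum (I : Type) (s : seq I) (P : pred I) (F : I -> R[i]) :
  conjc (\sum_(i <- s | P i) F i) = \sum_(i <- s | P i) conjc (F i).
Proof. exact: raddf_sum. Qed.

Lemma normc_sqr_conj z : (nc z ^+ 2)%:C%C = z * conjc z.
Proof.
by apply: complex_eq; rewrite !reimE ?normc_sqr; ring.
Qed.

Lemma fcoef_cubic_trig K c k :
  fcoef (cubic (trig (box K) c)) k = ccubic (box K) c k.
Proof.
have E x : cubic (trig (box K) c) x = \sum_(a <- box K) \sum_(b <- box K)
    \sum_(l <- box K) (c a * c b * conjc (c l)) * cis ((a + b - l)%:~R * x).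
  rewrite /cubic normc_sqr_conj mulrAC.
  rewrite {1 2}/trig big_distrlr /= mulr_suml; apply: eq_bigr => a _.
  rewrite mulr_suml; apply: eq_bigr => b _.
  rewrite /trig conjc_sum mulr_sumr; apply: eq_bigr => l _.
  rewrite conjcM -cisN rmorphB rmorphD /= mulrBl mulrDl !cisD; ring.
rewrite (_ : cubic _ = fun x => \sum_(a <- box K) \sum_(b <- box K)
    \sum_(l <- box K) (c a * c b * conjc (c l)) * cis ((a + b - l)%:~R * x));
  last exact/funext.
have i1 z (m : int) : cintegrable (fun x : R => z * cis (m%:~R * x)).
  by apply: cintegrableZ; exact: cintegrable_cis.
rewrite fcoef_sum => [|a]; last by do 2!apply: cintegrable_sum => ?.
apply: eq_bigr => a _.
rewrite fcoef_sum => [|b]; last by apply: cintegrable_sum => ?.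
apply: eq_bigr => b _; rewrite fcoef_sum //; apply: eq_bigr => l _.
rewrite fcoefZ ?fcoef_cis //; exact: cintegrable_cis.
Qed.

Lemma ler_dist_normc z w : `|nc z - nc w| <= nc (z - w).
Proof.
have h1 := ler_normcD (z - w) w; have h2 := ler_normcD (w - z) z.
rewrite subrK in h1; rewrite subrK normc_distC in h2.
by rewrite ler_norml; apply/andP; split; lra.
Qed.

Lemma normc_cubic_diff z w (M d : R) : nc z <= M -> nc w <= M -> nc (z - w) <= d ->
  nc ((nc z ^+ 2)%:C%C * z - (nc w ^+ 2)%:C%C * w) <= 3 * M ^+ 2 * d.
Proof.
move=> zM wM zwd.
have -> : (nc z ^+ 2)%:C%C * z - (nc w ^+ 2)%:C%C * w =
    (nc z ^+ 2)%:C%C * (z - w) + ((nc z + nc w) * (nc z - nc w))%:C%C * w.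
  by rewrite -[_ * (nc z - nc w)]mulrC -subr_sqr rmorphB /=; ring.
apply: le_trans (ler_normcD _ _) _; rewrite !normcM !normcC.
rewrite [`|(_ + _) * _|]normrM (@ger0_norm _ (nc z ^+ 2)) ?sqr_ge0 //.
rewrite (@ger0_norm _ (nc z + nc w)) ?addr_ge0 ?normc_ge0 //.
have := ler_dist_normc z w; have := normc_ge0 z; have := normc_ge0 w.
have := normc_ge0 (z - w).
move: (nc z) (nc w) (nc (z - w)) zM wM zwd => a b e aM bM ed e0 b0 a0 abe.
have M0 : 0 <= M := le_trans a0 aM.
rewrite (_ : 3 * M ^+ 2 * d = M ^+ 2 * d + (M + M) * d * M); last by ring.
apply: lerD; first by apply: ler_pM => //; rewrite ?sqr_ge0 // ler_pXn2r.
apply: ler_pM => //; first by rewrite mulr_ge0 ?addr_ge0.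
by apply: ler_pM; rewrite ?addr_ge0 ?lerD // (le_trans abe).
Qed.

Lemma cmeasurable_real (h : R -> R) : measurable_fun setT h ->
  cmeasurable (fun x => (h x)%:C%C).
Proof. by move=> mh; split => //; exact: measurable_cst. Qed.

Lemma cmeasurable_cubic f : cmeasurable f -> cmeasurable (cubic f).
Proof.
move=> mf; apply: cmeasurableM => //; apply: cmeasurable_real.
exact: measurable_normc_sqr.
Qed.

Section Truncation.
Variables (f : R -> R[i]) (A : R).
Hypothesis fL : L2T f.
Hypothesis fA : l1le (fun k => nc (fcoef f k)) A.
Let c := fcoef f.
Let g := fourier_series c.

Let A0 : 0 <= A. Proof. exact: l1le_ge0 fA. Qed.
Let mf : cmeasurable f. Proof. exact: L2T_cmeasurable. Qed.
Let mg : cmeasurable g. Proof. exact: cmeasurable_fourier_series fA. Qed.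
Let fg : {ae mu, forall x, D x -> f x = g x}.
Proof. exact: fourier_inversion (L2T_cmeasurable fL) (L2T_cintegrable fL) fA. Qed.
Let gA x : nc (g x) <= 3 * A. Proof. exact: normc_fourier_series_le. Qed.
Let tA K x : nc (trig (box K) c x) <= 3 * A.
Proof.
have /le_trans : nc (trig (box K) c x) <= A.
  by apply: le_trans (normc_trig_le _ _ _) _; apply: fA; exact: box_uniq.
by apply; move: A0; lra.
Qed.

Let cubic_bounded (h : R -> R[i]) x : (forall x, nc (h x) <= 3 * A) ->
  nc (cubic h x) <= (3 * A) ^+ 2 * (3 * A).
Proof.
move=> hA; rewrite /cubic normcM normcC ger0_norm ?sqr_ge0 //.
apply: ler_pM; rewrite ?sqr_ge0 ?normc_ge0 //.
by rewrite ler_pXn2r ?nnegrE ?normc_ge0 // mulr_ge0.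
Qed.

(** The function and its truncation are bounded by 3A and differ by at most 2e, and z -> |z|^2 z has
    Lipschitz constant 3 (3A)^2 there; with the factor 2 of [normc_fcoef_le] this makes 2 * 3 * 9 *
    2 = 108. The bound is uniform in k. *)
Lemma fcoef_cubic_trunc K (e : R) k : 0 <= e -> tail_le (fun k => nc (c k)) K e ->
  nc (fcoef (cubic f) k - ccubic (box K) c k) <= 108 * A ^+ 2 * e.
Proof.
move=> e0 tKe; rewrite -fcoef_cubic_trig.
have mT := cmeasurable_trig (box K) c.
have mcg := cmeasurable_cubic mg; have mcT := cmeasurable_cubic mT.
rewrite (@fcoef_ae _ _ (cubic g) _ (cmeasurable_cubic mf) mcg); last first.
  by apply: (aeS _ fg) => x fgx Dx; rewrite /cubic fgx.
have icg : cintegrable (cubic g).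
  by apply: cintegrable_bounded mcg _ => x; exact: cubic_bounded.
have icT : cintegrable (cubic (trig (box K) c)).
  by apply: cintegrable_bounded mcT _ => x; exact: cubic_bounded.
rewrite -fcoefB //.
rewrite (_ : 108 * A ^+ 2 * e = 2 * (3 * (3 * A) ^+ 2 * (2 * e))); last by ring.
apply: normc_fcoef_le.
- have := cmeasurableD mcg (cmeasurableM (cmeasurable_cst (-1)) mcT).
  by under eq_fun do rewrite mulN1r.
- by have := cintegrableD icg (cintegrableZ (-1) icT); under eq_fun do rewrite mulN1r.
- by rewrite !mulr_ge0 ?sqr_ge0.
- apply: aeW => x _; apply: normc_cubic_diff => //.
  exact: (fourier_series_tail fA).
Qed.

(** A quantitative Parseval identity: it is exact for the trigonometric polynomial, and the squared
    moduli differ by at most (3A + 3A) 2e pointwise, which with the factor 4 pi gives 48 pi. *)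
Lemma L2norm_trunc K (e : R) : 0 <= e -> tail_le (fun k => nc (c k)) K e ->
  `|L2norm f ^+ 2 - 2 * pi * \sum_(k <- box K) nc (c k) ^+ 2| <= 48 * pi * A * e.
Proof.
move=> e0 tKe; set T := trig (box K) c.
have mT : cmeasurable T := cmeasurable_trig (box K) c.
pose sq h : R -> R[i] := fun x => (nc (h x) ^+ 2)%:C%C.
have msq h : cmeasurable h -> cmeasurable (sq h).
  by move=> mh; apply: cmeasurable_real; exact: measurable_normc_sqr.
have isq h : cmeasurable h -> (forall x, nc (h x) <= 3 * A) -> cintegrable (sq h).
  move=> mh hA; apply: (cintegrable_bounded (M := (3 * A) ^+ 2)); first exact: msq.
  move=> x; rewrite normcC ger0_norm ?sqr_ge0 //.
  by rewrite ler_pXn2r ?nnegrE ?normc_ge0 // mulr_ge0.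
have -> : L2norm f ^+ 2 = re (torus_cint (sq g)).
  rewrite /L2norm sqr_sqrtr; last by apply: Rintegral_ge0 => x _; exact: sqr_ge0.
  rewrite -(@torus_cint_ae _ (sq f)) //; [exact: msq|exact: msq|].
  by apply: (aeS _ fg) => x fgx Dx; rewrite /sq fgx.
have -> : 2 * pi * \sum_(k <- box K) nc (c k) ^+ 2 = re (torus_cint (sq T)).
  have i1 z (m : int) : cintegrable (fun x : R => z * cis (m%:~R * x)).
    by apply: cintegrableZ; exact: cintegrable_cis.
  rewrite (_ : sq T = fun x => \sum_(a <- box K) \sum_(b <- box K)
      (c a * conjc (c b)) * cis ((a - b)%:~R * x)); last first.
    apply/funext => x; rewrite /sq normc_sqr_conj /T {1}/trig mulr_suml.
    apply: eq_bigr => a _; rewrite /trig conjc_sum mulr_sumr; apply: eq_bigr => b _.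
    by rewrite conjcM -cisN rmorphB /= mulrBl cisD; ring.
  rewrite torus_cint_sum => [|a]; last exact: cintegrable_sum.
  rewrite re_sum mulr_sumr !big_seq; apply: eq_bigr => a aK.
  rewrite torus_cint_sum // (bigD1_seq a) ?box_uniq //= big1 => [|b ba].
    rewrite torus_cintZ; last exact: cintegrable_cis.
    by rewrite torus_cint_cis subrr eqxx mulr1 -normc_sqr_conj addr0 reM /=; ring.
  rewrite torus_cintZ; last exact: cintegrable_cis.
  by rewrite torus_cint_cis subr_eq0 eq_sym (negPf ba) !mulr0.
rewrite -reN -reD; apply: le_trans (ler_re_normc _) _.
have -> : torus_cint (sq g) - torus_cint (sq T) =
    torus_cint (fun x => sq g x + (-1) * sq T x).
  have iT := isq _ mT (tA K).
  by rewrite torus_cintD ?torus_cintZ ?mulN1r //; [exact: isq|exact: cintegrableZ].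
rewrite (_ : 48 * pi * A * e = 4 * pi * ((3 * A + 3 * A) * (2 * e))); last by ring.
apply: normc_torus_cint_le.
- apply: cmeasurableD; first exact: msq.
  by apply: cmeasurableM; [exact: cmeasurable_cst|exact: msq].
- by apply: cintegrableD; [exact: isq|apply: cintegrableZ; exact: isq _ mT (tA K)].
- by rewrite mulr_ge0 ?addr_ge0 ?mulr_ge0.
apply: aeW => x _; rewrite /sq mulN1r -rmorphB normcC subr_sqr mulrC normrM.
apply: ler_pM => //.
- rewrite ger0_norm ?addr_ge0 ?normc_ge0 // lerD //; exact: tA.
- by apply: le_trans (ler_dist_normc _ _) _; exact: (fourier_series_tail fA).
Qed.

End Truncation.
End Nonlinearity.

(** * Sobolev norms and calculus in time *)

Section SobolevNorm.
Context {R : realType}.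
Local Notation nc := (@ComplexField.Normc.normc R).
Implicit Types (f g : R -> R[i]) (r A : R).

Let weightE r f (k : int) : japanese k `^ (2 * r) * nc (fcoef f k) ^+ 2 =
  (jpow r k * nc (fcoef f k)) ^+ 2.
Proof. by rewrite exprMn jpow_sqr. Qed.

Lemma hle_Hnorm r f : (Hnorm2 r f < +oo)%E ->
  hle r (fun k => nc (fcoef f k)) (Hnorm r f).
Proof.
move=> fr S uS; have f0 : (0 <= Hnorm2 r f)%E.
  by apply: esum_ge0 => k _; rewrite lee_fin weightE sqr_ge0.
rewrite sqr_sqrtr ?fine_ge0 // -lee_fin fineK ?ge0_fin_numE //.
apply: esum_ge; exists [set` S]; first by split => //; exact: finite_seq.
rewrite -fsbig_seq // -sumEFin le_eqVlt; apply/orP; left; apply/eqP.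
by apply: eq_bigr => k _; rewrite weightE.
Qed.

Lemma Hnorm_le r f A : 0 <= A -> hle r (fun k => nc (fcoef f k)) A ->
  (Hnorm2 r f < +oo)%E /\ Hnorm r f <= A.
Proof.
move=> A0 fA; have H : (Hnorm2 r f <= (A ^+ 2)%:E)%E.
  apply: ge_ereal_sup => _ [X [fX _] <-]; rewrite fsbig_finite //=.
  under eq_bigr do rewrite weightE.
  by rewrite sumEFin lee_fin; apply: fA; exact: finmap.fset_uniq.
have Hoo : (Hnorm2 r f < +oo)%E by apply: le_lt_trans H (ltry _).
split => //; have f0 : (0 <= Hnorm2 r f)%E.
  by apply: esum_ge0 => k _; rewrite lee_fin weightE sqr_ge0.
rewrite /Hnorm -(ger0_norm A0) -sqrtr_sqr ler_wsqrtr //.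
by rewrite -lee_fin fineK ?ge0_fin_numE.
Qed.

Lemma Hnorm_ge0 r f : 0 <= Hnorm r f. Proof. exact: sqrtr_ge0. Qed.

End SobolevNorm.

Section HleLimits.
Context {R : realType}.
Implicit Types (f g : int -> R) (r A : R).

Lemma sum_sqr_ge0 (T : Type) (S : seq T) (F : T -> R) : 0 <= \sum_(k <- S) F k ^+ 2.
Proof. by apply: sumr_ge0 => k _; exact: sqr_ge0. Qed.

(** On a finite set a pointwise error e costs at most e times the l2 norm of the weights on that
    set, which tends to 0 with e. Thus pointwise approximation passes on a weighted bound, as in
    Fatou's lemma. *)
Lemma hle_approx r f A : 0 <= A -> (forall k, 0 <= f k) ->
  (forall (S : seq int) (e : R), 0 < e ->
    exists2 g, hle r g A & forall k, k \in S -> f k <= g k + e) ->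
  hle r f A.
Proof.
move=> A0 f0 H S uS.
set q := Num.sqrt (\sum_(k <- S) (jpow r k * f k) ^+ 2).
set X := Num.sqrt (\sum_(k <- S) (jpow r k) ^+ 2).
have q0 : 0 <= q by exact: sqrtr_ge0.
have X0 : 0 <= X by exact: sqrtr_ge0.
have qA e : 0 < e -> q <= A + e * X.
  move=> e0; have [g gA fg] := H S e e0.
  rewrite -(@ler_pXn2r _ 2) ?nnegrE ?addr_ge0 ?mulr_ge0 ?(ltW e0) //.
  rewrite sqr_sqrtr ?sum_sqr_ge0 //.
  apply: (@le_trans _ _ (\sum_(k <- S) (jpow r k * g k + e * jpow r k) ^+ 2)).
    rewrite big_seq [leRHS]big_seq; apply: ler_sum => k kS.
    have h : jpow r k * f k <= jpow r k * g k + e * jpow r k.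
      by rewrite [e * _]mulrC -mulrDr ler_wpM2l ?jpow_ge0 ?fg.
    have j0 : 0 <= jpow r k * f k by rewrite mulr_ge0 ?jpow_ge0.
    by rewrite ler_pXn2r ?nnegrE // (le_trans j0).
  apply: minkowski_le => //; first by rewrite mulr_ge0 // ltW.
    exact: gA.
  under eq_bigr do rewrite exprMn.
  by rewrite -mulr_sumr exprMn sqr_sqrtr ?sum_sqr_ge0.
rewrite -[leLHS]sqr_sqrtr ?sum_sqr_ge0 // -/q.
rewrite ler_pXn2r ?nnegrE //; apply/ler_addgt0Pr => e e0.
have X1 : 0 < X + 1 by rewrite ltr_wpDl.
apply: le_trans (qA (e / (X + 1)) _) _; first by rewrite divr_gt0.
rewrite lerD2l mulrAC ler_pdivrMr // ler_pM2l // lerDl //.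
Qed.

Definition lo (V : zmodType) (K : nat) (f : int -> V) k : V :=
  if k \in box K then f k else 0.

Definition hi (V : zmodType) (K : nat) (f : int -> V) k : V :=
  if k \in box K then 0 else f k.

Lemma hi_ge0 K f k : (forall k, 0 <= f k) -> 0 <= hi K f k.
Proof. by rewrite /hi => f0; case: ifP. Qed.

Lemma hle_hi_small r f A e : (forall k, 0 <= f k) -> hle r f A -> 0 < e ->
  exists K0, forall K, (K0 <= K)%N -> hle r (hi K f) e.
Proof.
move=> f0 fA e0; have e2 : 0 < e ^+ 2 by rewrite exprn_gt0.
have [K0 HK0] := tail_le_small (fun k => sqr_ge0 (jpow r k * f k)) fA e2.
exists K0 => K /HK0 tK S uS.
rewrite (bigID (fun k => k \in box K)) /= big1 ?add0r; last first.
  by move=> k kB; rewrite /hi kB mulr0 expr0n.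
rewrite -big_filter; apply: le_trans (tK [seq k <- S | k \notin box K] _ _).
- rewrite !big_filter le_eqVlt; apply/orP; left; apply/eqP.
  by apply: eq_bigr => k kB; rewrite /hi (negPf kB).
- by rewrite filter_uniq.
- by move=> k; rewrite mem_filter mem_box -ltnNge => /andP[].
Qed.

Lemma tail_le_hi K f A : l1le (hi K f) A -> tail_le f K A.
Proof.
move=> fA S uS SK; apply: le_trans (fA S uS).
rewrite big_seq [leRHS]big_seq le_eqVlt; apply/orP; left; apply/eqP.
by apply: eq_bigr => k /SK; rewrite /hi mem_box ltnNge => /negPf ->.
Qed.

Lemma hle_delta r f A k : hle r f A -> 0 <= A -> 0 <= f k -> jpow r k * f k <= A.
Proof.
move=> fA A0 f0; have := fA [:: k] isT; rewrite big_seq1 ler_pXn2r ?nnegrE //.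
by rewrite mulr_ge0 ?jpow_ge0.
Qed.

End HleLimits.

(** * Complex derivatives, mean value inequalities and primitives in time *)

Section TimeCalculus.
Context {R : realType}.
Local Notation mu := (@lebesgue_measure R).
Local Notation re := (@complex.Re R).
Local Notation im := (@complex.Im R).
Local Notation nc := (@ComplexField.Normc.normc R).
Implicit Types (F G : R -> R[i]) (z d : R[i]) (t a b : R).

Lemma cderive_cst z t : cderive_at (fun=> z) t 0.
Proof. by split; exact: is_derive_cst. Qed.

Lemma cderiveD F G t d e : cderive_at F t d -> cderive_at G t e ->
  cderive_at (fun s => F s + G s) t (d + e).
Proof.
move=> [Fr Fi] [Gr Gi]; split.
- rewrite reD (_ : _ \o _ = (re \o F) + (re \o G)); first exact: is_deriveD.
  by apply/funext => s /=; rewrite reD.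
- rewrite imD (_ : _ \o _ = (im \o F) + (im \o G)); first exact: is_deriveD.
  by apply/funext => s /=; rewrite imD.
Qed.

Lemma cderiveM F G t d e : cderive_at F t d -> cderive_at G t e ->
  cderive_at (fun s => F s * G s) t (d * G t + F t * e).
Proof.
move=> [Fr Fi] [Gr Gi]; split.
- rewrite (_ : _ \o _ = (re \o F) * (re \o G) - (im \o F) * (im \o G)); last first.
    by apply/funext => s /=; rewrite reM.
  apply: (is_derive_eq (is_deriveB (is_deriveM Fr Gr) (is_deriveM Fi Gi))).
  by rewrite !reimE /GRing.scale /=; ring.
- rewrite (_ : _ \o _ = (re \o F) * (im \o G) + (im \o F) * (re \o G)); last first.
    by apply/funext => s /=; rewrite imM.
  apply: (is_derive_eq (is_deriveD (is_deriveM Fr Gi) (is_deriveM Fi Gr))).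
  by rewrite !reimE /GRing.scale /=; ring.
Qed.

Lemma cderive_conj F t d : cderive_at F t d ->
  cderive_at (fun s => conjc (F s)) t (conjc d).
Proof.
move=> [Fr Fi]; split.
- by rewrite reJ (_ : _ \o _ = re \o F) //; apply/funext => s /=; rewrite reJ.
- rewrite imJ (_ : _ \o _ = - (im \o F)); first exact: is_deriveN.
  by apply/funext => s /=; rewrite imJ.
Qed.

Lemma cderiveZ F t d z : cderive_at F t d -> cderive_at (fun s => z * F s) t (z * d).
Proof.
by move=> Fd; have := cderiveM (cderive_cst z t) Fd; rewrite mul0r add0r.
Qed.

Lemma cderive_sum (I : Type) (S : seq I) (F : I -> R -> R[i]) t (d : I -> R[i]) :
  (forall i, cderive_at (F i) t (d i)) ->
  cderive_at (fun s => \sum_(i <- S) F i s) t (\sum_(i <- S) d i).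
Proof.
move=> Fd; elim: S => [|i S IH].
  by under eq_fun do rewrite big_nil; rewrite big_nil; exact: cderive_cst.
by under eq_fun do rewrite big_cons; rewrite big_cons; exact: cderiveD.
Qed.

Lemma cderive_cis (m : R) t :
  cderive_at (fun s => cis (m * s)) t (Complex 0 m * cis (m * t)).
Proof.
have dl : is_derive t 1 (fun y : R => m * y) m.
  have : is_derive t 1 (m \*: @id R) (m *: 1) by apply: is_deriveZ.
  by rewrite /GRing.scale /= mulr1.
split.
- have := is_derive1_comp (is_derive_cos _) dl; rewrite /cis reM /=.
  by rewrite mul0r sub0r mulNr mulrC.
- have := is_derive1_comp (is_derive_sin _) dl; rewrite /cis imM /=.
  by rewrite mul0r add0r mulrC.
Qed.

Lemma is_derive_re F t d z : cderive_at F t d ->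
  is_derive t 1 (fun s => re (z * F s)) (re (z * d)).
Proof. by move=> /(cderiveZ z)[]. Qed.

Lemma mvt_nondecreasing (f df : R -> R) a b : a <= b ->
  (forall t, a <= t <= b -> is_derive t 1 f (df t)) ->
  (forall t, a <= t <= b -> 0 <= df t) -> f a <= f b.
Proof.
move=> ab fd df0.
have [||c cab E] := @MVT_segment R f df a b ab.
- by move=> t /subset_itv_oo_cc; rewrite in_itv /=; exact: fd.
- apply: derivable_within_continuous => t; rewrite in_itv /= => tab.
  by have [] := fd t tab.
- by rewrite -subr_ge0 E mulr_ge0 ?subr_ge0 // df0.
Qed.

(** The mean value inequality for a weighted l2 norm, with a primitive [H] standing for the integral
    of the bound [h]. The curve is tested against its own increment z: the resulting scalar phi
    increases by q^2, where q is the norm of z, while Cauchy-Schwarz gives phi' <= q h. *)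
Lemma vector_mvt (S : seq int) (w : int -> R) (y dy : R -> int -> R[i])
    (H h : R -> R) a b : a <= b -> (forall k, 0 <= w k) ->
  (forall t, a <= t <= b -> forall k, k \in S ->
    cderive_at (fun s => y s k) t (dy t k)) ->
  (forall t, a <= t <= b -> is_derive t 1 H (h t)) ->
  (forall t, a <= t <= b -> 0 <= h t) ->
  (forall t, a <= t <= b -> \sum_(k <- S) (w k * nc (dy t k)) ^+ 2 <= h t ^+ 2) ->
  \sum_(k <- S) (w k * nc (y b k - y a k)) ^+ 2 <= (H b - H a) ^+ 2.
Proof.
move=> ab w0 yd Hd h0 dyh.
pose z k := y b k - y a k; pose Q := \sum_(k <- S) (w k * nc (z k)) ^+ 2.
pose q := Num.sqrt Q; have Q0 : 0 <= Q by exact: sum_sqr_ge0.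
pose phi t := \sum_(k <- S) w k ^+ 2 * re (conjc (z k) * y t k).
pose dphi t := \sum_(k <- S) w k ^+ 2 * re (conjc (z k) * dy t k).
have dphiP t : a <= t <= b -> is_derive t 1 phi (dphi t).
  move=> tab; rewrite /phi /dphi.
  have : {subset S <= S} by [].
  elim: {1 3 4}S => [|k S' IH] SS.
    rewrite (_ : (fun t0 => _) = cst 0); last first.
      by apply/funext => t'; rewrite big_nil.
    by rewrite big_nil; exact: is_derive_cst.
  rewrite (_ : (fun t0 => _) =
    (w k ^+ 2 \*: (fun t0 => re (conjc (z k) * y t0 k))) +
    (fun t0 => \sum_(j <- S') w j ^+ 2 * re (conjc (z j) * y t0 j))); last first.
    by apply/funext => t'; rewrite big_cons.
  rewrite big_cons; apply: is_deriveD.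
    apply: is_deriveZ; apply: is_derive_re; apply: yd => //.
    by apply: SS; rewrite mem_head.
  by apply: IH => j jS'; apply: SS; rewrite inE jS' orbT.
have q0 : 0 <= q by exact: sqrtr_ge0.
have dphi_le t : a <= t <= b -> dphi t <= q * h t.
  move=> tab; apply: (@le_trans _ _ (\sum_(k <- S) (w k * nc (z k)) * (w k * nc (dy t k)))).
    apply: ler_sum => k _; rewrite mulrACA -expr2 ler_wpM2l ?sqr_ge0 //.
    by rewrite -[nc (z k)]normc_conj -normcM (le_trans (ler_norm _)) ?ler_re_normc.
  rewrite (le_trans (ler_norm _)) // -(@ler_pXn2r _ 2) ?nnegrE ?mulr_ge0 ?h0 //.
  rewrite real_normK ?num_real //; apply: le_trans (cauchy_schwarz _ _ _) _.
  rewrite exprMn sqr_sqrtr //; apply: ler_pM; rewrite ?sum_sqr_ge0 //.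
  exact: dyh.
have key : q * H a - phi a <= q * H b - phi b.
  apply: (@mvt_nondecreasing (fun t => q * H t - phi t) (fun t => q * h t - dphi t)).
  - exact: ab.
  - move=> t tab; apply: is_deriveB (dphiP t tab).
    by apply: is_deriveZ; exact: Hd.
  - by move=> t tab; rewrite subr_ge0 dphi_le.
have phiQ : phi b - phi a = q ^+ 2.
  rewrite sqr_sqrtr // -sumrB; apply: eq_bigr => k _.
  rewrite -mulrBr -reN -reD -mulrBr -/(z k) exprMn; congr (_ * _).
  by rewrite mulrC -normc_sqr_conj.
rewrite -/Q -(sqr_sqrtr Q0) -/q.
have [->|qn0] := eqVneq q 0; first by rewrite expr0n sqr_ge0.
have q1 : 0 < q by rewrite lt_neqAle eq_sym qn0.
have qH : q <= H b - H a.
  have lin (x x' u u' : R) : x - u <= x' - u' -> u' - u <= x' - x.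
    by clear; lra.
  by rewrite -(ler_pM2l q1) -expr2 -phiQ mulrBr; exact: lin key.
by rewrite ler_pXn2r ?nnegrE // (le_trans q0).
Qed.

Lemma primitive_on_itv (I : set R) (h : R -> R) a b : open I -> is_interval I ->
  I a -> I b -> a <= b -> {in I, forall t, {for t, continuous h}} ->
  exists2 H : R -> R, forall t, a <= t <= b -> is_derive t 1 H (h t) &
    H b - H a = \int[mu]_(t in `[a, b]) h t.
Proof.
move=> oI iI Ia Ib ab hI.
have [ea /= ea0 Ea] : \forall x \near a, I x by exact: open_nbhs_nbhs.
have [eb /= eb0 Eb] : \forall x \near b, I x by exact: open_nbhs_nbhs.
(* The interval is enlarged inside the open set [I], so that the primitive has two-sided derivatives
   at a and b too. *)
pose a' := a - ea / 2; pose b' := b + eb / 2.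
have a'a : a' < a by rewrite ltrBlDr ltrDl divr_gt0.
have bb' : b < b' by rewrite ltrDl divr_gt0.
have Ia' : I a'.
  apply: Ea; rewrite /ball_ /= opprB addrC subrK gtr0_norm ?divr_gt0 //.
  by rewrite ltr_pdivrMr // mulr_natr mulr2n ltrDl.
have Ib' : I b'.
  apply: Eb; rewrite /ball_ /= opprD addrA subrr sub0r normrN gtr0_norm ?divr_gt0 //.
  by rewrite ltr_pdivrMr // mulr_natr mulr2n ltrDl.
have sI : {subset `[a', b'] <= I}.
  move=> x; rewrite in_itv /= => xab; rewrite inE; exact: iI Ia' Ib' _ xab.
have hi : mu.-integrable `[a', b'] (EFin \o h).
  apply: continuous_compact_integrable; first exact: segment_compact.
  by apply: continuous_in_subspaceT => x /[!inE] xab; apply: hI; exact: sI.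
exists (fun t => \int[mu]_(x in `[a', t]) h x).
  move=> t /andP[at_ tb]; have tI : t \in I.
    by apply: sI; rewrite in_itv /=; apply/andP; split; apply: ltW;
      [exact: lt_le_trans a'a at_|exact: le_lt_trans tb bb'].
  have [||||d1 d2] := @continuous_FTC1_closed R h a' t b'.
  - exact: le_lt_trans tb bb'.
  - exact: hi.
  - exact: lt_le_trans a'a at_.
  - exact: hI.
  by split; [exact: d1|rewrite -derive1E; exact: d2].
have hi2 : mu.-integrable `[a', b] (EFin \o h).
  apply: integrableS hi => //= x /=; rewrite !in_itv /= => /andP[-> xb].
  by rewrite (le_trans xb) // ltW.
rewrite (Rintegral_itvB hi2); [|by rewrite bnd_simp ltW|by rewrite bnd_simp].
rewrite Rintegral_itv_obnd_cbnd //.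
apply: integrableS hi2 => //= x /=; rewrite !in_itv /= => /andP[ax ->].
by rewrite andbT ltW // (lt_trans a'a).
Qed.

End TimeCalculus.

(** * The resonance identity *)

Section TrilinearForms.
Context {R : realType}.
Local Notation nc := (@ComplexField.Normc.normc R).
Implicit Types (z w : R[i]) (k a b l : int) (B S : seq int) (K : nat).
Implicit Types (c f g h : int -> R[i]) (F G H : int -> R).
Implicit Types (m : int -> int -> int -> R[i]).

(** [f], [h] and the conjugated [g] carry the indices a, b and l. A Kronecker symbol replaces the
    substitution l = a + b - k, so that all three factors are truncated to [B] alike and additivity
    in each of them is immediate. *)
Definition tri m B f g h k : R[i] := \sum_(a <- B) \sum_(b <- B) \sum_(l <- B)
  m k a b * (f a * h b * conjc (g l)) * (a + b - l == k)%:R.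

Lemma sum_delta (V : nmodType) B (x : int) (v : int -> V) : uniq B ->
  \sum_(l <- B) (if l == x then v l else 0) = if x \in B then v x else 0.
Proof.
move=> uB; case: ifPn => xB.
  by rewrite (bigD1_seq x) //= eqxx big1 ?addr0 // => l /negPf ->.
rewrite big_seq big1 // => l lB; case: eqP => // lx.
by rewrite -lx lB in xB.
Qed.

Lemma tri_inner m B f g h k a b : uniq B ->
  \sum_(l <- B) m k a b * (f a * h b * conjc (g l)) * (a + b - l == k)%:R =
  if a + b - k \in B then m k a b * (f a * h b * conjc (g (a + b - k))) else 0.
Proof.
move=> uB; rewrite -(sum_delta (a + b - k)
  (fun l => m k a b * (f a * h b * conjc (g l)))) //.
apply: eq_bigr => l _.
rewrite (_ : (a + b - l == k) = (l == a + b - k)); last by lia.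
by case: eqP => _; rewrite ?mulr1 ?mulr0.
Qed.

Lemma normc_tri_le m (w : int -> int -> int -> R) B f g h k : uniq B ->
  (forall a b, nc (m k a b) <= w k a b) ->
  nc (tri m B f g h k) <= \sum_(a <- B) \sum_(b <- B)
    nc (f a) * nc (g (a + b - k)) * nc (h b) * w k a b.
Proof.
move=> uB mw; apply: le_trans (ler_normc_sum _ _ _) _; apply: ler_sum => a _.
apply: le_trans (ler_normc_sum _ _ _) _; apply: ler_sum => b _.
rewrite tri_inner //; have w0 := le_trans (normc_ge0 (m k a b)) (mw a b).
case: ifP => _; last by rewrite normc0 !mulr_ge0 ?normc_ge0.
rewrite !normcM normc_conj mulrC [nc (f a) * nc (h b) * _]mulrAC.
by rewrite ler_wpM2l // !mulr_ge0 ?normc_ge0.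
Qed.

Definition ker_one k a b : R[i] := 1.
Definition ker_nonres k a b : R[i] := ((a != k) && (b != k))%:R.
(** The kernel 1/(i Psi) off the resonances: integrating an oscillation with frequency Psi in time
    divides by i Psi. *)
Definition ker_phase (alpha : R) k a b : R[i] :=
  if (a != k) && (b != k) then (Complex 0 (phase alpha k a b))^-1 else 0.

Lemma ccubic_tri B c k : ccubic B c k = tri ker_one B c c c k.
Proof. by do 3!(apply: eq_bigr => ? _); rewrite /ker_one mul1r. Qed.

Lemma normc_tri_one_le B f g h k : uniq B -> nc (tri ker_one B f g h k) <=
  cubic_sum B (nc \o f) (nc \o g) (nc \o h) k.
Proof.
move=> uB; apply: le_trans (@normc_tri_le ker_one (fun _ _ _ => 1) _ _ _ _ _ uB _) _.
  by move=> a b; rewrite /ker_one (normcC 1) normr1.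
by under eq_bigr do under eq_bigr do rewrite mulr1.
Qed.

Lemma normc_tri_nonres_le B f g h k : uniq B -> nc (tri ker_nonres B f g h k) <=
  cubic_sum B (nc \o f) (nc \o g) (nc \o h) k.
Proof.
move=> uB; apply: le_trans (@normc_tri_le ker_nonres (fun _ _ _ => 1) _ _ _ _ _ uB _) _.
  move=> a b; rewrite /ker_nonres; case: (_ && _); last by rewrite normc0.
  by rewrite (normcC 1) normr1.
by under eq_bigr do under eq_bigr do rewrite mulr1.
Qed.

Lemma normc_im (x : R) : nc (Complex 0 x) = `|x|.
Proof. by rewrite /= expr0n add0r sqrtr_sqr. Qed.

Lemma normcV z : nc z^-1 = (nc z)^-1. Proof. exact: ComplexField.Normc.normcV. Qed.

Lemma normc_tri_phase_le alpha B f g h k : uniq B ->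
  nc (tri (ker_phase alpha) B f g h k) <=
  nonres_sum alpha B (nc \o f) (nc \o g) (nc \o h) k.
Proof.
move=> uB; apply: le_trans (@normc_tri_le (ker_phase alpha) (fun k a b =>
    if (a != k) && (b != k) then `|phase alpha k a b|^-1 else 0) _ _ _ _ _ uB _) _.
  move=> a b; rewrite /ker_phase; case: ifP => _; last by rewrite normc0.
  by rewrite normcV normc_im.
rewrite /nonres_sum; apply: ler_sum => a _; rewrite [leRHS]big_mkcond /=.
by apply: ler_sum => b _; case: ifP => _; rewrite ?mulr0.
Qed.

Lemma ler_pM3 (x y v x' y' v' : R) : 0 <= x <= x' -> 0 <= y <= y' -> 0 <= v <= v' ->
  x * y * v <= x' * y' * v'.
Proof.
move=> /andP[x0 xx] /andP[y0 yy] /andP[v0 vv].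
by apply: ler_pM => //; [exact: mulr_ge0|exact: ler_pM].
Qed.

Lemma cubic_sum_le B F F' G G' H H' k : (forall k, 0 <= F k <= F' k) ->
  (forall k, 0 <= G k <= G' k) -> (forall k, 0 <= H k <= H' k) ->
  cubic_sum B F G H k <= cubic_sum B F' G' H' k.
Proof.
move=> FF GG HH; do 2!(apply: ler_sum => ? _).
exact: ler_pM3.
Qed.

Lemma nonres_sum_le alpha B F F' G G' H H' k : (forall k, 0 <= F k <= F' k) ->
  (forall k, 0 <= G k <= G' k) -> (forall k, 0 <= H k <= H' k) ->
  nonres_sum alpha B F G H k <= nonres_sum alpha B F' G' H' k.
Proof.
move=> FF GG HH; do 2!(apply: ler_sum => ? _); apply: ler_wpM2r; first by rewrite invr_ge0.
exact: ler_pM3.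
Qed.

Lemma tri_diff m B f g h f' g' h' k :
  tri m B f g h k - tri m B f' g' h' k =
  tri m B (fun j => f j - f' j) g h k + tri m B f' (fun j => g j - g' j) h k +
  tri m B f' g' (fun j => h j - h' j) k.
Proof.
rewrite /tri -sumrB -!big_split /=; apply: eq_bigr => a _.
rewrite -sumrB -!big_split /=; apply: eq_bigr => b _.
rewrite -sumrB -!big_split /=; apply: eq_bigr => l _.
by rewrite [conjc (g l - g' l)]rmorphB /=; ring.
Qed.

Lemma sum_box_lo (V : zmodType) (X : int -> V) K K' : (K <= K')%N ->
  \sum_(a <- box K') (if a \in box K then X a else 0) = \sum_(a <- box K) X a.
Proof.
move=> KK'; rewrite (sum_box_split _ KK') [X in _ + X]big1_seq ?addr0.
  by rewrite big_seq [RHS]big_seq; apply: eq_bigr => a ->.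
by move=> a /andP[_]; rewrite mem_filter mem_box ltnNge => /andP[/negPf -> _].
Qed.

Lemma triDl m B f f' g h k : tri m B (fun j => f j + f' j) g h k =
  tri m B f g h k + tri m B f' g h k.
Proof.
by rewrite /tri -big_split; apply: eq_bigr => a _; rewrite -big_split;
  apply: eq_bigr => b _; rewrite -big_split; apply: eq_bigr => l _ /=; ring.
Qed.

Lemma triDm m B f g g' h k : tri m B f (fun j => g j + g' j) h k =
  tri m B f g h k + tri m B f g' h k.
Proof.
rewrite /tri -big_split; apply: eq_bigr => a _; rewrite -big_split.
apply: eq_bigr => b _; rewrite -big_split; apply: eq_bigr => l _ /=.
by rewrite [conjc (g l + g' l)]rmorphD /=; ring.
Qed.

Lemma triDr m B f g h h' k : tri m B f g (fun j => h j + h' j) k =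
  tri m B f g h k + tri m B f g h' k.
Proof.
by rewrite /tri -big_split; apply: eq_bigr => a _; rewrite -big_split;
  apply: eq_bigr => b _; rewrite -big_split; apply: eq_bigr => l _ /=; ring.
Qed.

(** Shrinking the box is the same as cutting the sequence off, so forms with two truncations can be
    compared over one box and their difference carries a tail factor. *)
Lemma tri_box_lo m c K K' k : (K <= K')%N ->
  tri m (box K) c c c k = tri m (box K') (lo K c) (lo K c) (lo K c) k.
Proof.
move=> KK'; rewrite /tri -(sum_box_lo _ KK'); apply: eq_bigr => a _.
rewrite {1}/lo; case: ifP => _; last first.
  by rewrite big1 // => b _; rewrite big1 // => l _; rewrite !(mul0r, mulr0).
rewrite -(sum_box_lo _ KK'); apply: eq_bigr => b _.
rewrite {1}/lo; case: ifP => _; last first.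
  by rewrite big1 // => l _; rewrite !(mul0r, mulr0).
rewrite -(sum_box_lo _ KK'); apply: eq_bigr => l _.
by rewrite /lo; case: ifP => _ //; rewrite conjc0 !(mul0r, mulr0).
Qed.

Lemma normc_sub_lo c K k : nc (c k - lo K c k) = hi K (nc \o c) k.
Proof. by rewrite /lo /hi; case: ifP; rewrite ?subrr ?normc0 ?subr0. Qed.

Lemma normc_lo_le c K k : nc (lo K c k) <= nc (c k).
Proof. by rewrite /lo; case: ifP => // _; rewrite normc0 normc_ge0. Qed.

(** Majorant for the derivative of a trilinear [T] on the diagonal in a direction of size [D], and
    for its increment between two points of size at most [A] at distance [D]. *)
Definition leibniz3 (T : (int -> R) -> (int -> R) -> (int -> R) -> int -> R)
  (D A : int -> R) k : R := T D A A k + T A D A k + T A A D k.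

Lemma tri_one_diff_le B c c' (A : int -> R) k : uniq B ->
  (forall k, nc (c k) <= A k) -> (forall k, nc (c' k) <= A k) ->
  nc (tri ker_one B c c c k - tri ker_one B c' c' c' k) <=
  leibniz3 (cubic_sum B) (fun k => nc (c k - c' k)) A k.
Proof.
move=> uB cA c'A; rewrite tri_diff; apply: le_trans (ler_normcD _ _) _.
apply: lerD; first apply: le_trans (ler_normcD _ _) _; first apply: lerD.
all: apply: le_trans (normc_tri_one_le _ _ _ _ uB) _; apply: cubic_sum_le => j /=.
all: by rewrite normc_ge0 //=.
Qed.

Lemma tri_phase_diff_le alpha B c c' (A : int -> R) k : uniq B ->
  (forall k, nc (c k) <= A k) -> (forall k, nc (c' k) <= A k) ->
  nc (tri (ker_phase alpha) B c c c k - tri (ker_phase alpha) B c' c' c' k) <=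
  leibniz3 (nonres_sum alpha B) (fun k => nc (c k - c' k)) A k.
Proof.
move=> uB cA c'A; rewrite tri_diff; apply: le_trans (ler_normcD _ _) _.
apply: lerD; first apply: le_trans (ler_normcD _ _) _; first apply: lerD.
all: apply: le_trans (normc_tri_phase_le _ _ _ _ _ uB) _; apply: nonres_sum_le => j /=.
all: by rewrite normc_ge0 //=.
Qed.

(** Inclusion and exclusion over a = k and b = k. If b = k then l = a, and the terms sum to (sum
    |c_j|^2) c_k; likewise for a = k; the common term a = b = k is |c_k|^2 c_k. *)
Lemma tri_one_decomp B c k : uniq B -> k \in B ->
  tri ker_one B c c c k = tri ker_nonres B c c c k +
    (2 * \sum_(j <- B) nc (c j) ^+ 2 - nc (c k) ^+ 2)%:C%C * c k.
Proof.
move=> uB kB; apply/eqP; rewrite addrC -subr_eq; apply/eqP.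
rewrite /tri -sumrB.
pose v a b := if a + b - k \in B then c a * c b * conjc (c (a + b - k)) else 0.
transitivity (\sum_(a <- B) \sum_(b <- B)
    ((if b == k then v a b else 0) + (if a == k then v a b else 0)
     - (if a == k then if b == k then v a b else 0 else 0))).
  apply: eq_bigr => a _; rewrite -sumrB; apply: eq_bigr => b _.
  rewrite !tri_inner // /ker_one /ker_nonres /v.
  case: (a + b - k \in B); last by do 2![case: (_ == k)]; rewrite ?addr0 ?subr0.
  case: (a == k); case: (b == k) => /=; ring.
under eq_bigr do rewrite sumrB big_split /=.
rewrite sumrB big_split /=.
have S1 a : \sum_(b <- B) (if b == k then v a b else 0) = v a k.
  by rewrite sum_delta // kB.
under eq_bigr do rewrite S1.
have vk a : a \in B -> v a k = (nc (c a) ^+ 2)%:C%C * c k.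
  by move=> aB; rewrite /v addrK aB normc_sqr_conj mulrAC.
have vk' a : a \in B -> v k a = (nc (c a) ^+ 2)%:C%C * c k.
  move=> aB; rewrite /v [k + a]addrC addrK aB normc_sqr_conj.
  by rewrite [c k * _]mulrC mulrAC.
have X1 : \sum_(a <- B) v a k = (\sum_(j <- B) nc (c j) ^+ 2)%:C%C * c k.
  rewrite rmorph_sum /= mulr_suml !big_seq.
  by apply: eq_bigr => a aB; rewrite vk.
have X2 : \sum_(a <- B) \sum_(b <- B) (if a == k then v a b else 0) =
    (\sum_(j <- B) nc (c j) ^+ 2)%:C%C * c k.
  rewrite (bigD1_seq k) //= [X in _ + X]big1 ?addr0; last first.
    by move=> a /negPf ->; rewrite big1.
  rewrite eqxx rmorph_sum /= mulr_suml !big_seq.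
  by apply: eq_bigr => a aB; rewrite vk'.
have X3 : \sum_(a <- B) \sum_(b <- B)
    (if a == k then if b == k then v a b else 0 else 0) =
    (nc (c k) ^+ 2)%:C%C * c k.
  rewrite (bigD1_seq k) //= [X in _ + X]big1 ?addr0; last first.
    by move=> a /negPf ->; rewrite big1.
  by rewrite eqxx S1 vk.
rewrite X1 X2 X3 !rmorphB !rmorphM /=.
by rewrite (_ : (2 : R)%:C%C = 2) ?rmorphMn //; ring.
Qed.

(** Since conjugation reverses the sign, the three slots together contribute i (mu_a + mu_b - mu_l)
    = i Psi + i mu_k. The part i Psi cancels the kernel and leaves the nonresonant sum. The shift by
    P disappears from Psi, which has two plus and two minus signs. *)
Lemma tri_phase_frequency alpha (P : R) B c k (mu := fun j => frac_symbol alpha j - P)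
    (ic := fun j => Complex 0 (mu j) * c j) : uniq B ->
  (forall a b, a != k -> b != k -> phase alpha k a b != 0) ->
  tri (ker_phase alpha) B ic c c k + tri (ker_phase alpha) B c ic c k +
  tri (ker_phase alpha) B c c ic k =
  Complex 0 (mu k) * tri (ker_phase alpha) B c c c k + tri ker_nonres B c c c k.
Proof.
move=> uB ph0; rewrite /tri mulr_sumr -!big_split /=; apply: eq_bigr => a _.
rewrite mulr_sumr -!big_split /=; apply: eq_bigr => b _.
rewrite mulr_sumr -!big_split /=; apply: eq_bigr => l _.
case: eqP => [E|_]; last by rewrite !mulr0 !addr0.
rewrite /ker_phase /ker_nonres; case: ifPn => [/andP[ak bk]|_]; last first.
  by rewrite !(mul0r, mulr0) !addr0.
have lE : l = a + b - k by lia.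
have ph : Complex 0 (phase alpha k a b) != 0.
  by apply: contra (ph0 a b ak bk) => /eqP[->].
have phE : Complex 0 (phase alpha k a b) = Complex 0 (mu a) + Complex 0 (mu b)
    - Complex 0 (mu l) - Complex 0 (mu k).
  apply: complex_eq; rewrite !reimE /= /phase /mu ?lE.
    by rewrite !(oppr0, addr0).
  by ring.
have -> : conjc (ic l) = - Complex 0 (mu l) * conjc (c l).
  by rewrite /ic conjcM; congr (_ * _); apply: complex_eq; rewrite !reimE /= ?oppr0.
have qph := mulVf ph; rewrite /ic phE in qph *.
move: (_^-1) qph => q qph; rewrite !mulr1.
rewrite (_ : true%:R = 1) // -[1 in RHS]qph.
move: (Complex 0 (mu a)) (Complex 0 (mu b)) (Complex 0 (mu l)) => ia ib il.
move: (Complex 0 (mu k)) (c a) (c b) (conjc (c l)) => ik ca cb cl; clear.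
move: q ia ib il ik ca cb cl; rewrite -/(GRing.Field.sort _).
by move=> *; ring.
Qed.

Lemma cderive_tri m B (c : R -> int -> R[i]) (dc : int -> R[i]) (t : R) k :
  (forall j, cderive_at (fun s => c s j) t (dc j)) ->
  cderive_at (fun s => tri m B (c s) (c s) (c s) k) t
    (tri m B dc (c t) (c t) k + tri m B (c t) dc (c t) k + tri m B (c t) (c t) dc k).
Proof.
move=> cd; rewrite /tri -!big_split /=; apply: cderive_sum => a.
rewrite -!big_split /=; apply: cderive_sum => b.
rewrite -!big_split /=; apply: cderive_sum => l.
have := cderiveM (cderiveM (cd a) (cd b)) (cderive_conj (cd l)).
move=> /(cderiveZ (m k a b)) /cderiveM /(_ (cderive_cst _ _)).
move=> /(_ (a + b - l == k)%:R).
set X := (X in cderive_at _ _ X -> _); set Y := (X in _ -> cderive_at _ _ X).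
suff -> : X = Y by [].
by rewrite /X /Y; ring.
Qed.

End TrilinearForms.

Section Quartic.
Context {R : realType}.
Local Notation re := (@complex.Re R).
Local Notation im := (@complex.Im R).
Local Notation nc := (@ComplexField.Normc.normc R).
Implicit Types (c : int -> R[i]) (B S : seq int).

Lemma hle_of_sum r (f : int -> R) A : 0 <= A ->
  (forall S, uniq S -> forall e, 0 < e ->
    \sum_(k <- S) (jpow r k * f k) ^+ 2 <= (A + e) ^+ 2) -> hle r f A.
Proof.
move=> A0 H S uS; rewrite -[leLHS]sqr_sqrtr ?sum_sqr_ge0 //.
rewrite ler_pXn2r ?nnegrE ?sqrtr_ge0 //; apply/ler_addgt0Pr => e e0.
rewrite -(@ler_pXn2r _ 2) ?nnegrE ?sqrtr_ge0 ?addr_ge0 ?(ltW e0) //.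
by rewrite sqr_sqrtr ?sum_sqr_ge0 // H.
Qed.

Definition quartic B c : R[i] := \sum_(k <- B) conjc (c k) * ccubic B c k.

(** Conjugation exchanges the pair (k, l) with (a, b), and both the box and the condition a + b = k
    + l are invariant. This reality is the source of conservation of mass, and it holds exactly at
    every truncation. *)
Lemma im_quartic B c : im (quartic B c) = 0.
Proof.
suff qc : conjc (quartic B c) = quartic B c.
  by have := congr1 im qc; rewrite imJ; lra.
have E : quartic B c = \sum_(k <- B) \sum_(a <- B) \sum_(b <- B) \sum_(l <- B)
    conjc (c k) * (c a * c b * conjc (c l)) * (a + b - l == k)%:R.
  apply: eq_bigr => k _; rewrite mulr_sumr; apply: eq_bigr => a _.
  rewrite mulr_sumr; apply: eq_bigr => b _; rewrite mulr_sumr.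
  by apply: eq_bigr => l _; rewrite mulrA.
rewrite {2}E exchange_big /= E conjc_sum; apply: eq_bigr => k _.
rewrite conjc_sum; apply: eq_bigr => a _.
rewrite exchange_big conjc_sum; apply: eq_bigr => b _ /=.
rewrite conjc_sum; apply: eq_bigr => l _; rewrite !conjcM !conjcK.
rewrite [conjc (_)%:R](_ : _ = (k + b - l == a)%:R); first by ring.
by rewrite conjc_nat (_ : (a + l - b == k) = (k + b - l == a)) //; lia.
Qed.

Lemma abs_mvt (f df : R -> R) (M a b : R) : a <= b ->
  (forall t, a <= t <= b -> is_derive t 1 f (df t)) ->
  (forall t, a <= t <= b -> `|df t| <= M) -> `|f b - f a| <= M * (b - a).
Proof.
move=> ab fd dfM.
have dM (t : R) : is_derive t 1 (fun x : R => M * x) M.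
  have : is_derive t 1 (M \*: @id R) (M *: 1) by apply: is_deriveZ.
  by rewrite /GRing.scale /= mulr1.
have h1 : M * a - f a <= M * b - f b.
  apply: (mvt_nondecreasing (f := fun t => M * t - f t) (df := fun t => M - df t)) ab _ _.
    by move=> t tab; apply: is_deriveB (fd t tab).
  move=> t tab; rewrite subr_ge0; apply: le_trans (dfM t tab); exact: ler_norm.
have h2 : M * a + f a <= M * b + f b.
  apply: (mvt_nondecreasing (f := fun t => M * t + f t) (df := fun t => M + df t)) ab _ _.
    by move=> t tab; apply: is_deriveD (fd t tab).
  move=> t tab; rewrite -[M]opprK addrC subr_ge0 lerNl.
  by apply: le_trans (dfM t tab); rewrite -normrN ler_norm.
by rewrite ler_norml mulrBr; apply/andP; split; lra.
Qed.

Lemma is_derive_sum_normc_sqr S (c : R -> int -> R[i]) (w : int -> R)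
    (dc : int -> R[i]) t : (forall k, cderive_at (fun x => c x k) t (dc k)) ->
  is_derive t 1 (fun x => \sum_(k <- S) w k * nc (c x k) ^+ 2)
    (\sum_(k <- S) w k * (2 * re (conjc (c t k) * dc k))).
Proof.
move=> cd; have := cderive_sum S (fun k => cderiveZ ((w k)%:C)%C
  (cderiveM (cderive_conj (cd k)) (cd k))).
move=> [+ _]; set F := (X in is_derive _ _ X _).
rewrite (_ : F = fun x => \sum_(k <- S) w k * nc (c x k) ^+ 2); last first.
  apply/funext => x; rewrite /F /= re_sum; apply: eq_bigr => k _.
  by rewrite [conjc _ * _]mulrC -normc_sqr_conj -rmorphM reC.
rewrite re_sum; set d1 := (X in is_derive _ _ _ X -> _).
suff -> : d1 = \sum_(k <- S) w k * (2 * re (conjc (c t k) * dc k)) by [].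
by apply: eq_bigr => k _; rewrite !reimE; ring.
Qed.

Lemma re_i (x : R) : re (Complex 0 x) = 0. Proof. by []. Qed.

Lemma im_i (x : R) : im (Complex 0 x) = x. Proof. by []. Qed.

Lemma ler_div_succ (x e : R) : 0 <= x -> 0 < e -> x * (e / (x + 1)) <= e.
Proof.
move=> x0 e0; rewrite mulrA ler_pdivrMr ?ltr_wpDl // mulrC ler_pM2l //.
by rewrite lerDl.
Qed.

End Quartic.

Section Flow.
Context {R : realType}.
Local Notation nc := (@ComplexField.Normc.normc R).

(* c t k and N t k stand for the k-th Fourier coefficients of u(t) and of
   |u(t)|^2 u(t); ns and n0 for the H^s and H^s0 norms of u(t). *)
Record fourier_flow (alpha s s0 sigma P Z Cp W : R) (I : set R)
    (c N : R -> int -> R[i]) (ns n0 : R -> R) : Prop := FourierFlow {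
  flow_alpha : 2^-1 < alpha <= 1;
  flow_s0 : 2^-1 < s0;
  flow_s0s : s0 <= s;
  flow_sigma : `|sigma| = 1;
  flow_open : open I;
  flow_itv : is_interval I;
  flow_I0 : I 0;
  flow_Z_ge0 : 0 <= Z;
  flow_Z : forall (f : int -> R) A, (forall k, 0 <= f k) -> 0 <= A ->
    hle s0 f A -> l1le f (Z * A);
  flow_Cp_ge0 : 0 <= Cp;
  flow_Cp : forall k a b : int, a != k -> b != k ->
    jpow (s + (2 * alpha - 1)) k / `|phase alpha k a b| <=
    Cp * (jpow s a + jpow s (a + b - k) + jpow s b +
          inv_abs (a - k) * inv_abs (b - k) *
          (jpow s a * jpow s0 (a + b - k) * jpow s0 b));
  flow_W : l1le (fun k => inv_abs k ^+ 2 : R) W;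
  flow_ns_ge0 : forall t, 0 <= ns t;
  flow_n0_ge0 : forall t, 0 <= n0 t;
  flow_ns : forall t, I t -> hle s (nc \o c t) (ns t);
  flow_n0 : forall t, I t -> hle s0 (nc \o c t) (n0 t);
  flow_ns_cont : {in I, forall t, {for t, continuous ns}};
  flow_n0_cont : {in I, forall t, {for t, continuous n0}};
  flow_cont : forall t0, I t0 -> forall e, 0 < e ->
    \forall t \near t0, I t -> hle s (fun k => nc (c t k - c t0 k)) e;
  flow_der : forall t, I t -> forall k, cderive_at (fun x => c x k) t
    (Complex 0 (frac_symbol alpha k) * c t k - Complex 0 sigma * N t k);
  flow_N : forall t, I t -> forall A e K, l1le (nc \o c t) A ->
    0 <= e -> tail_le (nc \o c t) K e ->
    forall k, nc (N t k - ccubic (box K) (c t) k) <= 108 * A ^+ 2 * e;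
  flow_P : forall A e K, l1le (nc \o c 0) A -> 0 <= e ->
    tail_le (nc \o c 0) K e ->
    `|P - 2 * \sum_(k <- box K) nc (c 0 k) ^+ 2| <= 48 * A * e
}.

End Flow.

(** * Uniform truncation in time and near conservation of mass *)

Section Evolution.
Context {R : realType}.
Local Notation re := (@complex.Re R).
Local Notation im := (@complex.Im R).
Local Notation nc := (@ComplexField.Normc.normc R).
Variables (alpha s s0 sigma P Z Cp W : R) (I : set R) (c N : R -> int -> R[i]).
Variables (ns n0 : R -> R).
Hypothesis E : fourier_flow alpha s s0 sigma P Z Cp W I c N ns n0.

Let s0s := flow_s0s E.
Let hsigma := flow_sigma E.
Let I0 := flow_I0 E.
Let Z_ge0 := flow_Z_ge0 E.
Let HZ := flow_Z E.
Let ns_ge0 := flow_ns_ge0 E.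
Let n0_ge0 := flow_n0_ge0 E.
Let c_ns := flow_ns E.
Let c_n0 := flow_n0 E.

Let nc0 (f : int -> R[i]) k : 0 <= (nc \o f) k. Proof. exact: normc_ge0. Qed.

Lemma c_l1 t : I t -> l1le (nc \o c t) (Z * n0 t).
Proof. by move=> It; apply: HZ => //; exact: c_n0. Qed.

Lemma itv_in a b t : I a -> I b -> a <= t <= b -> I t.
Proof. by move=> Ia Ib tab; have := flow_itv E; move=> /(_ a b Ia Ib t tab). Qed.

(** Compactness of [a, b]: near t0 the tail of c(t) is at most that of c(t0) plus the H^s distance,
    and finitely many such neighbourhoods suffice. *)
Lemma uniform_tail a b : I a -> I b -> a <= b -> forall e, 0 < e ->
  exists K0, forall K, (K0 <= K)%N -> forall t, a <= t <= b ->
  hle s (hi K (nc \o c t)) e.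
Proof.
move=> Ia Ib ab e e0.
have e2 : 0 < e / 2 by rewrite divr_gt0.
have := (compact_near_coveringP _).1 (@segment_compact R a b) nat \oo
  (fun K t => hle s (hi K (nc \o c t)) e) _.
case=> [t0 /=|K0 _ HK0].
  rewrite in_itv /= => tab; have It0 := itv_in Ia Ib tab.
  have [K0 HK0] := hle_hi_small (nc0 _) (c_ns It0) e2.
  have [V Vt0 HV] : exists2 V, nbhs t0 V & forall t, V t -> I t /\
      hle s (fun k => nc (c t k - c t0 k)) (e / 2).
    exists [set t | I t /\ (I t -> hle s (fun k => nc (c t k - c t0 k)) (e / 2))].
      by apply: filterI; [apply: open_nbhs_nbhs; split => //; exact: flow_open E|exact: (flow_cont E)].
    by move=> t [It h]; split => //; exact: h.
  exists (V, [set K | (K0 <= K)%N]); first by split => //=; exists K0.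
  move=> [t K] /= [/HV[It ht] /HK0 hK].
  have := hle_add (ltW e2) (ltW e2) ht hK; rewrite -splitr.
  apply: hle_le => k; first exact: hi_ge0.
  rewrite /hi /=; case: ifP => _; first by rewrite addr0 normc_ge0.
  by rewrite -[X in nc X <= _](subrK (c t0 k)); exact: ler_normcD.
by exists K0 => K KK0 t tab; apply: HK0 => //=; rewrite in_itv.
Qed.

Lemma bounded_norms a b : I a -> I b -> a <= b -> exists2 A, 0 <= A &
  forall t, a <= t <= b -> ns t <= A /\ n0 t <= A.
Proof.
move=> Ia Ib ab.
have sub : {subset `[a, b] <= I}.
  by move=> t; rewrite in_itv inE /= => tab; exact: itv_in Ia Ib tab.
have [|x _ hx] := @EVT_max R ns a b ab.
  by apply: continuous_in_subspaceT => x /[!inE] xab; apply: (flow_ns_cont E); exact: sub.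
have [|y _ hy] := @EVT_max R n0 a b ab.
  by apply: continuous_in_subspaceT => z /[!inE] xab; apply: (flow_n0_cont E); exact: sub.
exists (ns x + n0 y) => [|t tab]; first by rewrite addr_ge0.
split; first by rewrite (le_trans (hx t _)) ?in_itv //= lerDl.
by rewrite (le_trans (hy t _)) ?in_itv //= lerDr.
Qed.

Lemma uniform_l1_tail a b : I a -> I b -> a <= b -> forall e, 0 < e ->
  exists K0, forall K, (K0 <= K)%N -> forall t, a <= t <= b ->
  tail_le (nc \o c t) K e.
Proof.
move=> Ia Ib ab e e0; have Z1 : 0 < Z + 1 by rewrite ltr_wpDl.
have [|K0 HK0] := uniform_tail Ia Ib ab (e := e / (Z + 1)).
  by rewrite divr_gt0.
have eZ : 0 <= e / (Z + 1) by rewrite divr_ge0 // ltW.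
exists K0 => K /HK0 HK t /HK h; apply: tail_le_hi => S uS.
have h0 : hle s0 (hi K (nc \o c t)) (e / (Z + 1)).
  by apply: hle_mono s0s _ h => k; exact: hi_ge0.
apply: le_trans (HZ _ eZ h0 uS) _; first by move=> k; exact: hi_ge0.
exact: ler_div_succ.
Qed.

Lemma uniform_N_approx a b : I a -> I b -> a <= b -> forall e, 0 < e ->
  exists K0, forall K, (K0 <= K)%N -> forall t, a <= t <= b -> forall k,
  nc (N t k - ccubic (box K) (c t) k) <= e.
Proof.
move=> Ia Ib ab e e0; have [A A0 HA] := bounded_norms Ia Ib ab.
have X0 : 0 < 108 * (Z * A) ^+ 2 + 1 by rewrite ltr_wpDl ?mulr_ge0 ?sqr_ge0.
have [|K0 HK0] := uniform_l1_tail Ia Ib ab (e := e / (108 * (Z * A) ^+ 2 + 1)).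
  by rewrite divr_gt0.
exists K0 => K /HK0 HK t tab k; have It := itv_in Ia Ib tab.
have cA : l1le (nc \o c t) (Z * A).
  move=> S uS; apply: le_trans (c_l1 It uS) _; apply: ler_wpM2l => //.
  by case: (HA t tab).
apply: le_trans (flow_N E It cA _ (HK t tab) k) _.
  by rewrite divr_ge0 // ltW.
by apply: ler_div_succ => //; rewrite mulr_ge0 ?sqr_ge0.
Qed.

Definition mass K t : R := \sum_(k <- box K) nc (c t k) ^+ 2.

(** In the derivative of the truncated mass the dispersive term is purely imaginary and drops out,
    and by [im_quartic] the truncated convolution contributes nothing. What remains pairs the error
    N - [ccubic], small uniformly in k, with c, bounded in l1. *)
Lemma mass_variation a b : I a -> I b -> a <= b -> forall e, 0 < e ->
  exists K0, forall K, (K0 <= K)%N -> forall t1 t2, a <= t1 -> t1 <= t2 -> t2 <= b ->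
  `|mass K t2 - mass K t1| <= e.
Proof.
move=> Ia Ib ab e e0; have [A A0 HA] := bounded_norms Ia Ib ab.
have X0 : 0 < 2 * (Z * A) * (b - a) + 1.
  by rewrite ltr_wpDl // !mulr_ge0 ?subr_ge0.
have [|K0 HK0] := uniform_N_approx Ia Ib ab (e := e / (2 * (Z * A) * (b - a) + 1)).
  by rewrite divr_gt0.
set d := e / _ in HK0; have d0 : 0 <= d by rewrite divr_ge0 // ltW.
exists K0 => K /HK0 HK t1 t2 at1 t12 t2b.
pose dm t := \sum_(k <- box K) 1 * (2 * re (conjc (c t k) *
  (Complex 0 (frac_symbol alpha k) * c t k - Complex 0 sigma * N t k))).
have mE : mass K = fun t => \sum_(k <- box K) 1 * nc (c t k) ^+ 2.
  by apply/funext => t; apply: eq_bigr => k _; rewrite mul1r.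
have sub t : t1 <= t <= t2 -> a <= t <= b.
  by move=> /andP[t1t tt2]; rewrite (le_trans at1) //= (le_trans tt2).
apply: (@le_trans _ _ (2 * (Z * A) * d * (t2 - t1))); last first.
  apply: (@le_trans _ _ (2 * (Z * A) * d * (b - a))).
    apply: ler_wpM2l; first by rewrite mulr_ge0 // !mulr_ge0.
    by apply: lerB.
  by rewrite mulrAC; apply: ler_div_succ => //; rewrite !mulr_ge0 ?subr_ge0.
have fd t : t1 <= t <= t2 ->
    is_derive t 1 (fun t => \sum_(k <- box K) 1 * nc (c t k) ^+ 2) (dm t).
  move=> /sub tab.
  have := is_derive_sum_normc_sqr (box K) (fun=> 1) (flow_der E (itv_in Ia Ib tab)).
  exact.
rewrite mE; apply: (abs_mvt t12 fd) => t /sub tab.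
have It := itv_in Ia Ib tab.
have -> : dm t = 2 * sigma * \sum_(k <- box K)
    im (conjc (c t k) * (N t k - ccubic (box K) (c t) k)).
  have q0 := im_quartic (box K) (c t); rewrite /quartic im_sum in q0.
  under [in RHS]eq_bigr do rewrite mulrBr imD imN.
  rewrite sumrB q0 subr0 mulr_sumr; apply: eq_bigr => k _.
  by rewrite !(reimE, re_i, im_i); ring.
rewrite !normrM hsigma mulr1 ger0_norm // -!mulrA; apply: ler_wpM2l => //.
apply: le_trans (ler_norm_sum _ _ _) _.
apply: (@le_trans _ _ (\sum_(k <- box K) nc (c t k) * d)).
  apply: ler_sum => k _; apply: le_trans (ler_im_normc _) _.
  by rewrite normcM normc_conj ler_wpM2l ?normc_ge0 // HK.
rewrite -mulr_suml mulrA; apply: ler_wpM2r => //.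
apply: le_trans (c_l1 It (box_uniq K)) _; apply: ler_wpM2l => //.
by case: (HA t tab).
Qed.

Lemma P_approx a b : I a -> I b -> a <= b -> forall e, 0 < e ->
  exists K0, forall K, (K0 <= K)%N -> forall t, a <= t <= b ->
  `|P - 2 * mass K t| <= e.
Proof.
move=> Ia Ib ab e e0.
(* P is given by the data at time 0, so the interval is enlarged to contain 0. *)
pose a' := Num.min a 0; pose b' := Num.max b 0.
have Ia' : I a' by rewrite /a'; case: leP.
have Ib' : I b' by rewrite /b'; case: leP.
have a'0 : a' <= 0 by rewrite ge_min lexx orbT.
have b'0 : 0 <= b' by rewrite le_max lexx orbT.
have a'a : a' <= a by rewrite ge_min lexx.
have bb' : b <= b' by rewrite le_max lexx.
have e4 : 0 < e / 4 by rewrite divr_gt0.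
have [K1 HK1] := mass_variation Ia' Ib' (le_trans a'0 b'0) e4.
have X0 : 0 < 96 * (Z * n0 0) + 1 by rewrite ltr_wpDl ?mulr_ge0.
have [|K2 HK2] := uniform_l1_tail I0 I0 (lexx 0) (e := e / (96 * (Z * n0 0) + 1)).
  by rewrite divr_gt0.
exists (maxn K1 K2) => K; rewrite geq_max => /andP[/HK1 h1 /HK2 h2] t /andP[at_ tb].
have m0 : `|mass K t - mass K 0| <= e / 4.
  have [t0|t0] := leP 0 t; first by apply: h1 => //; exact: le_trans tb bb'.
  rewrite distrC; apply: h1 => //; last exact: ltW.
  exact: le_trans a'a at_.
have := flow_P E (c_l1 I0) _ (h2 0 _); rewrite lexx => /(_ _ isT) p0.
have {p0} : `|P - 2 * mass K 0| <= e / 2.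
  apply: le_trans (p0 _) _; first by rewrite divr_ge0 // ltW.
  rewrite ler_pdivlMr // [_ * 2]mulrC !mulrA -natrM -[_ * Z * _]mulrA -mulrA.
  by apply: ler_div_succ => //; rewrite !mulr_ge0.
move: m0; rewrite !ler_norml => /andP[m1 m2] /andP[p1 p2].
by apply/andP; split; lra.
Qed.

End Evolution.

(** * The normal form *)

Section Preliminaries.
Context {R : realType}.
Local Notation nc := (@ComplexField.Normc.normc R).

(** Allows a majorant g + h depending on the finite set S: g satisfies a global bound, while h,
    typically an increment at a truncation chosen after S, is controlled on S only and up to e. *)
Lemma hle_of_parts r (f : int -> R) A B : 0 <= A -> 0 <= B ->
  (forall k, 0 <= f k) ->
  (forall S, uniq S -> forall e, 0 < e -> exists g h : int -> R,
    [/\ forall k, f k <= g k + h k, hle r g A &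
        \sum_(k <- S) (jpow r k * h k) ^+ 2 <= (B + e) ^+ 2]) ->
  hle r f (A + B).
Proof.
move=> A0 B0 f0 H; apply: hle_of_sum => [|S uS e e0]; first exact: addr_ge0.
have [g [h [fgh gA hB]]] := H S uS e e0; rewrite -addrA.
have := minkowski_le A0 (addr_ge0 B0 (ltW e0)) (gA S uS) hB.
apply: le_trans; apply: ler_sum => k _; rewrite -mulrDr.
have j0 := jpow_ge0 r k; rewrite ler_pXn2r ?nnegrE ?mulr_ge0 ?ler_wpM2l //.
exact: le_trans (fgh k).
Qed.

Lemma small_factor (X e : R) : 0 <= X -> 0 < e -> exists2 d, 0 < d & X * d <= e.
Proof.
move=> X0 e0; exists (e / (X + 1)); last exact: ler_div_succ.
by rewrite divr_gt0 // ltr_wpDl.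
Qed.

Lemma hle_widen r (f : int -> R) A A' : 0 <= A -> A <= A' -> hle r f A -> hle r f A'.
Proof. exact: l2le_widen. Qed.

Lemma normc_cis_sub1_near (m e : R) : 0 < e ->
  \forall d \near 0, nc (cis (m * d) - 1) <= e.
Proof.
move=> e0; have e2 : 0 < e / 2 by rewrite divr_gt0.
have mc : (fun d : R => m * d) x @[x --> (0 : R)] --> (0 : R).
  by rewrite -[X in _ --> X](mulr0 m); apply: cvgMr; exact: cvg_id.
have Hc : cos (m * d) @[d --> (0 : R)] --> (1 : R).
  by rewrite -cos0; apply: continuous_cvg mc; exact: continuous_cos.
have Hs : sin (m * d) @[d --> (0 : R)] --> (0 : R).
  by rewrite -[X in _ --> X]sin0; apply: continuous_cvg mc; exact: continuous_sin.
move/cvgr_dist_le: Hc => /(_ _ e2); move/cvgr_dist_le: Hs => /(_ _ e2).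
apply: filterS2 => d; rewrite sub0r normrN => hs hc.
apply: le_trans (ler_normc_reim _) _; rewrite [leRHS]splitr.
by rewrite !reimE /= subr0 distrC; apply: lerD.
Qed.

Lemma normc_cis_sub1_near_seq (m : int -> R) (e : R) (S : seq int) : 0 < e ->
  \forall d \near 0, forall k, k \in S -> nc (cis (m k * d) - 1) <= e.
Proof.
move=> e0; elim: S => [|k S IH]; first by near=> d => k.
near=> d => j; rewrite inE => /predU1P[->|jS].
  by near: d; exact: normc_cis_sub1_near.
by move: j jS; near: d; exact: IH.
Unshelve. all: by end_near.
Qed.

(** Strong continuity of a unitary group with unbounded frequencies: the finitely many low
    frequencies turn little, and on the high ones the factor 2 is paid by the small tail of [z]. The
    neighbourhood depends on [z]. *)
Lemma hle_rotation_near r (m : int -> R) (z : int -> R[i]) A e : 0 <= A ->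
  hle r (nc \o z) A -> 0 < e ->
  \forall d \near 0, hle r (fun k => nc ((cis (m k * d) - 1) * z k)) e.
Proof.
move=> A0 zA e0; have e4 : 0 < e / 4 by rewrite divr_gt0.
have z0 k : 0 <= (nc \o z) k by exact: normc_ge0.
have [K HK] := hle_hi_small z0 zA e4.
have [q q0 Aq] := small_factor A0 (divr_gt0 e0 (ltr0n R 2)).
have := normc_cis_sub1_near_seq m (box K) q0; apply: filterS => d hd.
have H := hle_add (mulr_ge0 (ltW q0) A0) (mulr_ge0 (ler0n R 2) (ltW e4))
  (hle_scale q zA) (hle_scale 2 (HK K (leqnn _))).
apply: (@hle_widen _ _ (q * A + 2 * (e / 4))).
- by rewrite addr_ge0 // mulr_ge0 // ltW.
- rewrite mulrC (_ : 2 * _ = e / 2); last by field.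
  by rewrite [leRHS]splitr lerD2r.
apply: hle_le H => k; first exact: normc_ge0.
rewrite normcM /hi; case: ifPn => kK.
  by rewrite mulr0 addr0 ler_wpM2r ?normc_ge0 // hd.
rewrite ler_wpDl ?mulr_ge0 ?normc_ge0 ?(ltW q0) // ler_wpM2r ?normc_ge0 //.
by apply: le_trans (ler_normcB _ _) _; rewrite normc_cis (normcC 1) normr1.
Qed.

End Preliminaries.

Section NormalForm.
Context {R : realType}.
Local Notation lebesgue := (@lebesgue_measure R).
Local Notation nc := (@ComplexField.Normc.normc R).
Variables (alpha s s0 sigma P Z Cp W : R) (I : set R) (c N : R -> int -> R[i]).
Variables (ns n0 : R -> R).
Hypothesis E : fourier_flow alpha s s0 sigma P Z Cp W I c N ns n0.

Let Z_ge0 := flow_Z_ge0 E.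
Let HZ := flow_Z E.
Let ns_ge0 := flow_ns_ge0 E.
Let n0_ge0 := flow_n0_ge0 E.
Let c_ns := flow_ns E.
Let c_n0 := flow_n0 E.
Let beta := 2 * alpha - 1.

Let nc0 (f : int -> R[i]) k : 0 <= (nc \o f) k. Proof. exact: normc_ge0. Qed.

Let s_ge0 : 0 <= s.
Proof. by have := flow_s0 E; have := flow_s0s E; lra. Qed.

Let W_ge0 : 0 <= W. Proof. exact: l1le_ge0 (flow_W E). Qed.

Definition phase_cst : R := Cp * (Z ^+ 2 + W).

Lemma phase_cst_ge0 : 0 <= phase_cst.
Proof. by rewrite mulr_ge0 ?(flow_Cp_ge0 E) ?addr_ge0 ?sqr_ge0. Qed.

Lemma leibniz3_phase_hle B (D A : int -> R) (d1 d0 a1 a0 : R) : uniq B ->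
  (forall k, 0 <= D k) -> (forall k, 0 <= A k) ->
  0 <= d1 -> 0 <= d0 -> 0 <= a1 -> 0 <= a0 ->
  hle s D d1 -> hle s0 D d0 -> hle s A a1 -> hle s0 A a0 ->
  hle (s + beta) (leibniz3 (nonres_sum alpha B) D A)
    (3 * (phase_cst * (d1 * a0 ^+ 2 + 2 * (d0 * (a1 * a0))))).
Proof.
move=> uB D0 A0 d10 d00 a10 a00 Dd1 Dd0 Aa1 Aa0.
set q := d1 * _ + _; have q0 : 0 <= q.
  by rewrite addr_ge0 ?mulr_ge0 ?sqr_ge0.
have pq0 : 0 <= phase_cst * q by rewrite mulr_ge0 ?phase_cst_ge0.
have -> : 3 * (phase_cst * q) = phase_cst * q + phase_cst * q + phase_cst * q by ring.
have qE : phase_cst * q = Cp * ((Z ^+ 2 + W) * q) by rewrite /phase_cst mulrA.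
apply: hle_add => //; first by rewrite addr_ge0.
apply: hle_add => //.
- rewrite qE (_ : q = d1 * a0 * a0 + d0 * a1 * a0 + d0 * a0 * a1); last by rewrite /q; ring.
  by apply: (nonres_sum_hle (h := A) _ _ _ _ _ _ _ _ _ _ _ _ _ _ _ Z_ge0 HZ
    (flow_Cp_ge0 E) (flow_Cp E) (flow_W E)).
- rewrite qE (_ : q = a1 * d0 * a0 + a0 * d1 * a0 + a0 * d0 * a1); last by rewrite /q; ring.
  by apply: (nonres_sum_hle (h := A) _ _ _ _ _ _ _ _ _ _ _ _ _ _ _ Z_ge0 HZ
    (flow_Cp_ge0 E) (flow_Cp E) (flow_W E)).
- rewrite qE (_ : q = a1 * a0 * d0 + a0 * a1 * d0 + a0 * a0 * d1); last by rewrite /q; ring.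
  by apply: (nonres_sum_hle (h := D) _ _ _ _ _ _ _ _ _ _ _ _ _ _ _ Z_ge0 HZ
    (flow_Cp_ge0 E) (flow_Cp E) (flow_W E)).
Qed.

(** With freq_k = |k|^(2 alpha) - sigma P the equation becomes c_k' = i freq_k c_k - i sigma
    forcing_k. *)
Definition forcing t k : R[i] := N t k - P%:C%C * c t k.

(** N is close to the truncated convolution, which [tri_one_decomp] splits, and P is close to twice
    the truncated mass; the two terms linear in c_k then cancel up to e. *)
Lemma resonant_approx a b : I a -> I b -> a <= b -> forall e, 0 < e ->
  exists K0, forall K, (K0 <= K)%N -> forall t, a <= t <= b ->
  forall k, k \in box K ->
  nc (forcing t k - tri ker_nonres (box K) (c t) (c t) (c t) k
      + (nc (c t k) ^+ 2)%:C%C * c t k) <= e.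
Proof.
move=> Ia Ib ab e e0; have [A A0 HA] := bounded_norms E Ia Ib ab.
have X0 : 0 < Z * A + 1 by rewrite ltr_wpDl ?mulr_ge0.
have d0 : 0 < e / (Z * A + 1) by rewrite divr_gt0.
have [K1 HK1] := uniform_N_approx E Ia Ib ab d0.
have [K2 HK2] := P_approx E Ia Ib ab d0.
exists (maxn K1 K2) => K; rewrite geq_max => /andP[/HK1 h1 /HK2 h2] t tab k kK.
have It := itv_in E Ia Ib tab.
have {1}-> : e = e / (Z * A + 1) + e / (Z * A + 1) * (Z * A).
  by rewrite -[X in X + _]mulr1 -mulrDr [1 + _]addrC divfK // gt_eqF.
move: (h1 t tab k); rewrite ccubic_tri tri_one_decomp ?box_uniq // => h3.
rewrite (_ : forcing t k - _ + _ = N t k - (tri ker_nonres (box K) (c t) (c t) (c t) k +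
  (2 * \sum_(j <- box K) nc (c t j) ^+ 2 - nc (c t k) ^+ 2)%:C%C * c t k) +
  (2 * mass c K t - P)%:C%C * c t k); last first.
  by rewrite /forcing /mass !rmorphB /=; ring.
apply: le_trans (ler_normcD _ _) _; apply: lerD => //.
rewrite normcM normcC distrC; apply: ler_pM => //; [exact: normc_ge0|exact: h2|].
have := c_l1 E It (S := [:: k]) isT; rewrite big_seq1 /= => /le_trans; apply.
by apply: ler_wpM2l => //; case: (HA t tab).
Qed.

(** By [resonant_approx] the forcing is close to the nonresonant sum minus |c_k|^2 c_k. Each of the
    two is dominated by [cubic_sum], whence the factor 2 and a bound that does not involve P. *)
Lemma forcing_hle r nr t : 0 <= r -> I t -> 0 <= nr -> hle r (nc \o c t) nr ->
  hle r (nc \o forcing t) (2 * (3 `^ r * (Z ^+ 2 * (3 * (nr * n0 t ^+ 2))))).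
Proof.
move=> r0 It nr0 cr; apply: hle_approx => [|k|S e e0].
- by rewrite !mulr_ge0 ?powR_ge0 ?sqr_ge0.
- exact: normc_ge0.
have [K0 HK0] := resonant_approx It It (lexx t) e0.
have [K1 SK1] := sub_box S; pose K := maxn K0 K1.
exists (fun k => 2 * cubic_sum (box K) (nc \o c t) (nc \o c t) (nc \o c t) k).
  apply: hle_scale.
  rewrite (_ : 3 * _ = nr * n0 t * n0 t + n0 t * nr * n0 t + n0 t * n0 t * nr);
    last by ring.
  by apply: (cubic_sum_hle (f := nc \o c t) (g := nc \o c t) (h := nc \o c t)
    _ _ _ _ _ _ _ _ _ _ _ _ _ _ _ Z_ge0 HZ) => //;
  solve [exact: c_n0|exact: box_uniq].
move=> k /SK1 kK1; have kK : k \in box K.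
  by move: kK1; rewrite !mem_box => /leq_trans; apply; exact: leq_maxr.
have := HK0 K (leq_maxl _ _) t _ k kK; rewrite lexx => /(_ isT) h.
rewrite /=; have -> : forcing t k = forcing t k - tri ker_nonres (box K) (c t) (c t) (c t) k
    + (nc (c t k) ^+ 2)%:C%C * c t k + (tri ker_nonres (box K) (c t) (c t) (c t) k
    - (nc (c t k) ^+ 2)%:C%C * c t k) by ring.
apply: le_trans (ler_normcD _ _) _; rewrite addrC; apply: lerD => //.
rewrite mulr_natl mulr2n; apply: le_trans (ler_normcB _ _) _; apply: lerD.
  exact: normc_tri_nonres_le (box_uniq K).
(* |c_k|^3 is the term a = b = k of the majorant. *)
rewrite normcM normcC ger0_norm ?sqr_ge0 // /cubic_sum (bigD1_seq k) ?box_uniq //=.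
rewrite (bigD1_seq k) ?box_uniq //= addrK -expr2 -addrA lerDl addr_ge0 //.
  by apply: sumr_ge0 => b _; rewrite !mulr_ge0 ?normc_ge0.
by do 2!(apply: sumr_ge0 => ? _); rewrite !mulr_ge0 ?normc_ge0.
Qed.

(** Two of the three factors are estimated pointwise by |c_k| <= n0 <k>^(-s0), and 2 s0 > 1 >=
    beta. *)
Lemma cube_hle t : I t ->
  hle (s + beta) (fun k => nc (c t k) ^+ 3) (ns t * n0 t ^+ 2).
Proof.
move=> It; have := l2le_scale (n0 t ^+ 2) (c_ns It); rewrite mulrC.
apply: l2le_le => k; first by rewrite mulr_ge0 ?jpow_ge0 ?exprn_ge0 ?normc_ge0.
have h : jpow s0 k * nc (c t k) <= n0 t.
  by apply: (hle_delta (c_n0 It)) => //; exact: normc_ge0.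
have h2 : (jpow s0 k * nc (c t k)) ^+ 2 <= n0 t ^+ 2.
  by rewrite ler_pXn2r ?nnegrE ?mulr_ge0 ?jpow_ge0 ?normc_ge0.
have sc0 : 0 <= jpow s k * nc (c t k) by rewrite mulr_ge0 ?jpow_ge0 ?normc_ge0.
apply: le_trans (ler_wpM2r sc0 h2).
have jj : jpow (s + beta) k <= jpow s0 k ^+ 2 * jpow s k.
  rewrite jpow_sqr -jpowD addrC; apply: ler_jpow.
  by rewrite lerD2r /beta; have := flow_s0 E; have /andP[_] := flow_alpha E; lra.
rewrite exprMn [_ * nc _ ^+ 2 * _]mulrACA -exprSr.
by apply: ler_wpM2r => //; rewrite exprn_ge0 ?normc_ge0.
Qed.

Definition normal_form K t k : R[i] :=
  tri (ker_phase alpha) (box K) (c t) (c t) (c t) k.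

Lemma normal_form_hle K t : I t ->
  hle (s + beta) (nc \o normal_form K t) (3 * phase_cst * (ns t * n0 t ^+ 2)).
Proof.
move=> It; have cc0 := nc0 (c t).
have -> : 3 * phase_cst * (ns t * n0 t ^+ 2) = Cp * ((Z ^+ 2 + W) *
    (ns t * n0 t * n0 t + n0 t * ns t * n0 t + n0 t * n0 t * ns t)).
  by rewrite /phase_cst; ring.
apply: (@hle_le _ _ _ (nonres_sum alpha (box K) (nc \o c t) (nc \o c t) (nc \o c t))).
- by move=> k; exact: normc_ge0.
- by move=> k; exact: normc_tri_phase_le (box_uniq K).
by apply: (nonres_sum_hle (h := nc \o c t) _ _ _ _ _ _ _ _ _ _ _ _ _ _ _ Z_ge0 HZ
    (flow_Cp_ge0 E) (flow_Cp E) (flow_W E)) => //;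
  solve [exact: c_ns|exact: c_n0|exact: box_uniq].
Qed.

Definition freq k : R := frac_symbol alpha k - sigma * P.

(** The coefficient plus the boundary term, with the rotation undone. The sign is such that
    differentiating the boundary term produces i sigma times the nonresonant sum, which cancels that
    sum in -i sigma times the forcing. *)
Definition profile K t k : R[i] :=
  cis (- (freq k * t)) * (c t k + Complex 0 sigma * normal_form K t k).

Definition profile_deriv K t k : R[i] :=
  let G j := - Complex 0 sigma * forcing t j in
  cis (- (freq k * t)) * (Complex 0 sigma *
    (tri ker_nonres (box K) (c t) (c t) (c t) k - forcing t k +
     (tri (ker_phase alpha) (box K) G (c t) (c t) k +
      tri (ker_phase alpha) (box K) (c t) G (c t) k +
      tri (ker_phase alpha) (box K) (c t) (c t) G k))).

Lemma profile_derivP K t k : I t ->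
  cderive_at (fun x => profile K x k) t (profile_deriv K t k).
Proof.
move=> It.
pose ic j := Complex 0 (freq j) * c t j.
pose G j := - Complex 0 sigma * forcing t j.
have cd j : cderive_at (fun x => c x j) t (ic j + G j).
  have := flow_der E It j; set d := (X in cderive_at _ _ X -> _).
  suff -> : d = ic j + G j by [].
  rewrite /d /ic /G /forcing /freq; apply: complex_eq.
    by rewrite !(reimE, re_i, im_i); ring.
  by rewrite !(reimE, re_i, im_i); ring.
have ed : cderive_at (fun x => cis (- (freq k * x))) t
    (- Complex 0 (freq k) * cis (- (freq k * t))).
  have := cderive_cis (- freq k) t; rewrite mulNr.
  rewrite (_ : Complex 0 (- freq k) = - Complex 0 (freq k)); last first.
    by apply: complex_eq; rewrite !reimE /= ?oppr0.
  by rewrite (_ : (fun x => cis (- freq k * x)) = fun x => cis (- (freq k * x)))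
    //; apply/funext => x; rewrite mulNr.
have nd := cderive_tri (ker_phase alpha) (box K) k cd.
have := cderiveM ed (cderiveD (cd k) (cderiveZ (Complex 0 sigma) nd)).
set d := (X in cderive_at _ _ X -> _); suff -> : d = profile_deriv K t k by [].
have fr := tri_phase_frequency (sigma * P) (c t) (k := k) (box_uniq K)
  (fun a b ak bk => phase_neq0 (flow_alpha E) ak bk).
rewrite /d /profile_deriv -/(normal_form K t k) !triDl !triDm !triDr.
rewrite -/G -/ic in fr *.
move: fr; rewrite -/(normal_form K t k) -/(freq k).
set t1 := tri _ _ ic _ _ _; set t2 := tri _ _ _ ic _ _; set t3 := tri _ _ _ _ ic _.
move=> fr; have {fr} -> : t1 = Complex 0 (freq k) * normal_form K t k +
  tri ker_nonres (box K) (c t) (c t) (c t) k - t2 - t3 by rewrite -fr; ring.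
have -> : ic k = Complex 0 (freq k) * c t k by [].
have -> : G k = - Complex 0 sigma * forcing t k by [].
by ring.
Qed.

Lemma profile_deriv_le a b : I a -> I b -> a <= b -> forall e, 0 < e ->
  exists K0, forall K, (K0 <= K)%N -> forall t, a <= t <= b ->
  forall k, k \in box K -> nc (profile_deriv K t k) <=
    nc (c t k) ^+ 3 +
    leibniz3 (nonres_sum alpha (box K)) (nc \o forcing t) (nc \o c t) k + e.
Proof.
move=> Ia Ib ab e e0; have [K0 HK0] := resonant_approx Ia Ib ab e0.
exists K0 => K KK0 t tab k kK; have := HK0 K KK0 t tab k kK.
rewrite /profile_deriv; set Gm := fun j => _; set NR := tri ker_nonres _ _ _ _ _.
set G := forcing t k; move=> h.
rewrite normcM normc_cis mul1r normcM normc_im (flow_sigma E) mul1r.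
have -> : NR - G = (nc (c t k) ^+ 2)%:C%C * c t k -
  (G - NR + (nc (c t k) ^+ 2)%:C%C * c t k) by ring.
have nG : nc \o Gm = nc \o forcing t.
  by apply/funext => j; rewrite /= normcM normcN normc_im (flow_sigma E) mul1r.
apply: le_trans (ler_normcD _ _) _; rewrite [leRHS]addrAC; apply: lerD.
  apply: le_trans (ler_normcB _ _) _; apply: lerD => //.
  by rewrite normcM normcC ger0_norm ?sqr_ge0 // -exprSr.
rewrite /leibniz3 -nG; apply: le_trans (ler_normcD _ _) _; apply: lerD.
  apply: le_trans (ler_normcD _ _) _; apply: lerD.
all: exact: normc_tri_phase_le (box_uniq K).
Qed.

Definition density t : R := ns t * (n0 t ^+ 2 + n0 t ^+ 4).

Lemma density_ge0 t : 0 <= density t.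
Proof. by rewrite mulr_ge0 // addr_ge0 // exprn_ge0. Qed.

Lemma density_continuous : {in I, forall t, {for t, continuous density}}.
Proof.
move=> t tI; have hs := flow_ns_cont E tI; have h0 := flow_n0_cont E tI.
have hX m : (n0 x ^+ m) @[x --> t] --> n0 t ^+ m.
  exact: cvg_comp h0 (@exprn_continuous R m (n0 t)).
by apply: cvgM => //; apply: cvgD; exact: hX.
Qed.

(** The 1 is for the resonant cube. In the quintic part the forcing norms 6 Z^2 3^s ns n0^2 and 6
    Z^2 3^s0 n0^3 enter [leibniz3_phase_hle], the second one twice. *)
Definition profile_cst : R :=
  1 + 3 * (phase_cst * (Z ^+ 2 * (6 * 3 `^ s + 12 * 3 `^ s0))).

Lemma profile_cst_ge1 : 1 <= profile_cst.
Proof.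
rewrite /profile_cst lerDl mulr_ge0 // mulr_ge0 ?phase_cst_ge0 //.
by rewrite mulr_ge0 ?sqr_ge0 // addr_ge0 // mulr_ge0 // powR_ge0.
Qed.

Lemma profile_cst_ge0 : 0 <= profile_cst.
Proof. exact: le_trans ler01 profile_cst_ge1. Qed.

Lemma profile_deriv_hle K t : I t -> hle (s + beta) (fun k => nc (c t k) ^+ 3 +
    leibniz3 (nonres_sum alpha (box K)) (nc \o forcing t) (nc \o c t) k)
  (profile_cst * density t).
Proof.
move=> It; have s00 : 0 <= s0 by rewrite ltW // (le_lt_trans _ (flow_s0 E)).
set g1 := 2 * (3 `^ s * (Z ^+ 2 * (3 * (ns t * n0 t ^+ 2)))).
set g0 := 2 * (3 `^ s0 * (Z ^+ 2 * (3 * (n0 t * n0 t ^+ 2)))).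
have g10 : 0 <= g1 by rewrite !mulr_ge0 ?powR_ge0 ?sqr_ge0.
have g00 : 0 <= g0 by rewrite !mulr_ge0 ?powR_ge0 ?sqr_ge0.
have L := leibniz3_phase_hle (box_uniq K) (nc0 (forcing t)) (nc0 (c t)) g10 g00
  (ns_ge0 t) (n0_ge0 t) (forcing_hle s_ge0 It (ns_ge0 t) (c_ns It))
  (forcing_hle s00 It (n0_ge0 t) (c_n0 It)) (c_ns It) (c_n0 It).
have A0 : 0 <= ns t * n0 t ^+ 2 by rewrite mulr_ge0 ?sqr_ge0.
set X := 3 * _ in L; have X0 : 0 <= X.
  by rewrite mulr_ge0 // mulr_ge0 ?phase_cst_ge0 // addr_ge0 ?mulr_ge0 ?sqr_ge0.
apply: hle_widen (hle_add A0 X0 (cube_hle It) L); first exact: addr_ge0.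
have XE : X = (profile_cst - 1) * (ns t * n0 t ^+ 4).
  rewrite /X /g1 /g0 /profile_cst.
  by move: (3 `^ s) (3 `^ s0) phase_cst (n0 t) (ns t) => *; ring.
have B0 : 0 <= ns t * n0 t ^+ 4 by rewrite mulr_ge0 ?exprn_ge0.
have C0 : 0 <= profile_cst - 1.
  by rewrite subr_ge0 profile_cst_ge1.
rewrite XE /density mulrDr mulrDr; apply: lerD.
  by rewrite ler_peMl // -subr_ge0.
by rewrite ler_wpM2r // gerBl.
Qed.

(** K depends on S and e but not on t1 and t2. The density is replaced by any majorant [h] with
    primitive [H]: its own primitive serves for the estimate, a linear function for continuity in
    time. *)
Lemma profile_variation a b : I a -> I b -> a <= b -> forall S, uniq S ->
  forall e, 0 < e -> exists K0, forall K, (K0 <= K)%N ->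
  forall t1 t2, a <= t1 -> t1 <= t2 -> t2 <= b -> forall H h : R -> R,
  (forall t, t1 <= t <= t2 -> is_derive t 1 H (h t)) ->
  (forall t, t1 <= t <= t2 -> density t <= h t) ->
  \sum_(k <- S) (jpow (s + beta) k * nc (profile K t2 k - profile K t1 k)) ^+ 2 <=
  (profile_cst * (H t2 - H t1) + e) ^+ 2.
Proof.
move=> Ia Ib ab S uS e e0.
(* X converts an error d per frequency into a weighted l2 error on S; integration over time
   contributes b - a, so d is chosen with X (b - a) d <= e. *)
set X := Num.sqrt (\sum_(k <- S) (jpow (s + beta) k) ^+ 2).
have X0 : 0 <= X by exact: sqrtr_ge0.
have XE : X ^+ 2 = \sum_(k <- S) (jpow (s + beta) k) ^+ 2.
  by rewrite sqr_sqrtr ?sum_sqr_ge0.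
have [d d0 de] : exists2 d, 0 < d & (X * (b - a)) * d <= e.
  by apply: small_factor => //; rewrite mulr_ge0 ?subr_ge0.
have [K0 HK0] := profile_deriv_le Ia Ib ab d0; have [K1 SK1] := sub_box S.
exists (maxn K0 K1) => K; rewrite geq_max => /andP[KK0 KK1].
move=> t1 t2 at1 t12 t2b H h Hh hd.
have sub t : t1 <= t <= t2 -> a <= t <= b.
  by move=> /andP[t1t tt2]; rewrite (le_trans at1) //= (le_trans tt2).
have pc0 := profile_cst_ge0.
have lin (x : R) : is_derive x 1 (fun y : R => d * X * y) (d * X).
  have : is_derive x 1 ((d * X) \*: @id R) ((d * X) *: 1) by apply: is_deriveZ.
  by rewrite /GRing.scale /= mulr1.
pose H' t := profile_cst * H t + d * X * t.
pose h' t := profile_cst * h t + d * X.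
have Hd' t : t1 <= t <= t2 -> is_derive t 1 H' (h' t).
  move=> tt; apply: is_deriveD (lin t).
  by apply: is_deriveZ (Hh t tt).
have h'0 t : t1 <= t <= t2 -> 0 <= h' t.
  move=> tt; rewrite addr_ge0 ?mulr_ge0 ?(ltW d0) //.
  exact: le_trans (density_ge0 t) (hd t tt).
have yd t : t1 <= t <= t2 -> forall k, k \in S ->
    cderive_at (fun x => profile K x k) t (profile_deriv K t k).
  by move=> /sub tab k _; exact: profile_derivP (itv_in E Ia Ib tab).
have bound t : t1 <= t <= t2 ->
    \sum_(k <- S) (jpow (s + beta) k * nc (profile_deriv K t k)) ^+ 2 <= h' t ^+ 2.
  move=> tt; have tab := sub t tt; have It := itv_in E Ia Ib tab.
  set g := fun k : int => nc (c t k) ^+ 3 +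
    leibniz3 (nonres_sum alpha (box K)) (nc \o forcing t) (nc \o c t) k.
  apply: (@le_trans _ _ (\sum_(k <- S)
      (jpow (s + beta) k * g k + d * jpow (s + beta) k) ^+ 2)).
    rewrite big_seq [leRHS]big_seq; apply: ler_sum => k kS.
    have kK : k \in box K by move: (SK1 k kS); rewrite !mem_box => /leq_trans; exact.
    have hk := HK0 K KK0 t tab k kK; have j0 := jpow_ge0 (s + beta) k.
    have ml : jpow (s + beta) k * nc (profile_deriv K t k) <=
        jpow (s + beta) k * g k + d * jpow (s + beta) k.
      by rewrite [d * _]mulrC -mulrDr ler_wpM2l.
    have nn : 0 <= jpow (s + beta) k * nc (profile_deriv K t k).
      by rewrite mulr_ge0 ?normc_ge0.
    by rewrite ler_pXn2r ?nnegrE // (le_trans nn).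
  apply: minkowski_le.
  - by rewrite mulr_ge0 // (le_trans (density_ge0 t)) ?hd.
  - by rewrite mulr_ge0 // ltW.
  - apply: le_trans (profile_deriv_hle K It uS) _.
    have dt0 := density_ge0 t; have := hd t tt => dh.
    have h0 := le_trans dt0 dh.
    by rewrite ler_pXn2r ?nnegrE ?(mulr_ge0 pc0) // ler_wpM2l.
  - under eq_bigr do rewrite exprMn.
    by rewrite -mulr_sumr exprMn XE.
apply: le_trans (vector_mvt t12 (fun k => jpow_ge0 (s + beta) k) yd Hd' h'0 bound) _.
have H12 : 0 <= H' t2 - H' t1.
  by rewrite subr_ge0; exact: mvt_nondecreasing t12 Hd' h'0.
have le : H' t2 - H' t1 <= profile_cst * (H t2 - H t1) + e.
  rewrite /H' opprD addrACA -!mulrBr lerD2l; apply: le_trans de.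
  rewrite [leRHS]mulrC mulrA; apply: ler_wpM2l.
    by rewrite mulr_ge0 // ltW.
  exact: lerB.
by rewrite ler_pXn2r ?nnegrE // (le_trans H12).
Qed.

Definition smoothing t k : R[i] := c t k - cis (freq k * t) * c 0 k.

Let smoothingE K t k : smoothing t k =
  cis (freq k * t) * (profile K t k - profile K 0 k)
  + cis (freq k * t) * (Complex 0 sigma * normal_form K 0 k)
  - Complex 0 sigma * normal_form K t k.
Proof.
have h := cisNK (freq k * t); rewrite /smoothing /profile mulr0 oppr0 cis0 mul1r.
move: (cis (freq k * t)) (cis (- (freq k * t))) h (normal_form K t k) => p q h w.
move: (normal_form K 0 k) (c t k) (c 0 k) (Complex 0 sigma) => w0 ct ct0 i.
have -> : p * (q * (ct + i * w) - (ct0 + i * w0)) + p * (i * w0) - i * w =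
  q * p * (ct + i * w) - p * ct0 - i * w by ring.
by rewrite h; ring.
Qed.

Let normc_i : nc (Complex 0 sigma) = 1.
Proof. by rewrite normc_im (flow_sigma E). Qed.

(** For every K the difference is a rotated increment of the profile plus the boundary terms at 0
    and t. The boundary terms are bounded uniformly in K on all frequencies, the increment on S for
    large K, as [hle_of_parts] requires. *)
Lemma smoothing_hle t : I t ->
  hle (s + beta) (nc \o smoothing t)
    (3 * phase_cst * (ns 0 * n0 0 ^+ 2) + 3 * phase_cst * (ns t * n0 t ^+ 2)
     + profile_cst * `|oriented_integral 0 t density|).
Proof.
move=> It; have I0 := flow_I0 E.
have pc0 := profile_cst_ge0; have ph0 := phase_cst_ge0.
have b0 x : 0 <= 3 * phase_cst * (ns x * n0 x ^+ 2).
  by rewrite mulr_ge0 // mulr_ge0 // sqr_ge0.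
apply: hle_of_parts => [|||S uS e e0]; [exact: addr_ge0|exact: mulr_ge0|exact: nc0|].
have [K HK] : exists K, \sum_(k <- S) (jpow (s + beta) k *
    nc (profile K t k - profile K 0 k)) ^+ 2 <=
    (profile_cst * `|oriented_integral 0 t density| + e) ^+ 2.
  have key a b : I a -> I b -> a <= b -> exists K, \sum_(k <- S)
      (jpow (s + beta) k * nc (profile K b k - profile K a k)) ^+ 2 <=
      (profile_cst * (\int[lebesgue]_(x in `[a, b]) density x) + e) ^+ 2.
    move=> Ia Ib ab; have [H Hd <-] := primitive_on_itv (flow_open E) (flow_itv E)
      Ia Ib ab density_continuous.
    have [K HK] := profile_variation Ia Ib ab uS e0.
    by exists K; apply: HK (leqnn K) _ _ (lexx a) ab (lexx b) _ _ Hd _.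
  rewrite /oriented_integral; have [t0|t0] := leP 0 t.
    have [K HK] := key 0 t I0 It t0; exists K.
    by rewrite ger0_norm // Rintegral_ge0 // => x _; exact: density_ge0.
  have [K HK] := key t 0 It I0 (ltW t0); exists K.
  rewrite normrN ger0_norm; last by rewrite Rintegral_ge0 // => x _; exact: density_ge0.
  by apply: le_trans HK; apply: ler_sum => k _; rewrite -[X in nc X]opprB normcN.
exists (fun k => nc (normal_form K 0 k) + nc (normal_form K t k)).
exists (fun k => nc (profile K t k - profile K 0 k)); split => // [k|].
  rewrite [leLHS]/(nc _) (smoothingE K) [leRHS]addrC [leRHS]addrA.
  apply: le_trans (ler_normcB _ _) _.
  apply: lerD; last by rewrite normcM normc_i mul1r.
  apply: le_trans (ler_normcD _ _) _.
  rewrite 2!(normcM (cis _)) (normcM (Complex 0 sigma)) normc_i normc_cis.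
  by rewrite !mul1r.
by apply: hle_add => //; exact: normal_form_hle.
Qed.

(** The boundary terms form a Cauchy sequence in K in H^(s + beta): by trilinearity a change of
    truncation puts a tail of c into one slot. *)
Lemma normal_form_tail t e : I t -> 0 < e -> exists K', forall K, (K' <= K)%N ->
  hle (s + beta) (fun k => nc (normal_form K t k - normal_form K' t k)) e.
Proof.
move=> It e0; pose X := 3 * (phase_cst * (n0 t ^+ 2 + 2 * (ns t * n0 t))).
have X0 : 0 <= X.
  by rewrite mulr_ge0 // mulr_ge0 ?phase_cst_ge0 // addr_ge0 ?sqr_ge0 // mulr_ge0 // mulr_ge0.
have [d d0 Xd] := small_factor X0 e0.
have [K' HK'] := hle_hi_small (nc0 (c t)) (c_ns It) d0.
exists K' => K KK'; have h := HK' K' (leqnn _).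
have h0 : hle s0 (hi K' (nc \o c t)) d.
  by apply: hle_mono (flow_s0s E) _ h => k; exact: hi_ge0.
have D0 k : 0 <= hi K' (nc \o c t) k by exact: hi_ge0.
have L := leibniz3_phase_hle (box_uniq K) D0 (nc0 (c t)) (ltW d0) (ltW d0)
  (ns_ge0 t) (n0_ge0 t) h h0 (c_ns It) (c_n0 It).
move: L; set Y := 3 * _ => L; have YE : Y = X * d by rewrite /Y /X; ring.
apply: hle_widen (_ : 0 <= Y) _ _; [by rewrite YE mulr_ge0 // ltW|by rewrite YE|].
apply: hle_le L => k; first exact: normc_ge0.
rewrite /normal_form (tri_box_lo _ _ _ KK').
have := @tri_phase_diff_le _ alpha (box K) (c t) (lo K' (c t)) (nc \o c t) k (box_uniq K)
  (fun _ => lexx _) (normc_lo_le (c t) K').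
by rewrite (_ : (fun k => nc (c t k - lo K' (c t) k)) = hi K' (nc \o c t)) //;
  apply/funext => j; rewrite normc_sub_lo.
Qed.

(** The rotation is only strongly continuous, so it must act on something independent of t and of
    the final K, namely [z]. The increment splits into four pieces of size e/4: the profile, the
    boundary term between t0 and t, the rotated tail of the boundary term at t0, and the rotation of
    [z]. *)
Lemma smoothing_continuous t0 : I t0 -> forall e, 0 < e ->
  \forall t \near t0, I t ->
  hle (s + beta) (fun k => nc (smoothing t k - smoothing t0 k)) e.
Proof.
move=> It0 e e0; have pc0 := profile_cst_ge0; have ph0 := phase_cst_ge0.
have e4 : 0 < e / 4 by rewrite divr_gt0.
pose M := ns t0 + n0 t0 + 1; have M0 : 0 <= M by rewrite !addr_ge0.
pose D := M * (M ^+ 2 + M ^+ 4).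
have D0 : 0 <= D by rewrite mulr_ge0 // addr_ge0 ?exprn_ge0.
pose X := 3 * (phase_cst * (3 * (2 * M) ^+ 2)).
have X0 : 0 <= X by rewrite mulr_ge0 // mulr_ge0 // mulr_ge0 ?sqr_ge0.
have [d d0 Xd] := small_factor X0 e4.
have [eta eta0 Deta] := small_factor (mulr_ge0 pc0 D0) e4.
(* Half of e/4, since the rotation minus the identity has norm at most 2. *)
have [K' HK'] := normal_form_tail It0 (divr_gt0 e4 (ltr0n R 2)).
pose z k := smoothing t0 k + Complex 0 sigma * normal_form K' t0 k.
have [A A0 zA] : exists2 A, 0 <= A & hle (s + beta) (nc \o z) A.
  set A1 := 3 * phase_cst * (ns 0 * n0 0 ^+ 2) + 3 * phase_cst * (ns t0 * n0 t0 ^+ 2)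
     + profile_cst * `|oriented_integral 0 t0 density|.
  have bx x : 0 <= 3 * phase_cst * (ns x * n0 x ^+ 2).
    by rewrite mulr_ge0 // mulr_ge0 // sqr_ge0.
  have A10 : 0 <= A1 by rewrite addr_ge0 ?mulr_ge0 // addr_ge0.
  exists (A1 + 3 * phase_cst * (ns t0 * n0 t0 ^+ 2)); first by rewrite addr_ge0.
  apply: hle_le (hle_add A10 (bx t0) (smoothing_hle It0) (normal_form_hle K' It0)).
    exact: nc0.
  move=> k; apply: le_trans (ler_normcD _ _) _.
  by rewrite normcM normc_i mul1r.
have nsM : \forall t \near t0, ns t <= M /\ n0 t <= M.
  have l1 := flow_ns_cont E (mem_set It0); have l2 := flow_n0_cont E (mem_set It0).
  have := cvgr_le _ l1 (ns t0 + 1) _; rewrite ltrDl => /(_ _ ltr01).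
  have := cvgr_le _ l2 (n0 t0 + 1) _; rewrite ltrDl => /(_ _ ltr01).
  apply: filterS2 => t h2 h1; split.
    by apply: le_trans h1 _; rewrite /M addrAC lerDl.
  by apply: le_trans h2 _; rewrite /M -addrA lerDr.
have rot : \forall t \near t0,
    hle (s + beta) (fun k => nc ((cis (freq k * (t - t0)) - 1) * z k)) (e / 4).
  have sub0 : (t - t0) @[t --> t0] --> (0 : R).
    by rewrite -[X in _ --> X](subrr t0); apply: cvgB; [exact: cvg_id|exact: cvg_cst].
  exact: sub0 (hle_rotation_near freq A0 zA e4).
have near1 : \forall t \near t0, [/\ I t, ns t <= M /\ n0 t <= M & `|t - t0| <= eta].
  have : \forall t \near t0, `|t - t0| <= eta.
    have : \forall t \near t0, ball t0 eta t by exact: near_ball.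
    apply: filterS => t; rewrite /ball /= distrC.
    exact: ltW.
  have : \forall t \near t0, I t by apply: open_nbhs_nbhs; split => //; exact: flow_open E.
  by apply: filterS3 nsM => t.
have [rho rho0 Hrho] := (nbhs_ballP _ _).1 near1.
have : \forall t \near t0, ball t0 rho t by exact: near_ball.
move: rot; move: (flow_cont E It0 d0); apply: filterS3 => t cd rt tb It.
have [_ [nst n0t] teta] := Hrho t tb; have {}cd := cd It.
have {1}-> : e = (e / 4 + e / 4 + e / 4) + e / 4 by field.
apply: hle_of_parts => [|||S uS e' e'0]; [by rewrite !addr_ge0 // ltW|exact: ltW
  |by move=> k; exact: normc_ge0|].
have [K [KK' HK]] : exists K, (K' <= K)%N /\ \sum_(k <- S) (jpow (s + beta) k *
    nc (profile K t k - profile K t0 k)) ^+ 2 <= (e / 4 + e') ^+ 2.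
  have key a b : ball t0 rho a -> ball t0 rho b -> a <= b -> b - a <= eta ->
      exists K, (K' <= K)%N /\ \sum_(k <- S)
      (jpow (s + beta) k * nc (profile K b k - profile K a k)) ^+ 2 <= (e / 4 + e') ^+ 2.
    move=> ba bb ab abeta; have [Ia _ _] := Hrho a ba; have [Ib _ _] := Hrho b bb.
    have [K HK] := profile_variation Ia Ib ab uS e'0.
    exists (maxn K K'); split; first exact: leq_maxr.
    have lin (x : R) : is_derive x 1 (fun y : R => D * y) D.
      have : is_derive x 1 (D \*: @id R) (D *: 1) by apply: is_deriveZ.
      by rewrite /GRing.scale /= mulr1.
    have hD x : a <= x <= b -> density x <= D.
      move=> /andP[ax xb]; have bx : ball t0 rho x.
        move: ba bb; rewrite /ball /= !ltr_distlC => /andP[h1 h2] /andP[h3 h4].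
        by rewrite (lt_le_trans h1) //= (le_lt_trans xb).
      have [_ [nx1 nx2] _] := Hrho x bx.
      apply: ler_pM => //; first by rewrite addr_ge0 // exprn_ge0.
      by apply: lerD; rewrite ler_pXn2r ?nnegrE.
    apply: le_trans (HK _ (leq_maxl K K') a b (lexx a) ab (lexx b) _ _ (fun x _ => lin x) hD) _.
    have Q : profile_cst * (D * b - D * a) <= e / 4.
      rewrite -mulrBr mulrA; apply: le_trans Deta; apply: ler_wpM2l => //.
      exact: mulr_ge0.
    have Q0 : 0 <= profile_cst * (D * b - D * a).
      by rewrite mulr_ge0 // -mulrBr mulr_ge0 // subr_ge0.
    by rewrite ler_pXn2r ?nnegrE ?addr_ge0 ?(ltW e'0) ?(ltW e4) // lerD2r.
  have b0 : ball t0 rho t0 by exact: ballxx.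
  have [t0t|tt0] := leP t0 t.
    by apply: key => //; apply: le_trans teta; exact: ler_norm.
  have [|K [KK HK]] := key t t0 tb b0 (ltW tt0).
    by apply: le_trans teta; rewrite distrC ler_norm.
  exists K; split => //.
  by apply: le_trans HK; apply: ler_sum => k _; rewrite -[X in nc X]opprB normcN.
pose g1 k := nc (normal_form K t k - normal_form K t0 k).
pose g2 k := 2 * nc (normal_form K t0 k - normal_form K' t0 k).
pose g3 k := nc ((cis (freq k * (t - t0)) - 1) * z k).
exists (fun k => g1 k + g2 k + g3 k).
exists (fun k => nc (profile K t k - profile K t0 k)); split => //.
- move=> k; have -> : smoothing t k - smoothing t0 k =
      cis (freq k * t) * (profile K t k - profile K t0 k)
      - Complex 0 sigma * (normal_form K t k - normal_form K t0 k)
      + (cis (freq k * (t - t0)) - 1) * (Complex 0 sigma *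
          (normal_form K t0 k - normal_form K' t0 k))
      + (cis (freq k * (t - t0)) - 1) * z k.
    rewrite /z !(smoothingE K) [freq k * (t - t0)]mulrBr cisD.
    have := cisNK (freq k * t0).
    move: (cis (freq k * t)) (cis (- (freq k * t0))) (cis (freq k * t0)) => p q p0.
    move: (profile K t k) (profile K t0 k) (profile K 0 k) => y y1 y0.
    move: (normal_form K t k) (normal_form K t0 k) (normal_form K 0 k) => w w1 w0.
    move: (normal_form K' t0 k) (Complex 0 sigma) => w' i h.
    apply/eqP; rewrite -subr_eq0; apply/eqP.
    transitivity (p * (1 - q * p0) * (y1 - y0 + i * w0)); first by ring.
    by rewrite h subrr mulr0 mul0r.
  have c2 : nc (cis (freq k * (t - t0)) - 1) <= 2.
    by apply: le_trans (ler_normcB _ _) _; rewrite normc_cis (normcC 1) normr1.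
  rewrite [leRHS]addrC [leRHS]addrA [X in _ <= X + _]addrA.
  apply: le_trans (ler_normcD _ _) _; apply: lerD => //.
  apply: le_trans (ler_normcD _ _) _; apply: lerD.
    apply: le_trans (ler_normcB _ _) _.
    rewrite (normcM (cis _)) (normcM (Complex 0 sigma)) normc_i normc_cis.
    by rewrite !mul1r.
  by rewrite (normcM (_ - 1)) (normcM (Complex 0 sigma)) normc_i mul1r ler_wpM2r ?normc_ge0.
- have M2 : 0 <= 2 * M by rewrite mulr_ge0.
  have H2 : hle (s + beta) g2 (e / 4).
    by have := hle_scale 2 (HK' K KK'); rewrite mulrC divfK.
  have e40 := ltW e4; apply: (hle_add _ _ _ rt) => //; first exact: addr_ge0.
  apply: hle_add => //.
  have cd0 : hle s0 (fun k => nc (c t k - c t0 k)) d.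
    by apply: hle_mono (flow_s0s E) _ cd => k; exact: normc_ge0.
  pose S2 k := nc (c t k) + nc (c t0 k).
  have S20 k : 0 <= S2 k by rewrite addr_ge0 ?normc_ge0.
  have [_ [nst0 n0t0] _] := Hrho t0 (ballxx _ rho0).
  have S2s : hle s S2 (2 * M).
    apply: hle_widen (hle_add (ns_ge0 t) (ns_ge0 t0) (c_ns It) (c_ns It0)).
      exact: addr_ge0.
    by rewrite mulr_natl mulr2n lerD.
  have S20' : hle s0 S2 (2 * M).
    apply: hle_widen (hle_add (n0_ge0 t) (n0_ge0 t0) (c_n0 It) (c_n0 It0)).
      exact: addr_ge0.
    by rewrite mulr_natl mulr2n lerD.
  have D20 k : 0 <= nc (c t k - c t0 k) by exact: normc_ge0.
  have L := leibniz3_phase_hle (box_uniq K) D20 S20 (ltW d0) (ltW d0) M2 M2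
    cd cd0 S2s S20'.
  move: L; set Y := 3 * _ => L; have YE : Y = X * d by rewrite /Y /X; ring.
  apply: hle_widen (_ : 0 <= Y) _ _; [by rewrite YE mulr_ge0 // ltW|by rewrite YE|].
  apply: hle_le L => j; first exact: normc_ge0.
  by apply: tri_phase_diff_le (box_uniq K) _ _ => l; rewrite /S2 ?lerDl ?lerDr normc_ge0.
Qed.

End NormalForm.

(** * Energy *)

Section QuarticForm.
Context {R : realType}.
Local Notation re := (@complex.Re R).
Local Notation nc := (@ComplexField.Normc.normc R).
Implicit Types (c e f g h : int -> R[i]) (B : seq int) (k a b l : int).

Definition quad B e f g h : R[i] :=
  \sum_(k <- B) conjc (e k) * tri ker_one B f g h k.

Lemma quadE B e f g h : quad B e f g h =
  \sum_(k <- B) \sum_(a <- B) \sum_(b <- B) \sum_(l <- B)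
    conjc (e k) * (f a * h b * conjc (g l)) * (a + b - l == k)%:R.
Proof.
rewrite /quad; apply: eq_bigr => k _; rewrite mulr_sumr; apply: eq_bigr => a _.
rewrite mulr_sumr; apply: eq_bigr => b _; rewrite mulr_sumr.
by apply: eq_bigr => l _; rewrite /ker_one mul1r mulrA.
Qed.

Lemma quad_sym13 B e f g h : quad B e f g h = quad B g f e h.
Proof.
rewrite !quadE exchange_big [RHS]exchange_big /=; apply: eq_bigr => a _.
rewrite exchange_big [RHS]exchange_big /=; apply: eq_bigr => b _.
rewrite exchange_big /=; apply: eq_bigr => k _; apply: eq_bigr => l _.
by rewrite (_ : (a + b - k == l) = (a + b - l == k)); [ring|lia].
Qed.

Lemma quad_sym24 B e f g h : quad B e f g h = quad B e h g f.
Proof.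
rewrite !quadE; apply: eq_bigr => k _; rewrite exchange_big /=.
apply: eq_bigr => a _; apply: eq_bigr => b _; apply: eq_bigr => l _.
by rewrite [b + a]addrC; ring.
Qed.

Lemma conjc_quad B e f g h : conjc (quad B e f g h) = quad B f e h g.
Proof.
rewrite !quadE exchange_big conjc_sum /=; apply: eq_bigr => a _.
rewrite conjc_sum; apply: eq_bigr => k _; rewrite exchange_big conjc_sum /=.
apply: eq_bigr => l _; rewrite conjc_sum; apply: eq_bigr => b _.
rewrite !conjcM !conjcK conjc_nat.
by rewrite (_ : (k + l - b == a) = (a + b - l == k)); [ring|lia].
Qed.

Lemma quartic_quad B c : quartic B c = quad B c c c c.
Proof. by apply: eq_bigr => k _; rewrite ccubic_tri. Qed.

(** By the symmetries of [quad] the four slots contribute equally to the real part, two of them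
    after conjugation; hence the factor 4. *)
Lemma cderive_quartic B (c : R -> int -> R[i]) (dc : int -> R[i]) t :
  (forall j, cderive_at (fun x => c x j) t (dc j)) ->
  is_derive t 1 (fun x => re (quartic B (c x)))
    (4 * re (\sum_(k <- B) conjc (dc k) * ccubic B (c t) k)).
Proof.
move=> cd; have := cderive_sum B (fun k => cderiveM (cderive_conj (cd k))
  (cderive_tri ker_one B k cd)).
move=> [+ _]; set F := (X in is_derive _ _ X _); set d := (X in is_derive _ _ _ X).
rewrite (_ : F = fun x => re (quartic B (c x))); last first.
  by apply/funext => x; rewrite quartic_quad.
suff -> : d = 4 * re (\sum_(k <- B) conjc (dc k) * ccubic B (c t) k) by [].
rewrite /d big_split /= -/(quad B dc (c t) (c t) (c t)).
under [X in _ + X]eq_bigr do rewrite !mulrDr.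
rewrite 2!big_split /= -!/(quad B _ _ _ _).
rewrite (quad_sym24 _ _ (c t) _ dc) (quad_sym13 _ _ _ dc).
have /(congr1 re) := conjc_quad B (c t) dc (c t) (c t); rewrite reJ => q.
rewrite !reD q /quad.
under [in RHS]eq_bigr do rewrite ccubic_tri.
by ring.
Qed.

(** Two factors are taken in l2, by Cauchy-Schwarz against the conjugated one and by Young's
    inequality, the other two in l1. *)
Lemma normc_quartic_le K c : nc (quartic (box K) c) <=
  (\sum_(k <- box K) nc (c k) ^+ 2) * (\sum_(k <- box K) nc (c k)) ^+ 2.
Proof.
set m := \sum_(k <- box K) nc (c k) ^+ 2; set X := \sum_(k <- box K) nc (c k).
pose f := lo K (nc \o c).
have f0 k : 0 <= f k by rewrite /f /lo; case: ifP => // _; exact: normc_ge0.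
have m0 : 0 <= m by exact: sum_sqr_ge0.
have X0 : 0 <= X by apply: sumr_ge0 => k _; exact: normc_ge0.
have lo_sum (F : int -> R) S : uniq S -> (forall k, 0 <= F k) ->
    \sum_(k <- S) lo K F k <= \sum_(k <- box K) F k.
  move=> uS F0; rewrite -big_mkcond -big_filter.
  apply: ler_sum_uniq_sub => //; first exact: filter_uniq.
  by move=> k; rewrite mem_filter => /andP[].
have fX : l1le f X by move=> S uS; apply: lo_sum => // k; exact: normc_ge0.
have fm : l1le (fun k => f k ^+ 2) (Num.sqrt m ^+ 2).
  move=> S uS; rewrite sqr_sqrtr //.
  apply: le_trans (lo_sum (fun k => nc (c k) ^+ 2) S uS _); last first.
    by move=> k; exact: sqr_ge0.
  by apply: ler_sum => k _; rewrite /f /lo; case: ifP => //; rewrite expr0n.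
have Y := young_fst f0 f0 f0 (box_uniq K) (box_uniq K) fm fX fX.
have cE k : nc (ccubic (box K) c k) <=
    \sum_(a <- box K) \sum_(b <- box K) f a * f (a + b - k) * f b.
  have -> : ccubic (box K) c k = tri ker_one (box K) (lo K c) (lo K c) (lo K c) k.
    by rewrite ccubic_tri; exact: tri_box_lo.
  have L j : nc (lo K c j) = f j by rewrite /f /lo; case: ifP; rewrite ?normc0.
  apply: le_trans (normc_tri_one_le _ _ _ _ (box_uniq K)) _.
  by apply: ler_sum => a _; apply: ler_sum => b _; rewrite /= !L.
apply: le_trans (ler_normc_sum _ _ _) _.
rewrite -(@ler_pXn2r _ 2) ?nnegrE ?mulr_ge0 ?sqr_ge0 //; last first.
  by apply: sumr_ge0 => k _; exact: normc_ge0.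
under eq_bigr do rewrite normcM normc_conj.
apply: le_trans (cauchy_schwarz _ _ _) _.
rewrite (_ : (m * X ^+ 2) ^+ 2 = m * (Num.sqrt m * X * X) ^+ 2); last first.
  by rewrite !exprMn sqr_sqrtr //; ring.
apply: ler_wpM2l => //; apply: le_trans Y; apply: ler_sum => k _.
have c0 := normc_ge0 (ccubic (box K) c k).
by rewrite ler_pXn2r ?nnegrE //; apply: le_trans c0 _.
Qed.

End QuarticForm.

Section Energy.
Context {R : realType}.
Local Notation re := (@complex.Re R).
Local Notation im := (@complex.Im R).
Local Notation nc := (@ComplexField.Normc.normc R).
Variables (alpha s sigma P Z Cp W : R) (I : set R) (c N : R -> int -> R[i]).
Variables (ns n0 : R -> R).
Hypothesis E : fourier_flow alpha s alpha sigma P Z Cp W I c N ns n0.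

Let Z_ge0 := flow_Z_ge0 E.
Let HZ := flow_Z E.
Let n0_ge0 := flow_n0_ge0 E.
Let c_n0 := flow_n0 E.

Let nc0 (f : int -> R[i]) k : 0 <= (nc \o f) k. Proof. exact: normc_ge0. Qed.

Let alpha_ge0 : 0 <= alpha.
Proof. by have := flow_s0 E; lra. Qed.

Lemma leibniz3_cubic_hle B (D A : int -> R) (d a : R) : uniq B ->
  (forall k, 0 <= D k) -> (forall k, 0 <= A k) -> 0 <= d -> 0 <= a ->
  hle alpha D d -> hle alpha A a ->
  hle alpha (leibniz3 (cubic_sum B) D A)
    (3 * (3 `^ alpha * (Z ^+ 2 * (3 * (d * a ^+ 2))))).
Proof.
move=> uB D0 A0 d0 a0 Dd Aa; set q := 3 `^ alpha * _.
have q0 : 0 <= q by rewrite !mulr_ge0 ?powR_ge0 ?sqr_ge0.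
have -> : 3 * q = q + q + q by ring.
apply: hle_add => //; first by rewrite addr_ge0.
apply: hle_add => //; rewrite /q.
- rewrite (_ : 3 * _ = d * a * a + d * a * a + d * a * a); last by ring.
  by apply: (cubic_sum_hle _ _ _ _ _ _ _ _ _ _ _ _ _ _ _ Z_ge0 HZ).
- rewrite (_ : 3 * _ = a * d * a + a * d * a + a * d * a); last by ring.
  by apply: (cubic_sum_hle _ _ _ _ _ _ _ _ _ _ _ _ _ _ _ Z_ge0 HZ).
- rewrite /q (_ : 3 * _ = a * a * d + a * a * d + a * a * d); last by ring.
  by apply: (cubic_sum_hle _ _ _ _ _ _ _ _ _ _ _ _ _ _ _ Z_ge0 HZ).
Qed.

(** Convergence in H^alpha, stronger than the uniform one. N is compared on a finite set with the
    convolution at a larger M, and the passage from M to K is trilinear with a tail of c in one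
    slot, small in H^alpha. *)
Lemma uniform_N_tail a b : I a -> I b -> a <= b -> forall e, 0 < e ->
  exists K0, forall K, (K0 <= K)%N -> forall t, a <= t <= b ->
  hle alpha (fun k => nc (N t k - ccubic (box K) (c t) k)) e.
Proof.
move=> Ia Ib ab e e0; have [A A0 HA] := bounded_norms E Ia Ib ab.
have X0 : 0 <= 3 * (3 `^ alpha * (Z ^+ 2 * (3 * A ^+ 2))).
  by rewrite !mulr_ge0 ?powR_ge0 ?sqr_ge0.
have [d d0 Xd] := small_factor X0 e0.
have [K0 HK0] := uniform_tail E Ia Ib ab d0.
exists K0 => K KK0 t tab; have It := itv_in E Ia Ib tab.
apply: hle_approx => [|k|S e' e'0]; [exact: ltW|exact: normc_ge0|].
have [K1 HK1] := uniform_N_approx E It It (lexx t) e'0.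
pose M := maxn K K1; have KM : (K <= M)%N := leq_maxl _ _.
exists (leibniz3 (cubic_sum (box M)) (hi K (nc \o c t)) (nc \o c t)).
  have D0 k : 0 <= hi K (nc \o c t) k by exact: hi_ge0.
  have D1 : hle alpha (hi K (nc \o c t)) d.
    by apply: hle_mono (flow_s0s E) _ (HK0 K KK0 t tab).
  have A1 : hle alpha (nc \o c t) A.
    by apply: hle_widen (n0_ge0 t) _ (c_n0 It); case: (HA t tab).
  have := leibniz3_cubic_hle (box_uniq M) D0 (nc0 (c t)) (ltW d0) A0 D1 A1.
  apply: hle_widen; first by rewrite !mulr_ge0 ?powR_ge0 ?sqr_ge0 ?(ltW d0).
  apply: le_trans Xd; rewrite le_eqVlt; apply/orP; left; apply/eqP.
  by move: (3 `^ alpha) => x; ring.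
move=> k _; have h1 := HK1 M (leq_maxr _ _) t; rewrite lexx in h1.
have {}h1 := h1 isT k.
rewrite -[X in nc X <= _](subrKA (ccubic (box M) (c t) k)) addrC.
apply: le_trans (ler_normcD _ _) _; apply: lerD => //.
rewrite !ccubic_tri (tri_box_lo _ _ _ KM).
have := @tri_one_diff_le _ (box M) (c t) (lo K (c t)) (nc \o c t) k (box_uniq M)
  (fun _ => lexx _) (normc_lo_le (c t) K).
by rewrite (_ : (fun k => nc (c t k - lo K (c t) k)) = hi K (nc \o c t)) //;
  apply/funext => j; rewrite normc_sub_lo.
Qed.

Lemma N_hle a b : I a -> I b -> a <= b -> exists2 B, 0 <= B &
  forall t, a <= t <= b -> hle alpha (nc \o N t) B.
Proof.
move=> Ia Ib ab; have [A A0 HA] := bounded_norms E Ia Ib ab.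
pose X := 2 * (3 `^ alpha * (Z ^+ 2 * (3 * (A * A ^+ 2)))).
have X0 : 0 <= X by rewrite !mulr_ge0 ?powR_ge0 ?sqr_ge0.
have PA0 : 0 <= `|P| * A by rewrite mulr_ge0.
exists (X + `|P| * A) => [|t tab]; first by rewrite addr_ge0.
have It := itv_in E Ia Ib tab; have [_ n0A] := HA t tab.
have h1 : hle alpha (nc \o forcing P c N t) X.
  apply: hle_widen (forcing_hle E alpha_ge0 It (n0_ge0 t) (c_n0 It)).
    by rewrite !mulr_ge0 ?powR_ge0 ?sqr_ge0.
  apply: ler_wpM2l => //; apply: ler_wpM2l; first exact: powR_ge0.
  apply: ler_wpM2l; first exact: sqr_ge0.
  apply: ler_wpM2l => //; apply: ler_pM; rewrite ?sqr_ge0 //.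
  by rewrite ler_pXn2r ?nnegrE.
have h2 : hle alpha (fun k => `|P| * nc (c t k)) (`|P| * A).
  by apply: hle_scale; apply: hle_widen (n0_ge0 t) n0A (c_n0 It).
apply: hle_le (hle_add X0 PA0 h1 h2) => k; first exact: normc_ge0.
rewrite /= -[N t k](subrK (P%:C%C * c t k)); apply: le_trans (ler_normcD _ _) _.
by apply: lerD => //; rewrite normcM normcC.
Qed.

Definition energy K t : R :=
  2^-1 * \sum_(k <- box K) frac_symbol alpha k * nc (c t k) ^+ 2 -
  sigma / 4 * re (quartic (box K) (c t)).

Lemma frac_symbol_ge0 k : 0 <= frac_symbol alpha k :> R.
Proof. exact: powR_ge0. Qed.

Lemma frac_symbol_le k : frac_symbol alpha k <= jpow alpha k ^+ 2 :> R.
Proof.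
rewrite jpow_sqr; apply: ge0_ler_powR; rewrite ?nnegrE ?mulr_ge0 //.
- exact: japanese_ge0.
- exact: normr_le_japanese.
Qed.

Lemma jpow_sqr_le k : jpow alpha k ^+ 2 <= 2 * (1 + frac_symbol alpha k) :> R.
Proof.
have /andP[_ a1] := flow_alpha E; have f0 := frac_symbol_ge0 k.
rewrite jpow_sqr /jpow powRrM -[_ `^ 2]/(_ `^ 2%:R) powR_mulrn ?japanese_ge0 //.
have k2 : 0 <= `|k%:~R : R| by [].
have [->|kn0] := eqVneq k 0.
  rewrite japanese_sqr (_ : 0%:~R = 0) // expr0n addr0 powR1.
  by have := frac_symbol_ge0 0; lra.
have k1 := normr_int_ge1 (R := R) kn0.
rewrite japanese_sqr -real_normK ?num_real //.
set x := `|k%:~R| in k1 k2 *.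
apply: (@le_trans _ _ ((2 * x ^+ 2) `^ alpha)).
  apply: ge0_ler_powR; rewrite ?nnegrE ?addr_ge0 ?mulr_ge0 ?sqr_ge0 //.
  by rewrite mulr_natl mulr2n lerD2r -[1](expr1n _ 2) ler_pXn2r ?nnegrE.
rewrite powRM ?sqr_ge0 //.
have -> : (x ^+ 2) `^ alpha = frac_symbol alpha k.
  by rewrite /frac_symbol -/x -powR_mulrn // -powRrM.
apply: ler_pM; rewrite ?powR_ge0 //; last by rewrite lerDr.
by rewrite -[leRHS]powRr1 // ler_powR // ler1n.
Qed.

(** With r = N - [ccubic], every term of the derivative free of r cancels, frequency by frequency.
    In the rest the weight |k|^(2 alpha) is split as <k>^alpha on c or N and <k>^alpha on r. *)
Lemma energy_variation a b : I a -> I b -> a <= b -> forall e, 0 < e ->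
  exists K0, forall K, (K0 <= K)%N -> forall t1 t2, a <= t1 -> t1 <= t2 -> t2 <= b ->
  `|energy K t2 - energy K t1| <= e.
Proof.
move=> Ia Ib ab e e0; have [A A0 HA] := bounded_norms E Ia Ib ab.
have [B B0 HB] := N_hle Ia Ib ab.
have X0 : 0 <= (A + B) * (b - a).
  by apply: mulr_ge0; [exact: addr_ge0|rewrite subr_ge0].
have [d d0 Xd] := small_factor X0 e0.
have [K0 HK0] := uniform_N_tail Ia Ib ab d0.
exists K0 => K KK0 t1 t2 at1 t12 t2b.
pose dc t k := Complex 0 (frac_symbol alpha k) * c t k - Complex 0 sigma * N t k.
pose de t := 2^-1 * (\sum_(k <- box K) frac_symbol alpha k *
    (2 * re (conjc (c t k) * dc t k))) -
  sigma / 4 * (4 * re (\sum_(k <- box K) conjc (dc t k) * ccubic (box K) (c t) k)).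
have sub t : t1 <= t <= t2 -> a <= t <= b.
  by move=> /andP[t1t tt2]; rewrite (le_trans at1) //= (le_trans tt2).
have Ed t : t1 <= t <= t2 -> is_derive t 1 (energy K) (de t).
  move=> /sub tab; have cd := flow_der E (itv_in E Ia Ib tab).
  have h1 := is_derive_sum_normc_sqr (box K) (fun k => frac_symbol alpha k) cd.
  have h2 := cderive_quartic (box K) cd.
  exact: is_deriveB (is_deriveZ (2^-1) h1) (is_deriveZ (sigma / 4) h2).
apply: (@le_trans _ _ ((A + B) * d * (t2 - t1))); last first.
  apply: le_trans Xd; rewrite mulrAC; apply: ler_wpM2r; first exact: ltW.
  by apply: ler_wpM2l; [exact: addr_ge0|exact: lerB].
apply: (abs_mvt t12 Ed) => t /sub tab.
have It := itv_in E Ia Ib tab; have [_ n0A] := HA t tab.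
pose r k := N t k - ccubic (box K) (c t) k.
have ss : sigma * sigma = 1.
  by have := flow_sigma E; rewrite -expr2 -real_normK ?num_real // => ->; rewrite expr1n.
have -> : de t = \sum_(k <- box K) (sigma * frac_symbol alpha k *
    im (conjc (c t k) * r k) - im (conjc (N t k) * r k)).
  rewrite /de re_sum !mulr_sumr -sumrB; apply: eq_bigr => k _.
  have lin (x y z w l : R) : 2^-1 * (l * (2 * x)) - sigma / 4 * (4 * y) =
      sigma * l * z - w <-> l * x - sigma * y = sigma * l * z - w.
    by split => h; lra.
  apply/lin; rewrite /dc /r !(reimE, re_i, im_i).
  move: (re (c t k)) (im (c t k)) (re (N t k)) (im (N t k)) => c1 c2 N1 N2.
  move: (re (ccubic _ _ _)) (im (ccubic _ _ _)) (frac_symbol alpha k) => q1 q2 l.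
  transitivity (sigma * l * (c1 * (N2 - q2) - c2 * (N1 - q1)) +
    sigma * sigma * (- N2 * q1 + N1 * q2) ); first by ring.
  by rewrite ss; ring.
apply: le_trans (ler_norm_sum _ _ _) _.
apply: (@le_trans _ _ (\sum_(k <- box K) (jpow alpha k * (nc (c t k) + nc (N t k))) *
    (jpow alpha k * nc (r k)))).
  apply: ler_sum => k _; have r0 := normc_ge0 (r k).
  rewrite mulrACA -expr2 mulrDl mulrDr; apply: le_trans (ler_normB _ _) _; apply: lerD.
    rewrite !normrM (flow_sigma E) mul1r ger0_norm ?frac_symbol_ge0 //.
    apply: ler_pM; rewrite ?frac_symbol_ge0 ?frac_symbol_le //.
    by apply: le_trans (ler_im_normc _) _; rewrite normcM normc_conj.
  apply: le_trans (ler_im_normc _) _; rewrite normcM normc_conj.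
  by rewrite ler_peMl ?mulr_ge0 ?normc_ge0 // exprn_ege1 // jpow_ge1.
have h1 : hle alpha (fun k => nc (c t k) + nc (N t k)) (A + B).
  apply: hle_add => //; last exact: HB.
  exact: hle_widen (n0_ge0 t) n0A (c_n0 It).
have h2 := HK0 K KK0 t tab.
apply: le_trans (ler_norm _) _.
rewrite -(@ler_pXn2r _ 2) ?nnegrE ?mulr_ge0 ?addr_ge0 ?(ltW d0) //.
rewrite real_normK ?num_real //; apply: le_trans (cauchy_schwarz _ _ _) _.
rewrite exprMn; apply: ler_pM; rewrite ?sum_sqr_ge0 //.
  exact: h1 (box_uniq K).
exact: h2 (box_uniq K).
Qed.

End Energy.

(** * The a priori bound in H^alpha *)

Section EnergyBound.
Context {R : realType}.
Local Notation re := (@complex.Re R).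
Local Notation nc := (@ComplexField.Normc.normc R).

(** For |k| <= J Cauchy-Schwarz over 2J + 1 terms gives the mass; beyond J, Cauchy-Schwarz against
    <k>^(-alpha) gives the H^alpha norm with the small factor [delta]. *)
Lemma sum_normc_sqr_le (alpha : R) (d : int -> R[i]) J K (delta : R) :
  tail_le (fun k => jpow (- alpha) k ^+ 2) J delta -> (J <= K)%N ->
  (\sum_(k <- box K) nc (d k)) ^+ 2 <=
  2 * ((2 * J).+1%:R * \sum_(k <- box K) nc (d k) ^+ 2) +
  2 * (delta * \sum_(k <- box K) (jpow alpha k * nc (d k)) ^+ 2).
Proof.
move=> tJ JK; rewrite (sum_box_split _ JK).
set x := \sum_(k <- box J) _; set y := (X in x + X).
have -> : (x + y) ^+ 2 = 2 * x ^+ 2 + 2 * y ^+ 2 - (x - y) ^+ 2 by ring.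
apply: (@le_trans _ _ (2 * x ^+ 2 + 2 * y ^+ 2)); first by rewrite gerBl sqr_ge0.
have sJK : {subset box J <= box K}.
  by move=> k; rewrite !mem_box => /leq_trans; apply.
apply: lerD; apply: ler_wpM2l => //.
  have := cauchy_schwarz (box J) (fun=> 1) (fun k => nc (d k)).
  under eq_bigr do rewrite mul1r; move=> /le_trans; apply; apply: ler_pM.
  - by apply: sumr_ge0 => k _; exact: sqr_ge0.
  - exact: sum_sqr_ge0.
  - under eq_bigr do rewrite expr1n.
    by rewrite big_const_seq count_predT size_map size_iota iter_addr_0.
  - by apply: ler_sum_uniq_sub (box_uniq J) sJK _ => k; exact: sqr_ge0.
rewrite /y; set S := [seq _ <- _ | _].
have uS : uniq S by rewrite filter_uniq ?box_uniq.
have := cauchy_schwarz S (jpow (- alpha)) (fun k => jpow alpha k * nc (d k)).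
under eq_bigr do rewrite mulrA jpowNr mul1r.
move=> /le_trans; apply; apply: ler_pM; rewrite ?sum_sqr_ge0 //.
  by apply: tJ => // k; rewrite mem_filter => /andP[].
apply: ler_sum_uniq_sub => //; last by move=> k; exact: sqr_ge0.
by move=> k; rewrite mem_filter => /andP[].
Qed.

(* In the focusing case the quartic part of the energy is absorbed by splitting
   the frequencies at a height J that depends only on the norm q of the datum. *)
Lemma energy_bound (alpha Z q : R) : 2^-1 < alpha <= 1 -> 0 <= Z -> 0 <= q ->
  exists2 B, 0 <= B & forall s sigma P Cp W I c N ns n0,
  fourier_flow alpha s alpha sigma P Z Cp W I c N ns n0 -> n0 0 = q ->
  forall t, I t -> hle alpha (nc \o c t) B.
Proof.
move=> /andP[ha _] Z0 q0; have [Zj HZj] := l1le_jpow ha.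
pose m1 := q ^+ 2 + 1; have m10 : 0 < m1 by rewrite ltr_wpDl ?sqr_ge0.
(* With this delta the high-frequency term, 2 delta Y multiplied by a mass of at most m1, is Y/2 and
   is absorbed on the left. The summand 1 in m1 is the tolerance in near conservation of mass. *)
have d0 : 0 < (4 * m1)^-1 by rewrite invr_gt0 mulr_gt0.
have [J HJ] := tail_le_small (fun k => sqr_ge0 (jpow (- alpha) k)) HZj d0.
(* E0 bounds the initial energy: the quadratic part by q^2/2, the quartic part by the mass times the
   square of the l1 bound Z q. *)
pose E0 := 2^-1 * q ^+ 2 + 4^-1 * (q ^+ 2 * (Z * q) ^+ 2).
have E00 : 0 <= E0 by rewrite addr_ge0 // !mulr_ge0 ?sqr_ge0.
pose Y1 := 2 * (2 * m1 + 4 * (E0 + 1) + m1 * (2 * ((2 * J).+1%:R * m1))).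
have Y10 : 0 <= Y1.
  have m0 := ltW m10; rewrite mulr_ge0 // !addr_ge0 ?mulr_ge0 //.
  by rewrite addr_ge0.
exists (Num.sqrt Y1) => [|s sigma P Cp W I c N ns n0 E n0q t It S uS].
  exact: sqrtr_ge0.
rewrite sqr_sqrtr //; have I0 := flow_I0 E.
have var (F : nat -> R -> R) : (forall a b, I a -> I b -> a <= b ->
    forall e, 0 < e -> exists K0, forall K, (K0 <= K)%N -> forall t1 t2,
    a <= t1 -> t1 <= t2 -> t2 <= b -> `|F K t2 - F K t1| <= e) ->
    exists K0, forall K, (K0 <= K)%N -> F K t <= F K 0 + 1.
  move=> H; have [t0|t0] := leP 0 t.
    have [K0 HK0] := H 0 t I0 It t0 1 ltr01; exists K0 => K /HK0 h.
    by rewrite -lerBlDl (le_trans (ler_norm _)) ?h.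
  have [K0 HK0] := H t 0 It I0 (ltW t0) 1 ltr01; exists K0 => K /HK0 h.
  by rewrite -lerBlDl (le_trans (ler_norm _)) // distrC h // ltW.
have [K1 HK1] := var _ (mass_variation E).
have [K2 HK2] := var _ (energy_variation E).
have [K3 SK3] := sub_box S.
pose K := maxn (maxn K1 K2) (maxn K3 J).
have [K1K K2K K3K JK] : [/\ K1 <= K, K2 <= K, K3 <= K & J <= K]%N.
  by rewrite /K; split; rewrite !leq_max leqnn ?orbT.
have hm := HK1 K K1K; have hE := HK2 K K2K.
have SK k : k \in S -> k \in box K.
  by move=> /SK3; rewrite !mem_box => /leq_trans; apply.
pose Y x := \sum_(k <- box K) (jpow alpha k * nc (c x k)) ^+ 2.
have Y0 x : 0 <= Y x by exact: sum_sqr_ge0.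
apply: (@le_trans _ _ (Y t)).
  by apply: ler_sum_uniq_sub => // k; exact: sqr_ge0.
have mY x : mass c K x <= Y x.
  apply: ler_sum => k _; have n := normc_ge0 (c x k).
  have j1 : 1 <= jpow alpha k by apply: jpow_ge1; apply: ltW (lt_trans _ ha).
  by rewrite ler_pXn2r ?nnegrE ?mulr_ge0 ?jpow_ge0 // ler_peMl.
have m0 x : 0 <= mass c K x by exact: sum_sqr_ge0.
have YQ : Y 0 <= q ^+ 2 by rewrite -n0q; exact: (flow_n0 E I0 (box_uniq K)).
have quart x : `|sigma / 4 * re (quartic (box K) (c x))| <= 4^-1 *
    (mass c K x * (\sum_(k <- box K) nc (c x k)) ^+ 2).
  rewrite !normrM (flow_sigma E) mul1r ger0_norm //; apply: ler_wpM2l => //.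
  exact: le_trans (ler_re_normc _) (normc_quartic_le _ _).
have hE0 : energy alpha sigma c K 0 <= E0.
  rewrite /energy /E0; apply: lerD.
    apply: ler_wpM2l => //; apply: le_trans YQ; apply: ler_sum => k _.
    by rewrite exprMn ler_wpM2r ?sqr_ge0 ?(frac_symbol_le E).
  apply: le_trans (ler_norm _) _; rewrite normrN; apply: le_trans (quart 0) _.
  apply: ler_wpM2l => //; apply: ler_pM; rewrite ?sqr_ge0 //.
    exact: le_trans (mY 0) YQ.
  rewrite ler_pXn2r ?nnegrE ?mulr_ge0 //; last first.
    by apply: sumr_ge0 => k _; exact: normc_ge0.
  by rewrite -n0q; exact: (c_l1 E I0 (box_uniq K)).
have hm1 : mass c K t <= m1.
  by apply: le_trans hm _; rewrite lerD2r (le_trans (mY 0)).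
have X2 := sum_normc_sqr_le (c t) (HJ J (leqnn J)) JK.
have YE : Y t <= 2 * mass c K t + 4 * energy alpha sigma c K t +
    mass c K t * (\sum_(k <- box K) nc (c t k)) ^+ 2.
  apply: (@le_trans _ _ (2 * mass c K t +
    2 * \sum_(k <- box K) frac_symbol alpha k * nc (c t k) ^+ 2)).
    rewrite /mass !mulr_sumr -big_split; apply: ler_sum => k _ /=.
    rewrite (_ : 2 * _ + _ = 2 * (1 + frac_symbol alpha k) * nc (c t k) ^+ 2);
      last by ring.
    by rewrite exprMn ler_wpM2r ?sqr_ge0 ?(jpow_sqr_le E).
  have := quart t; rewrite ler_norml => /andP[_ +]; rewrite /energy.
  set x := sigma / 4 * _; set y := \sum_(k <- box K) frac_symbol _ _ * _.
  set z := _ * (\sum_(k <- box K) _) ^+ 2; move: x y z (mass c K t) => x y z v.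
  by clear; lra.
move: X2; rewrite -/(mass c K t) -/(Y t) => X2.
have := ler_pM (m0 t) (sqr_ge0 _) hm1 X2.
have -> : m1 * (2 * ((2 * J).+1%:R * mass c K t) + 2 * ((4 * m1)^-1 * Y t)) =
    m1 * (2 * ((2 * J).+1%:R * mass c K t)) + Y t / 2.
  by field; rewrite gt_eqF.
have : m1 * (2 * ((2 * J).+1%:R * mass c K t)) <= m1 * (2 * ((2 * J).+1%:R * m1)).
  by rewrite ler_pM2l // ler_wpM2l // ler_wpM2l.
move: YE hE hE0 hm1; rewrite /Y1.
have lin (x y z e e' Yt m m' E' : R) : Yt <= 2 * m + 4 * e + x -> e <= e' + 1 ->
  e' <= E' -> m <= m' -> y <= z -> x <= y + Yt / 2 ->
  Yt <= 2 * (2 * m' + 4 * (E' + 1) + z) by clear; lra.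
exact: lin.
Qed.

End EnergyBound.

(** * Solutions *)

Section Solutions.
Context {R : realType}.
Local Notation re := (@complex.Re R).
Local Notation im := (@complex.Im R).
Local Notation nc := (@ComplexField.Normc.normc R).

Lemma Hnorm2_mono r r' (f : R -> R[i]) : r <= r' -> (Hnorm2 r' f < +oo)%E ->
  (Hnorm2 r f < +oo)%E /\ Hnorm r f <= Hnorm r' f.
Proof.
move=> rr ff; apply: Hnorm_le; first exact: Hnorm_ge0.
by apply: hle_mono rr _ (hle_Hnorm ff) => k; exact: normc_ge0.
Qed.

Lemma time_derivative_eq (d z w : R[i]) (l sigma : R) :
  (0 +i* 1)%C * d + l%:C%C * z = sigma%:C%C * w ->
  d = Complex 0 l * z - Complex 0 sigma * w.
Proof.
move=> eq; apply: complex_eq; [have := congr1 im eq|have := congr1 re eq].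
all: by rewrite !(reimE, re_i, im_i) !(mul0r, mul1r, subr0, sub0r, add0r, addr0); lra.
Qed.

Lemma fcoefB_L2T (f g : R -> R[i]) k : L2T f -> L2T g ->
  fcoef (fun x => f x - g x) k = fcoef f k - fcoef g k.
Proof. by move=> fL gL; apply: fcoefB; exact: L2T_cintegrable. Qed.

Lemma Hnorm_triangle r (f g : R -> R[i]) : inH r f -> inH r g ->
  inH r (fun x => f x - g x) -> Hnorm r f <= Hnorm r g + Hnorm r (fun x => f x - g x).
Proof.
move=> [fL ff] [gL gf] [dL df].
have H := hle_add (Hnorm_ge0 r g) (Hnorm_ge0 r (fun x => f x - g x))
  (hle_Hnorm gf) (hle_Hnorm df).
apply: (Hnorm_le _ _).2; first by rewrite addr_ge0 ?Hnorm_ge0.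
apply: hle_le H => k; first exact: normc_ge0.
rewrite fcoefB_L2T //.
by rewrite -[X in nc X <= _](subrKC (fcoef g k)) ler_normcD.
Qed.

Lemma inHB r (f g : R -> R[i]) : inH r f -> inH r g -> inH r (fun x => f x - g x).
Proof.
move=> [fL ff] [gL gf]; split; first exact: L2TB.
have H := hle_add (Hnorm_ge0 r f) (Hnorm_ge0 r g) (hle_Hnorm ff) (hle_Hnorm gf).
apply: (@Hnorm_le _ _ _ (Hnorm r f + Hnorm r g) _ _).1; first by rewrite addr_ge0 ?Hnorm_ge0.
apply: hle_le H => k; first exact: normc_ge0.
by rewrite fcoefB_L2T // ler_normcB.
Qed.

Lemma Hnorm_distC r (f g : R -> R[i]) : L2T f -> L2T g ->
  Hnorm r (fun x => f x - g x) = Hnorm r (fun x => g x - f x).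
Proof.
move=> fL gL; rewrite /Hnorm; suff -> : Hnorm2 r (fun x => f x - g x) =
  Hnorm2 r (fun x => g x - f x) by [].
apply: eq_esum => k _; by rewrite !fcoefB_L2T // normc_distC.
Qed.

Lemma CtH_near r r' (I : set R) (u : R -> R -> R[i]) : r <= r' -> CtH r' I u ->
  forall t0, I t0 -> forall e, 0 < e -> \forall t \near t0, I t ->
  Hnorm r (fun x => u t x - u t0 x) <= e.
Proof.
move=> rr [uI uc] t0 It0 e e0; have := uc t0 It0.
move/cvgr_dist_le => /(_ _ e0); rewrite near_withinE; apply: filterS => t + It => /(_ It).
rewrite sub0r normrN ger0_norm ?Hnorm_ge0 //; apply: le_trans.
by have [] := Hnorm2_mono rr (inHB (uI t It) (uI t0 It0)).2.
Qed.

Lemma Hnorm_continuous r r' (I : set R) (u : R -> R -> R[i]) : r <= r' ->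
  open I -> CtH r' I u -> {in I, forall t, {for t, continuous (fun t => Hnorm r (u t))}}.
Proof.
move=> rr oI uC t0 /[!inE] It0; have [uI _] := uC.
have uI' t : I t -> inH r (u t).
  by move=> It; have [uL uf] := uI t It; split => //; have [] := Hnorm2_mono rr uf.
apply/cvgrPdist_le => e e0; have := CtH_near rr uC It0 e0.
have : \forall t \near t0, I t by apply: open_nbhs_nbhs.
apply: filterS2 => t It /(_ It) ute; have ut := uI' t It; have ut0 := uI' t0 It0.
have h1 := Hnorm_triangle ut ut0 (inHB ut ut0).
have h2 := Hnorm_triangle ut0 ut (inHB ut0 ut).
rewrite (@Hnorm_distC _ (u t0)) in h2; [|by case: ut0|by case: ut].
move: h1 h2 ute; move: (Hnorm r (u t)) (Hnorm r (u t0)) (Hnorm r _) => x y z.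
by move=> h1 h2 ze; rewrite ler_norml; apply/andP; split; lra.
Qed.

Variables (alpha s s0 Z Cp W : R).
Hypotheses (halpha : 2^-1 < alpha <= 1) (hs0 : 2^-1 < s0) (s0s : s0 <= s).
Hypotheses (Z_ge0 : 0 <= Z) (Cp_ge0 : 0 <= Cp).
Hypothesis HZ : forall (f : int -> R) A, (forall k, 0 <= f k) -> 0 <= A ->
  hle s0 f A -> l1le f (Z * A).
Hypothesis HC : forall k a b : int, a != k -> b != k ->
    jpow (s + (2 * alpha - 1)) k / `|phase alpha k a b| <=
    Cp * (jpow s a + jpow s (a + b - k) + jpow s b +
          inv_abs (a - k) * inv_abs (b - k) *
          (jpow s a * jpow s0 (a + b - k) * jpow s0 b)).
Hypothesis HW : l1le (fun k => inv_abs k ^+ 2 : R) W.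

Section OneSolution.
Variables (sigma : R) (u0 : R -> R[i]) (I : set R) (u : R -> R -> R[i]).
Hypotheses (hsigma : sigma = 1 \/ sigma = -1) (u0H : inH s u0).
Hypothesis uS : fNLS_solution alpha s sigma u0 I u.

Let P := pi^-1 * L2norm u0 ^+ 2.

Lemma solution_init k : fcoef (u 0) k = fcoef u0 k.
Proof.
have [[_ _ I0] [uI _] ae0 _] := uS; have [uL _] := uI 0 I0; have [u0L _] := u0H.
apply: fcoef_ae; try exact: L2T_cmeasurable.
by apply: aeS ae0 => x + _; exact.
Qed.

Lemma solution_init_Hnorm r : Hnorm r (u 0) = Hnorm r u0.
Proof.
rewrite /Hnorm; suff -> : Hnorm2 r (u 0) = Hnorm2 r u0 by [].
by apply: eq_esum => k _; rewrite solution_init.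
Qed.

Lemma solution_init_L2norm : L2norm (u 0) = L2norm u0.
Proof.
have [[_ _ I0] [uI _] ae0 _] := uS; have [uL _] := uI 0 I0; have [u0L _] := u0H.
rewrite /L2norm; congr (Num.sqrt (fine _)); apply: ae_eq_integral => //.
- by apply/measurable_EFinP; apply: measurable_funTS;
    apply: measurable_normc_sqr; exact: L2T_cmeasurable.
- by apply/measurable_EFinP; apply: measurable_funTS;
    apply: measurable_normc_sqr; exact: L2T_cmeasurable.
- by apply: aeS ae0 => x + _ => ->.
Qed.

(** The passage from functions to sequences. Division by pi turns the Parseval estimate into the one
    for P, with 48 pi becoming 48. *)
Lemma solution_flow : fourier_flow alpha s s0 sigma P Z Cp W I
  (fun t => fcoef (u t)) (fun t => fcoef (cubic (u t)))
  (fun t => Hnorm s (u t)) (fun t => Hnorm s0 (u t)).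
Proof.
have [[oI iI I0] uC ae0 ud] := uS; have [uI _] := uC.
have uL t : I t -> L2T (u t) by move=> It; case: (uI t It).
have us t : I t -> hle s (nc \o fcoef (u t)) (Hnorm s (u t)).
  by move=> It; apply: hle_Hnorm; case: (uI t It).
have us0 t : I t -> hle s0 (nc \o fcoef (u t)) (Hnorm s0 (u t)).
  by move=> It; apply: hle_Hnorm; have [_ uf] := uI t It; case: (Hnorm2_mono s0s uf).
split => //.
- by case: hsigma => ->; rewrite ?normrN normr1.
- by move=> t; exact: Hnorm_ge0.
- by move=> t; exact: Hnorm_ge0.
- exact: Hnorm_continuous.
- exact: Hnorm_continuous s0s oI uC.
- move=> t0 It0 e e0; have := CtH_near (lexx s) uC It0 e0.
  apply: filterS => t + It => /(_ It) ute.
  have H := hle_Hnorm (inHB (uI t It) (uI t0 It0)).2.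
  apply: hle_widen (Hnorm_ge0 _ _) ute _; apply: hle_le H => k.
    exact: normc_ge0.
  by rewrite fcoefB_L2T //; exact: uL.
- move=> t It k; have [d dd eq] := ud t It k.
  suff <- : d = Complex 0 (frac_symbol alpha k) * fcoef (u t) k -
    Complex 0 sigma * fcoef (cubic (u t)) k by [].
  exact: time_derivative_eq.
- by move=> t It A e K cA e0 te k; exact: (fcoef_cubic_trunc (uL t It) cA).
- move=> A e K cA e0 te.
  have := L2norm_trunc (uL 0 I0) cA e0 te; rewrite solution_init_L2norm.
  have pi0 : 0 < pi :> R := pi_gt0 R.
  have -> : P - 2 * \sum_(k <- box K) nc (fcoef (u 0) k) ^+ 2 = pi^-1 *
    (L2norm u0 ^+ 2 - 2 * pi * \sum_(k <- box K) nc (fcoef (u 0) k) ^+ 2).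
    by rewrite /P mulrBr; congr (_ - _); rewrite mulrA [pi^-1 * _]mulrCA mulVf ?gt_eqF //
      mulr1.
  rewrite normrM [`|pi^-1|]ger0_norm ?invr_ge0 ?(ltW pi0) // => h.
  rewrite mulrC ler_pdivrMr //; apply: le_trans h _.
  by rewrite le_eqVlt; apply/orP; left; apply/eqP; ring.
Qed.

Let F := solution_flow.

Lemma smoothing_diff_coef t : I t -> L2T (smoothing_diff alpha sigma u0 u t) /\
  forall k, fcoef (smoothing_diff alpha sigma u0 u t) k =
    smoothing alpha sigma P (fun t => fcoef (u t)) t k.
Proof.
move=> It; have [[_ _ I0] [uI _] _ _] := uS; have [uL _] := uI t It.
have u0l1 : l1le (fun k => nc (fcoef u0 k)) (Z * Hnorm s0 (u 0)).
  by move=> S uS'; under eq_bigr do rewrite -solution_init; exact: (c_l1 F I0).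
have [mL mE] := fourier_multiplierP (fun k => normc_cis (t * frac_symbol alpha k)) u0l1.
rewrite -/(free_evol alpha t u0) in mL mE.
have pL : L2T (phased_evol alpha sigma P t u0) by exact: L2TZ.
split => [|k]; first exact: L2TB.
rewrite /smoothing_diff fcoefB; try exact: L2T_cintegrable.
rewrite -/P fcoefZ; last exact: L2T_cintegrable.
rewrite mE /smoothing solution_init mulrA -cisD; congr (_ - cis _ * _).
by rewrite /freq; ring.
Qed.

Lemma smoothing_diff_bound r t : r <= s + (2 * alpha - 1) -> I t ->
  inH r (smoothing_diff alpha sigma u0 u t) /\
  Hnorm r (smoothing_diff alpha sigma u0 u t) <=
  3 * phase_cst Z Cp W * (Hnorm s u0 * Hnorm s0 u0 ^+ 2) +
  3 * phase_cst Z Cp W * (Hnorm s (u t) * Hnorm s0 (u t) ^+ 2) +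
  profile_cst s s0 Z Cp W * `|oriented_integral 0 t (fun t => Hnorm s (u t) *
    (Hnorm s0 (u t) ^+ 2 + Hnorm s0 (u t) ^+ 4))|.
Proof.
move=> rs It; have [dL dE] := smoothing_diff_coef It.
have := smoothing_hle F It; rewrite !solution_init_Hnorm.
set A := (X in hle _ _ X); move=> H.
have A0 : 0 <= A.
  have ph0 := phase_cst_ge0 F; have pr0 := profile_cst_ge0 F.
  have b0 f : 0 <= 3 * phase_cst Z Cp W * (Hnorm s f * Hnorm s0 f ^+ 2).
    by rewrite mulr_ge0 // mulr_ge0 ?sqr_ge0 ?Hnorm_ge0.
  by rewrite /A addr_ge0 // ?addr_ge0 // mulr_ge0.
have [] := @Hnorm_le R r (smoothing_diff alpha sigma u0 u t) A A0.
  apply: (hle_mono rs) => [k|]; first exact: normc_ge0.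
  by move: H; apply: l2le_eq => k; rewrite dE.
by move=> h1 h2; split; [split|exact: h2].
Qed.

Lemma smoothing_diff_CtH r : r <= s + (2 * alpha - 1) ->
  CtH r I (smoothing_diff alpha sigma u0 u).
Proof.
move=> rs; split=> [t It|t0 It0]; first by case: (smoothing_diff_bound rs It).
apply/cvgrPdist_le => e e0; have := smoothing_continuous F It0 e0.
apply: filterS => t + It => /(_ It) H.
have [dL dE] := smoothing_diff_coef It; have [dL0 dE0] := smoothing_diff_coef It0.
rewrite sub0r normrN ger0_norm ?Hnorm_ge0 //.
apply: (Hnorm_le (ltW e0) _).2; apply: (hle_mono rs) => [k|]; first exact: normc_ge0.
move: H; apply: l2le_eq => k; by rewrite fcoefB_L2T // dE dE0.
Qed.

End OneSolution.
End Solutions.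

(** With primitives F and G of f and g on the interval, M G - F is nondecreasing; for t < 0 the same
    comparison is made on [t, 0]. *)
Lemma oriented_integral_le (R : realType) (I : set R) (f g : R -> R) (M t : R) :
  open I -> is_interval I -> I 0 -> I t -> 0 <= M ->
  {in I, forall x, {for x, continuous f}} -> {in I, forall x, {for x, continuous g}} ->
  (forall x, I x -> 0 <= f x) -> (forall x, I x -> f x <= M * g x) ->
  `|oriented_integral 0 t f| <= M * `|oriented_integral 0 t g|.
Proof.
move=> oI iI I0 It M0 fc gc f0 fg.
have key a b : I a -> I b -> a <= b ->
    `|\int[lebesgue_measure]_(x in `[a, b]) f x| <=
    M * (\int[lebesgue_measure]_(x in `[a, b]) g x).
  move=> Ia Ib ab; have [F Fd <-] := primitive_on_itv oI iI Ia Ib ab fc.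
  have [G Gd <-] := primitive_on_itv oI iI Ia Ib ab gc.
  have Ix x : a <= x <= b -> I x by exact: iI.
  rewrite ger0_norm; last first.
    by rewrite subr_ge0; apply: (mvt_nondecreasing ab Fd) => x /Ix; exact: f0.
  have H x : a <= x <= b ->
      is_derive x 1 (fun x => M * G x - F x) (M * g x - f x).
    by move=> xab; exact: is_deriveB (is_deriveZ M (Gd x xab)) (Fd x xab).
  have := mvt_nondecreasing ab H; rewrite mulrBr.
  have lin (x y z w : R) : z - x <= w - y -> y - x <= w - z by clear; lra.
  by move=> h; apply/lin/h => x /Ix /fg; rewrite subr_ge0.
have M_key a b : I a -> I b -> a <= b ->
    `|\int[lebesgue_measure]_(x in `[a, b]) f x| <=
    M * `|\int[lebesgue_measure]_(x in `[a, b]) g x|.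
  move=> Ia Ib ab; apply: le_trans (key a b Ia Ib ab) _.
  by apply: ler_wpM2l => //; exact: ler_norm.
rewrite /oriented_integral; have [t0|t0] := leP 0 t; first exact: M_key.
by rewrite !normrN; apply: M_key => //; exact: ltW.
Qed.

Unset Implicit Arguments.

Theorem theorem1p2 (R : realType) (alpha s a : R)
    (halpha : 2^-1 < alpha <= 1) (hs : 2^-1 < s) (ha : a <= 2 * alpha - 1) :
  [/\ forall (sigma : R) (u0 : R -> R[i]) (I : set R) (u : R -> R -> R[i]),
        sigma = 1 \/ sigma = -1 -> inH s u0 ->
        fNLS_maximal_solution alpha s sigma u0 I u ->
        CtH (s + a) I (smoothing_diff alpha sigma u0 u),
      forall s0 : R, 2^-1 < s0 <= s ->
        exists C : R,
        forall (sigma : R) (u0 : R -> R[i]) (I : set R) (u : R -> R -> R[i]),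
        sigma = 1 \/ sigma = -1 -> inH s u0 ->
        fNLS_maximal_solution alpha s sigma u0 I u ->
        forall t : R, I t ->
        Hnorm (s + a) (smoothing_diff alpha sigma u0 u t) <=
        C * (Hnorm s u0 * (1 + Hnorm s0 u0 ^+ 2)
             + Hnorm s (u t) * Hnorm s0 (u t) ^+ 2
             + `|oriented_integral 0 t (fun t' =>
                  Hnorm s (u t') *
                  (Hnorm s0 (u t') ^+ 2 + Hnorm s0 (u t') ^+ 4))|) &
      alpha <= s ->
        exists C : R -> R,
        forall (sigma : R) (u0 : R -> R[i]) (I : set R) (u : R -> R -> R[i]),
        sigma = 1 \/ sigma = -1 -> inH s u0 ->
        fNLS_maximal_solution alpha s sigma u0 I u ->
        forall t : R, I t ->
        Hnorm (s + a) (smoothing_diff alpha sigma u0 u t) <=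
        C (Hnorm alpha u0) *
          (Hnorm s u0 + Hnorm s (u t)
           + `|oriented_integral 0 t (fun t' => Hnorm s (u t'))|)].
Proof.
have ra : s + a <= s + (2 * alpha - 1) by rewrite lerD2l.
have [W HW] := @l1le_inv_abs R.
split.
(* Continuity in time calls for one admissible exponent s0, and s itself is taken. *)
- move=> sigma u0 I u hsigma u0H [uS _].
  have [Z Z0 HZ] := l1le_of_hle hs.
  have [Cp Cp0 HC] := jpow_div_phase halpha hs (lexx s).
  exact: (smoothing_diff_CtH halpha hs (lexx s) Z0 Cp0 HZ HC HW hsigma u0H uS ra).
- move=> s0 /andP[hs0 s0s]; have [Z Z0 HZ] := l1le_of_hle hs0.
  have [Cp Cp0 HC] := jpow_div_phase halpha hs0 s0s.
  exists (3 * phase_cst Z Cp W + profile_cst s s0 Z Cp W).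
  move=> sigma u0 I u hsigma u0H [uS _] t It.
  have F := solution_flow halpha hs0 s0s Z0 Cp0 HZ HC HW hsigma u0H uS.
  have [_ /le_trans] := smoothing_diff_bound halpha hs0 s0s Z0 Cp0 HZ HC HW hsigma
    u0H uS ra It.
  apply; set i := `|oriented_integral _ _ _|.
  have i0 : 0 <= i by exact: normr_ge0.
  have ph0 := phase_cst_ge0 F; have pr0 := profile_cst_ge0 F.
  have x0 : 0 <= Hnorm s u0 by exact: Hnorm_ge0.
  have y0 : 0 <= Hnorm s (u t) * Hnorm s0 (u t) ^+ 2.
    by rewrite mulr_ge0 ?sqr_ge0 ?Hnorm_ge0.
  have z0 : 0 <= Hnorm s u0 * Hnorm s0 u0 ^+ 2 by rewrite mulr_ge0 ?sqr_ge0.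
  have lin (p r x y z j : R) : 0 <= p * x -> 0 <= r * x -> 0 <= r * (x * y) ->
      0 <= r * z -> 0 <= p * j ->
      3 * p * (x * y) + 3 * p * z + r * j <= (3 * p + r) * (x * (1 + y) + z + j).
    by clear; lra.
  exact: (lin _ _ _ _ _ _ (mulr_ge0 ph0 x0) (mulr_ge0 pr0 x0) (mulr_ge0 pr0 z0)
      (mulr_ge0 pr0 y0) (mulr_ge0 ph0 i0)).
(* Now s0 = alpha, the norm that the energy controls. *)
move=> als; have [ha0 _] := andP halpha; have [Z Z0 HZ] := l1le_of_hle ha0.
have [Cp Cp0 HC] := jpow_div_phase halpha ha0 als.
(* The constant has to be a function on all of R for [choice]; negative q, which are not norms, get
   the value 0. *)
pose bound q B := 0 <= B /\ (0 <= q -> forall s sigma P Cp W I c N ns n0,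
  fourier_flow alpha s alpha sigma P Z Cp W I c N ns n0 -> n0 0 = q ->
  forall t, I t -> hle alpha (@ComplexField.Normc.normc R \o c t) B).
have /choice[B HB] : forall q, exists B, bound q B.
  move=> q; have [q0|q0] := leP 0 q.
    by have [B B0 HB] := energy_bound halpha Z0 q0; exists B.
  by exists 0; split => // /le_lt_trans /(_ q0); rewrite ltxx.
pose p := phase_cst Z Cp W; pose r := profile_cst s alpha Z Cp W.
(* The H^alpha norms are replaced by their bound B: squares in the boundary terms, square plus
   fourth power in the integral. *)
exists (fun q => 3 * p * B q ^+ 2 + r * (B q ^+ 2 + B q ^+ 4)).
move=> sigma u0 I u hsigma u0H [uS _] t It.
have F := solution_flow halpha ha0 als Z0 Cp0 HZ HC HW hsigma u0H uS.
have [_ /le_trans] := smoothing_diff_bound halpha ha0 als Z0 Cp0 HZ HC HW hsigma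
  u0H uS ra It.
apply; rewrite -/p -/r; have [[oI iI I0] uC _ _] := uS.
have [B0 {}HB] := HB (Hnorm alpha u0); move: (B _) B0 HB => b b0 HB.
have bt x : I x -> Hnorm alpha (u x) <= b.
  move=> Ix; apply: (Hnorm_le b0 _).2; apply: (HB (Hnorm_ge0 _ _) _ _ _ _ _ _ _ _ _ _ F _ x Ix).
  exact: (solution_init_Hnorm u0H uS).
have bE m x : I x -> Hnorm alpha (u x) ^+ m <= b ^+ m.
  by move=> Ix; rewrite lerXn2r ?nnegrE ?Hnorm_ge0 ?bt.
have b2 : 0 <= b ^+ 2 by exact: sqr_ge0.
have b4 : 0 <= b ^+ 2 + b ^+ 4 by rewrite addr_ge0 // exprn_ge0.
have p0 : 0 <= p by exact: phase_cst_ge0 F.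
have r0 : 0 <= r by exact: profile_cst_ge0 F.
have h0 x : 0 <= Hnorm s x by exact: Hnorm_ge0.
have i1 : `|oriented_integral 0 t (fun t' => Hnorm s (u t') *
    (Hnorm alpha (u t') ^+ 2 + Hnorm alpha (u t') ^+ 4))| <=
    (b ^+ 2 + b ^+ 4) * `|oriented_integral 0 t (fun t' => Hnorm s (u t'))|.
  apply: (oriented_integral_le oI iI I0 It b4 (density_continuous F) (flow_ns_cont F)).
    by move=> x _; exact: density_ge0 F x.
  by move=> x Ix; rewrite /density mulrC ler_wpM2r // lerD ?bE.
have z1 : Hnorm s u0 * Hnorm alpha u0 ^+ 2 <= Hnorm s u0 * b ^+ 2.
  by apply: ler_wpM2l => //; rewrite -(solution_init_Hnorm u0H uS) bE.
have y1 : Hnorm s (u t) * Hnorm alpha (u t) ^+ 2 <= Hnorm s (u t) * b ^+ 2.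
  by apply: ler_wpM2l => //; exact: bE.
set i := `|oriented_integral _ _ _| in i1 *.
set j := `|oriented_integral _ _ _| in i1 *.
have j0 : 0 <= j by exact: normr_ge0.
apply: (@le_trans _ _ (3 * p * (Hnorm s u0 * b ^+ 2) +
    3 * p * (Hnorm s (u t) * b ^+ 2) + r * ((b ^+ 2 + b ^+ 4) * j))).
  have p3 : 0 <= 3 * p by rewrite mulr_ge0.
  exact: (lerD (lerD (ler_wpM2l p3 z1) (ler_wpM2l p3 y1)) (ler_wpM2l r0 i1)).
have lin (p' r' b' q x y z : R) : 0 <= r' * q * x -> 0 <= r' * q * y ->
    0 <= p' * b' * z -> 3 * p' * (x * b') + 3 * p' * (y * b') + r' * (q * z) <=
    (3 * p' * b' + r' * q) * (x + y + z) by clear; lra.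
have pb := mulr_ge0 p0 b2; have rq := mulr_ge0 r0 b4.
exact: (lin _ _ _ _ _ _ _ (mulr_ge0 rq (h0 _)) (mulr_ge0 rq (h0 _)) (mulr_ge0 pb j0)).
Qed.
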